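(* Let $\gamma>0$, $\rho<0$, and let $X_1,\dots,X_n$ be i.i.d. nonnegative random variables with distribution function $F$ whose quantile function $U(t)=F^{\leftarrow}(1-1/t)$, $t\ge1$, satisfies the second-order condition: there is a measurable function $A$, of constant sign near infinity, not identically zero, with $A(t)\to0$ as $t\to\infty$, such that $$\lim_{t\to\infty}\frac{U(tx)/U(t)-x^{\gamma}}{A(t)}=x^{\gamma}\frac{x^{\rho}-1}{\rho}\quad\text{for all }x>0.$$ Let $r\in\mathbb{R}$ with $\gamma r<1/2$, and let $k=k(n)$ be integers with $1\le k<n$, $k(n)\to\infty$, $n/k(n)\to\infty$, and $\lim_{n\to\infty}\sqrt{k}\,A(n/k)=\mu\in(-\infty,\infty)$. Then, as $n\to\infty$, $$\sqrt{k}\big(G_n(k,r,0)-\xi(r,0),\ G_n(k,r,1)-\xi(r,1)\big)\xrightarrow{d}\mu\big(\nu^{(1)}(r),\nu^{(2)}(r)\big)+\big(W^{(1)},W^{(2)}\big),$$ where, with $d_r(m)=1-m\gamma r$, $$\nu^{(1)}(r)=\frac{r}{d_r(1)(d_r(1)-\rho)},\qquad \nu^{(2)}(r)=\frac{1-\rho-\gamma^2r^2}{d_r(1)^2(d_r(1)-\rho)^2},$$ and $(W^{(1)},W^{(2)})$ is a zero-mean Gaussian random vector with $\mathrm{E}(W^{(1)})^2=s_1^2(r)$, $\mathrm{E}(W^{(2)})^2=s_2^2(r)$, $\mathrm{E}(W^{(1)}W^{(2)})=s_{12}(r)$, where $$s_1^2(r)=\frac{\gamma^2r^2}{d_r(2)d_r(1)^2},\quad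 s_2^2(r)=\frac{\gamma^2\big(d_r(2)+2\gamma^4r^4\big)}{d_r(2)^3d_r(1)^4},\quad s_{12}(r)=\frac{\gamma^2 r\big(d_r(1)-\gamma^2r^2\big)}{d_r(2)^2d_r(1)^3}.$$
   Context: For a monotone function $W$, $W^{\leftarrow}(t)=\sup\{x: W(x)\le t\}$. $X_{n,1}\le\dots\le X_{n,n}$ are the order statistics of $X_1,\dots,X_n$. For $x\ge1$, $g_{r,u}(x)=x^r(\ln x)^u$, and $G_n(k,r,u)=\frac1k\sum_{i=0}^{k-1} g_{r,u}\big(X_{n-i,n}/X_{n-k,n}\big)$. Also $\xi(r,u)=\gamma^u\Gamma(1+u)/(1-\gamma r)^{1+u}$, so $\xi(r,0)=1/(1-\gamma r)$ and $\xi(r,1)=\gamma/(1-\gamma r)^2$. $\xrightarrow{d}$ denotes convergence in distribution. *)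

(* Defs.v *)
From HB Require Import structures.
From mathcomp Require Import all_boot all_order all_algebra.
From mathcomp Require Import all_classical all_reals all_analysis.
From mathcomp Require Import normal_distribution.

Set Implicit Arguments.
Unset Strict Implicit.
Unset Printing Implicit Defensive.

Import Order.TTheory GRing.Theory Num.Theory.
Import numFieldNormedType.Exports.
Local Open Scope classical_set_scope.
Local Open Scope ring_scope.

Definition geninv {R : realType} (W : R -> R) (t : R) : R :=
  sup [set x | W x <= t].

Definition tail_quantile {R : realType} (F : R -> R) (t : R) : R :=
  geninv F (1 - t^-1).

(* Order statistic X_{j,n} (j = 1..n) of the sample X_1,...,X_n, where the
   sample X_1,...,X_n is (X 0, ..., X (n-1)):  the j-th smallest value. *)
Definition order_stat {T : Type} {R : realType} (X : nat -> T -> R)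
  (n j : nat) (w : T) : R :=
  nth 0 (sort <=%R [seq X i w | i <- iota 0 n]) j.-1.

Definition g_ru {R : realType} (r : R) (u : nat) (x : R) : R :=
  x `^ r * (ln x) ^+ u.

Definition G_stat {T : Type} {R : realType} (X : nat -> T -> R)
  (n k : nat) (r : R) (u : nat) (w : T) : R :=
  k%:R^-1 * \sum_(0 <= i < k)
     g_ru r u (order_stat X n (n - i) w / order_stat X n (n - k) w).

(* xi(r,u) = gamma^u Gamma(1+u) / (1 - gamma r)^(1+u), for natural u
   (Gamma(1+u) = u!). *)
Definition xi_ru {R : realType} (gamma r : R) (u : nat) : R :=
  gamma ^+ u * (u`!)%:R / (1 - gamma * r) ^+ u.+1.

Definition mutually_independent {d} {T : measurableType d} {R : realType}
  (P : probability T R) (X : nat -> T -> R) : Prop :=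
  forall (s : seq nat) (B : nat -> set R), uniq s ->
    (forall i, measurable (B i)) ->
    P (\big[setI/setT]_(i <- s) (X i @^-1` B i)) =
      (\prod_(i <- s) P (X i @^-1` B i))%E.

Definition gauss_law {R : realType} (m v : R) : set R -> \bar R :=
  if 0 < v then normal_prob m (Num.sqrt v) else \d_m.

Definition is_normal_rv {d} {T : measurableType d} {R : realType}
  (Q : probability T R) (Z : T -> R) (m v : R) : Prop :=
  measurable_fun setT Z /\
  forall B : set R, measurable B -> Q (Z @^-1` B) = gauss_law m v B.

(* (W1, W2) is a zero-mean Gaussian vector with E W1^2 = v1, E W2^2 = v2,
   E W1 W2 = c12: every linear combination is normal with mean 0 and the
   corresponding variance. *)
Definition centered_gaussian_vector {d} {T : measurableType d} {R : realType}
  (Q : probability T R) (W1 W2 : T -> R) (v1 v2 c12 : R) : Prop :=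
  forall a b : R,
    is_normal_rv Q (fun w => a * W1 w + b * W2 w) 0
      (a ^+ 2 * v1 + 2 * a * b * c12 + b ^+ 2 * v2).

Definition cvg_in_distribution {d} {T : measurableType d} {R : realType}
  (P : probability T R) (Y : nat -> T -> R * R)
  {d'} {T' : measurableType d'} (Q : probability T' R) (Z : T' -> R * R) : Prop :=
  forall f : R * R -> R, continuous f -> (exists M : R, forall z, `|f z| <= M) ->
    (\int[P]_w (f (Y n w))%:E)%E @[n --> \oo] --> (\int[Q]_w (f (Z w))%:E)%E.

(* Main.v *)
Require Import Defs.
From HB Require Import structures.
From mathcomp Require Import all_boot all_order all_algebra.
From mathcomp Require Import all_classical all_reals all_analysis.
From mathcomp Require Import normal_distribution exponential_distribution.
From mathcomp Require Import measurable_realfun zify ring lra.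
Import Order.TTheory GRing.Theory Num.Theory.
Import numFieldNormedType.Exports.
Local Open Scope classical_set_scope.
Local Open Scope ring_scope.

(* With [u z = U (exp z)] the sample is distributed as [u Z_1, ..., u Z_n] for
   i.i.d. standard exponential [Z_i].  By symmetry one may assume that the
   [(k+1)]-st largest coordinate is the first one; given its value [s], the
   exceedances [Z_i - s] are again i.i.d. exponential, and the statistic is a sum
   of [k] independent terms, functions of [ln (u (s + z)) - ln (u s)].  The
   second-order condition, through the uniform convergence theorem, controls
   this increment by [gamma z + O(A (exp s))] uniformly in [z >= 0].  A
   second-order expansion of [cos] for one term, uniform in the phase and for
   [s] in a window around [ln (n / k)], is then multiplied over the [k] terms;
   Chebyshev's inequality for the number of exceedances discards the other
   values of [s].  This gives the convergence of [E cos (a Y_1 + b Y_2 + c)] for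
   all [a, b, c], which implies convergence in distribution: convolution with a
   Gaussian density, itself a mixture of cosines, reduces bounded Lipschitz
   functions to that case, and an infimal convolution reduces continuous
   functions to Lipschitz ones. *)

Set Implicit Arguments.
Unset Strict Implicit.
Unset Printing Implicit Defensive.

(** * Integrals of real-valued functions *)

(** Knowing [cos (b + x)] for every phase [b] amounts to knowing the complex exponential, so
    products over the exceedances can be handled with real integrals, provided each one-term
    estimate bounds its error before [b] is chosen. A term is compared not with its Taylor
    polynomial, which does not multiply well, but with [expR (- v / (2 k)) * cos (b + m / k)], whose
    [k]-fold composition is exactly [expR (- v / 2) * cos (b + m)]; an error [e / k] per term then
    costs [e] in total. The condition [gamma * r < 1/2] makes a term square integrable: its square
    grows like [expR (2 gamma r z)], up to a polynomial, against the density [expR (- z)]. [F] may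
    have atoms, so the [X_i] may have ties; the exponential variables have none almost surely, and
    the nondecreasing [u] carries their ranks over to the sample. The window for [s] has a fixed
    half-width [eta] depending only on the required accuracy, and Chebyshev's error is a constant
    depending on [eta], divided by [k]. *)

Lemma bounded_integrable {d} {T : measurableType d} {R : realType}
    (mu : {finite_measure set T -> \bar R}) (f : T -> R) (M : R) :
  measurable_fun setT f -> (forall x, `|f x| <= M) ->
  mu.-integrable setT (EFin \o f).
Proof.
move=> mf fM; apply: measurable_bounded_integrable => //.
  by rewrite fin_num_fun_lty//; exact: fin_num_measure.
exists M; split; first exact: num_real.
by move=> x Mx y _; exact: le_trans (fM y) (ltW Mx).
Qed.

Lemma integrable_funD {d} {T : measurableType d} {R : realType}
    (mu : {measure set T -> \bar R}) (f g : T -> R) :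
  mu.-integrable setT (EFin \o f) -> mu.-integrable setT (EFin \o g) ->
  mu.-integrable setT (EFin \o (fun x => f x + g x)).
Proof. exact: (@integrableD _ _ _ mu setT measurableT (EFin \o f) (EFin \o g)). Qed.

Lemma integrable_funB {d} {T : measurableType d} {R : realType}
    (mu : {measure set T -> \bar R}) (f g : T -> R) :
  mu.-integrable setT (EFin \o f) -> mu.-integrable setT (EFin \o g) ->
  mu.-integrable setT (EFin \o (fun x => f x - g x)).
Proof. exact: (@integrableB _ _ _ mu setT measurableT (EFin \o f) (EFin \o g)). Qed.

Lemma integrable_funZl {d} {T : measurableType d} {R : realType}
    (mu : {measure set T -> \bar R}) (c : R) (f : T -> R) :
  mu.-integrable setT (EFin \o f) ->
  mu.-integrable setT (EFin \o (fun x => c * f x)).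
Proof. exact: (@integrableZl _ _ _ mu setT measurableT c (EFin \o f)). Qed.

Lemma Rintegral_prob_cst {d} {T : measurableType d} {R : realType}
    (P : probability T R) (c : R) : \int[P]_x c = c.
Proof. by rewrite Rintegral_cst//= probability_setT mulr1. Qed.

Lemma integral_EFin_Rintegral {d} {T : measurableType d} {R : realType}
    (mu : {measure set T -> \bar R}) (f : T -> R) :
  mu.-integrable setT (EFin \o f) ->
  (\int[mu]_x (f x)%:E = (\int[mu]_x f x)%R%:E)%E.
Proof. by move=> fi; rewrite /Rintegral fineK// integrable_fin_num. Qed.

Lemma Rintegral_le_bound {d} {T : measurableType d} {R : realType}
    (P : probability T R) (f : T -> R) (M : R) :
  P.-integrable setT (EFin \o f) -> (forall x, `|f x| <= M) ->
  `|\int[P]_x f x| <= M.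
Proof.
move=> fi fM; apply: (le_trans (le_normr_Rintegral measurableT fi)).
rewrite -[leRHS](Rintegral_prob_cst P); apply: le_Rintegral => //.
- exact: integrable_norm.
- exact: (finite_measure_integrable_cst P M).
Qed.

Lemma Rintegral_dist_le {d} {T : measurableType d} {R : realType}
    (mu : {measure set T -> \bar R}) (f g h : T -> R) :
  mu.-integrable setT (EFin \o f) -> mu.-integrable setT (EFin \o g) ->
  mu.-integrable setT (EFin \o h) ->
  (forall x, `|f x - g x| <= h x) ->
  `|\int[mu]_x f x - \int[mu]_x g x| <= \int[mu]_x h x.
Proof.
move=> fi gi hi fgh; rewrite -RintegralB//.
have fgi := integrable_funB fi gi.
apply: (le_trans (le_normr_Rintegral measurableT fgi)).
apply: le_Rintegral => //; exact: integrable_norm.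
Qed.

Lemma Rintegral_dct {d} {T : measurableType d} {R : realType}
    (mu : {measure set T -> \bar R}) (f_ : nat -> T -> R) (f g : T -> R) :
  (forall n, measurable_fun setT (f_ n)) -> measurable_fun setT f ->
  mu.-integrable setT (EFin \o g) ->
  {ae mu, forall x, f_ n x @[n --> \oo] --> f x} ->
  {ae mu, forall x n, `|f_ n x| <= g x} ->
  \int[mu]_x f_ n x @[n --> \oo] --> \int[mu]_x f x.
Proof.
move=> mf_ mf ig ff fg.
have [fi _ cv] : [/\ mu.-integrable setT (EFin \o f),
    ((\int[mu]_x `|(f_ n x)%:E - (f x)%:E|)%E @[n --> \oo] --> 0%E) &
    ((\int[mu]_x (f_ n x)%:E)%E @[n --> \oo] --> (\int[mu]_x (f x)%:E)%E)].
  apply: (@dominated_convergence _ _ _ mu _ measurableT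
    (fun n x => (f_ n x)%:E) (EFin \o f) (EFin \o g)) => //.
  - by move=> n; exact/measurable_EFinP.
  - exact/measurable_EFinP.
  - apply: filterS ff => x ffx _.
    by apply: cvg_EFin => //; exact: nearW.
  - by apply: filterS fg => x fgx n _; rewrite lee_fin.
apply: fine_cvg; rewrite /Rintegral fineK//; exact: integrable_fin_num.
Qed.

Lemma density_dominates {d} {T : measurableType d} {R : realType}
    (nu : {measure set T -> \bar R}) (mu : {measure set T -> \bar R})
    (g : T -> R) :
  measurable_fun setT g ->
  (forall A, measurable A -> nu A = (\int[mu]_(x in A) (g x)%:E)%E) ->
  nu `<< mu.
Proof.
move=> mg nuE; apply/null_content_dominatesP => A mA muA0.
rewrite nuE//; apply: null_set_integral => //.
by apply/measurable_funTS; exact/measurable_EFinP.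
Qed.

(** The change of variables holds for the Radon-Nikodym derivative of [nu]; that derivative has the
    same integral as [g] over every measurable set, hence equals [g] almost everywhere. *)
Lemma ge0_integral_density {d} {T : measurableType d} {R : realType}
    (nu : {finite_measure set T -> \bar R})
    (mu : {sigma_finite_measure set T -> \bar R})
    (g : T -> R) (f : T -> R) :
  measurable_fun setT g -> (forall x, 0 <= g x) ->
  (forall A, measurable A -> nu A = (\int[mu]_(x in A) (g x)%:E)%E) ->
  measurable_fun setT f -> (forall x, 0 <= f x) ->
  (\int[nu]_x (f x)%:E = \int[mu]_x (f x * g x)%:E)%E.
Proof.
move=> mg g0 nuE mf f0.
have numu := density_dominates mg nuE.
have h0 := Radon_Nikodym_SigmaFinite.f_ge0 numu.
have hi := Radon_Nikodym_SigmaFinite.f_integrable numu.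
have hE := Radon_Nikodym_SigmaFinite.f_integral numu.
set h := Radon_Nikodym_SigmaFinite.f nu mu in h0 hi hE.
have hg : ae_eq mu setT h (EFin \o g).
  apply: integral_ae_eq => //; first exact/measurable_EFinP.
  by move=> E _ mE; rewrite -hE// nuE.
have := @Radon_Nikodym_SigmaFinite.change_of_variables _ _ _ nu mu numu
  (EFin \o f) setT (fun x => f0 x) measurableT _.
move=> <-; last exact/measurable_EFinP.
apply: ge0_ae_eq_integral => //.
- apply: emeasurable_funM; first exact/measurable_EFinP.
  exact: measurable_int hi.
- by apply/measurable_EFinP; exact: measurable_funM.
- by move=> x _; rewrite mule_ge0// lee_fin.
- by move=> x _; rewrite lee_fin mulr_ge0.
- by apply: filterS hg => x /(_ I) hx _; rewrite /= -/h hx /= EFinM.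
Qed.

Lemma integrable_density {d} {T : measurableType d} {R : realType}
    (nu : {finite_measure set T -> \bar R})
    (mu : {sigma_finite_measure set T -> \bar R})
    (g : T -> R) (f : T -> R) :
  measurable_fun setT g -> (forall x, 0 <= g x) ->
  (forall A, measurable A -> nu A = (\int[mu]_(x in A) (g x)%:E)%E) ->
  measurable_fun setT f ->
  nu.-integrable setT (EFin \o f) <->
  mu.-integrable setT (EFin \o (fun x => f x * g x)).
Proof.
move=> mg g0 nuE mf.
have mnf : measurable_fun setT (fun x => `|f x|) by exact: measurableT_comp.
have E := ge0_integral_density mg g0 nuE mnf (fun x => normr_ge0 (f x)).
split=> /integrableP[m fi]; apply/integrableP; split.
- by apply/measurable_EFinP; exact: measurable_funM.
- under eq_integral do rewrite /= normrM (ger0_norm (g0 _)).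
  by rewrite -E.
- exact/measurable_EFinP.
- rewrite /= E; move: fi; under eq_integral do rewrite /= normrM (ger0_norm (g0 _)).
  by [].
Qed.

Lemma Rintegral_density {d} {T : measurableType d} {R : realType}
    (nu : {finite_measure set T -> \bar R})
    (mu : {sigma_finite_measure set T -> \bar R})
    (g : T -> R) (f : T -> R) :
  measurable_fun setT g -> (forall x, 0 <= g x) ->
  (forall A, measurable A -> nu A = (\int[mu]_(x in A) (g x)%:E)%E) ->
  nu.-integrable setT (EFin \o f) ->
  \int[nu]_x f x = \int[mu]_x (f x * g x).
Proof.
move=> mg g0 nuE fi.
have mf : measurable_fun setT f by apply/measurable_EFinP; exact: measurable_int fi.
have fgi := (integrable_density mg g0 nuE mf).1 fi.
pose fp := fun x => Num.max (f x) 0; pose fn := fun x => Num.max (- f x) 0.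
have mfp : measurable_fun setT fp by exact: measurable_maxr.
have mfn : measurable_fun setT fn.
  by apply: measurable_maxr => //; exact: measurableT_comp.
have fE : f = (fun x => fp x - fn x).
  apply/funext => x; rewrite /fp /fn; case: (leP (f x) 0) => f0.
    by rewrite (max_idPl _) ?oppr_ge0// sub0r opprK.
  by rewrite (max_idPr _) ?subr0// oppr_le0 ltW.
have fp0 x : 0 <= fp x by rewrite /fp le_max lexx orbT.
have fn0 x : 0 <= fn x by rewrite /fn le_max lexx orbT.
have fpi : nu.-integrable setT (EFin \o fp).
  apply: le_integrable fi => //; first exact/measurable_EFinP.
  move=> x _ /=; rewrite lee_fin ger0_norm// /fp; case: (leP (f x) 0) => // f0.
  by rewrite ler_norm.
have fni : nu.-integrable setT (EFin \o fn).
  apply: le_integrable fi => //; first exact/measurable_EFinP.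
  move=> x _ /=; rewrite lee_fin ger0_norm// /fn; case: (leP (- f x) 0) => // f0.
  by rewrite -normrN ler_norm.
have fpgi := (integrable_density mg g0 nuE mfp).1 fpi.
have fngi := (integrable_density mg g0 nuE mfn).1 fni.
rewrite fE RintegralB//.
transitivity (\int[mu]_x (fp x * g x) - \int[mu]_x (fn x * g x)).
  by rewrite /Rintegral (ge0_integral_density mg g0 nuE mfp fp0)
    (ge0_integral_density mg g0 nuE mfn fn0).
rewrite -RintegralB//; apply: eq_Rintegral => x _.
by rewrite mulrBl.
Qed.

(** The closed lower rays are stable under intersection, generate the Borel sets and exhaust the
    line, so uniqueness of measures applies. *)
Lemma eq_measure_cdf {R : realType}
    (m1 m2 : {finite_measure set (measurableTypeR R) -> \bar R}) :
  (forall x : R, m1 `]-oo, x]%classic = m2 `]-oo, x]%classic) ->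
  forall A, measurable A -> m1 A = m2 A.
Proof.
move=> m12.
pose G := [set A : set R | exists x, A = `]-oo, x]%classic].
move=> A mA.
apply: (@measure_unique _ R (measurableTypeR R) G (fun n => `]-oo, n%:R]%classic)) => //.
- rewrite RGenOInfty.measurableE; apply/seteqP; split.
    apply: smallest_sub; first exact: smallest_sigma_algebra.
    move=> _ [x ->]; rewrite -setCitvl.
    by apply: sigma_algebraC; apply: sub_sigma_algebra; exists x.
  apply: smallest_sub; first exact: smallest_sigma_algebra.
  move=> _ [x ->]; rewrite -setCitvr.
  by apply: sigma_algebraC; apply: sub_sigma_algebra; exists x.
- move=> _ _ [x ->] [y ->]; exists (Num.min x y).
  by apply/seteqP; split => z /=; rewrite !in_itv/= le_min => /andP.
- by move=> n; exists n%:R.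
- apply/seteqP; split => // x _.
  exists (Num.truncn x).+1 => //=; rewrite in_itv/=.
  by rewrite ltW// truncnS_gt.
- by move=> _ [x ->]; exact: m12.
- by move=> n; rewrite ltey_eq fin_num_measure.
Qed.

(** The image of Lebesgue measure under a translation gives intervals their length, which
    characterises Lebesgue measure. *)
Lemma lebesgue_measure_shift {R : realType} (a : R) (A : set R) :
  measurable A ->
  lebesgue_measure [set x | A (x + a)] = lebesgue_measure A.
Proof.
move=> mA.
have mf : @measurable_fun _ _ (measurableTypeR R) (measurableTypeR R) setT
    (fun x : R => x + a) by exact: measurable_funD.
have := @lebesgue_measure_unique R
  (measure_function_pushforward__canonical__measure_function_Measure
     lebesgue_measure mf) _ A mA.
move=> ->//.
move=> _ [[x y]] /= _ <-; rewrite /pushforward/=.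
rewrite (_ : _ @^-1` _ = `]x - a, y - a]%classic); last first.
  by apply/seteqP; split => z /=; rewrite !in_itv/= ltrBlDr lerBrDr.
rewrite !lebesgue_measure_itv/= !lte_fin ltrD2r.
by case: ifP => // _; rewrite -!EFinB; congr EFin; ring.
Qed.

(** * Independent samples *)

Definition prod_prob {d1 d2} {T1 : measurableType d1} {T2 : measurableType d2}
  {R : realType} (P1 : probability T1 R) (P2 : probability T2 R) :
  probability (T1 * T2)%type R := (P1 \x P2)%E.

Lemma Rintegral_prod {d1 d2} {T1 : measurableType d1} {T2 : measurableType d2}
    {R : realType} (P1 : probability T1 R) (P2 : probability T2 R)
    (f : T1 * T2 -> R) (M : R) :
  measurable_fun setT f -> (forall z, `|f z| <= M) ->
  \int[prod_prob P1 P2]_z f z = \int[P1]_x \int[P2]_y f (x, y).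
Proof.
move=> mf fM.
have fi := @bounded_integrable _ _ _ (prod_prob P1 P2) f M mf fM.
rewrite [LHS]/Rintegral -integral12_prod_meas1// [RHS]/Rintegral.
congr fine; apply: eq_integral => x _.
rewrite /fubini_F -[LHS]fineK//.
apply: integrable_fin_num => //.
apply: (@bounded_integrable _ _ _ _ _ M) => //.
by apply: measurableT_comp mf _; exact: measurable_fun_pair.
Qed.

Lemma Rintegral_swap {d1 d2} {T1 : measurableType d1} {T2 : measurableType d2}
    {R : realType} (P1 : probability T1 R) (P2 : probability T2 R)
    (f : T1 * T2 -> R) (M : R) :
  measurable_fun setT f -> (forall z, `|f z| <= M) ->
  \int[P1]_x \int[P2]_y f (x, y) = \int[P2]_y \int[P1]_x f (x, y).
Proof.
move=> mf fM; rewrite -(Rintegral_prod P1 P2 mf fM).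
have fi := @bounded_integrable _ _ _ (prod_prob P1 P2) f M mf fM.
rewrite [LHS]/Rintegral -integral21_prod_meas1// [RHS]/Rintegral.
congr fine; apply: eq_integral => x _.
rewrite /fubini_G -[LHS]fineK//.
apply: integrable_fin_num => //.
apply: (@bounded_integrable _ _ _ _ _ M) => //.
by apply: measurableT_comp mf _; exact: measurable_fun_pair.
Qed.

Lemma measurable_Rintegral2 {d1 d2} {T1 : measurableType d1}
    {T2 : measurableType d2} {R : realType} (P2 : probability T2 R)
    (f : T1 * T2 -> R) (M : R) :
  measurable_fun setT f -> (forall z, `|f z| <= M) ->
  measurable_fun setT (fun x => \int[P2]_y f (x, y)).
Proof.
move=> mf fM.
(* Adding [M] makes the integrand nonnegative, so that Tonelli's theorem gives measurability; the
   constant is subtracted afterwards. *)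
have mg : measurable_fun setT (fun z => f z + M) by exact: measurable_funD.
have g0 z : 0 <= f z + M by have := fM z; rewrite ler_norml -lerBlDr sub0r => /andP[].
have fi x : P2.-integrable setT (EFin \o (fun y => f (x, y))).
  apply: (@bounded_integrable _ _ _ _ _ M) => //.
  by apply: measurableT_comp mf _; exact: measurable_fun_pair.
have mE : measurable_fun setT (fun z => (f z + M)%:E) by exact/measurable_EFinP.
have m := @measurable_fun_fubini_tonelli_F _ _ T1 T2 R P2
  (fun z => (f z + M)%:E) mE (fun z => g0 z).
rewrite (_ : (fun x => _) = (fun x => fine (\int[P2]_y (f (x, y) + M)%:E) - M)).
  apply: measurable_funB => //; exact: measurableT_comp m.
apply/funext => x; rewrite -[fine _]/(Rintegral _ _ _) RintegralD//.
  by rewrite Rintegral_prob_cst addrK.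
exact: finite_measure_integrable_cst.
Qed.

Definition tcons {d} {T : measurableType d} {n} (z : T * n.-tuple T) :
  n.+1.-tuple T := [tuple of z.1 :: z.2].

Lemma measurable_tcons {d} {T : measurableType d} {n} :
  measurable_fun setT (@tcons d T n).
Proof. exact: (measurable_cons measurable_fst measurable_snd). Qed.

HB.instance Definition _ {d} {T : measurableType d} {n} :=
  isMeasurableFun.Build _ _ _ _ (@tcons d T n) measurable_tcons.

(** The product law is built by pushing forward along [tcons], so that an integral peels off the
    first coordinate, the shape of all later inductions on the sample size. *)
Fixpoint tuple_prob {d} {T : measurableType d} {R : realType}
    (P : probability T R) (n : nat) : probability (n.-tuple T) R :=
  match n with
  | 0 => \d_[tuple]
  | m.+1 => distribution (prod_prob P (tuple_prob P m)) (@tcons d T m)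
  end.

Definition rectangle {T : Type} {n : nat} (B : 'I_n -> set T) : set (n.-tuple T) :=
  [set t | forall i, B i (tnth t i)].

Lemma measurable_rectangle {d} {T : measurableType d} {n : nat}
    (B : 'I_n -> set T) :
  (forall i, measurable (B i)) -> measurable (rectangle B).
Proof.
move=> mB.
rewrite (_ : rectangle B = \big[setI/setT]_(i < n) ((fun t => tnth t i) @^-1` B i)).
  apply: big_ind => //; first by move=> A C; exact: measurableI.
  move=> i _; rewrite -[X in measurable X]setTI.
  exact: (measurable_tnth i).
rewrite -bigcap_seq; apply/seteqP; split => t /= h i; first by move=> _; exact: h.
by apply: h; rewrite /= mem_index_enum.
Qed.

(** Rectangles, unlike the generating preimages under one coordinate, are stable under intersection,
    as the uniqueness of measures demands. *)
Lemma measurable_tuple_rectangleE {d} {T : measurableType d} {n : nat} :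
  @measurable _ (n.-tuple T) = <<s [set A | exists B : 'I_n -> set T,
    (forall i, measurable (B i)) /\ A = rectangle B] >>.
Proof.
apply/seteqP; split; last first.
  apply: smallest_sub; first exact: sigma_algebra_measurable.
  by move=> _ [B [mB ->]]; exact: measurable_rectangle.
apply: smallest_sub; first exact: smallest_sigma_algebra.
move=> A /=; rewrite -bigcup_seq/= => -[i _ [C mC <-]].
apply: sub_sigma_algebra; exists (fun j => if j == i then C else setT); split.
  by move=> j; case: ifP.
apply/seteqP; split => t /=.
  by move=> [_ Ct] j; case: eqP => [->|].
by move=> /(_ i); rewrite eqxx; split.
Qed.

Lemma eq_measure_rectangle {d} {T : measurableType d} {R : realType} {n : nat}
    (m1 m2 : probability (n.-tuple T) R) :
  (forall B : 'I_n -> set T, (forall i, measurable (B i)) ->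
     m1 (rectangle B) = m2 (rectangle B)) ->
  forall A, measurable A -> m1 A = m2 A.
Proof.
move=> m12 A mA.
apply: (measure_unique _ (fun=> setT) measurable_tuple_rectangleE) => //.
- move=> _ _ [B [mB ->]] [C [mC ->]]; exists (fun i => B i `&` C i); split.
    by move=> i; exact: measurableI.
  apply/seteqP; split => t /=; first by move=> [h1 h2] i; split.
  by move=> h; split => i; have [] := h i.
- by move=> _; exists (fun=> setT); split => //; apply/seteqP; split.
- by apply/seteqP; split => // t _; exists 0%N.
- by move=> _ [B [mB ->]]; exact: m12.
- by move=> _; rewrite ltey_eq fin_num_measure.
Qed.

Lemma tuple_prob_rectangle {d} {T : measurableType d} {R : realType}
    (P : probability T R) (n : nat) (B : 'I_n -> set T) :
  (forall i, measurable (B i)) ->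
  tuple_prob P n (rectangle B) = (\prod_(i < n) P (B i))%E.
Proof.
elim: n B => [|n IH] B mB /=.
  by rewrite big_ord0 diracE mem_set//; case.
rewrite big_ord_recl -IH//.
rewrite /distribution /pushforward.
rewrite (_ : _ @^-1` _ = B ord0 `*` rectangle (fun i => B (lift ord0 i))).
  rewrite /prod_prob product_measure1E//.
  by apply: measurable_rectangle => i; exact: mB.
apply/seteqP; split => -[x t] /=.
  move=> h; split; first by have := h ord0; rewrite tnth0.
  by move=> i; have := h (lift ord0 i); rewrite tnthS.
move=> [Bx Bt] i; case: (unliftP ord0 i) => [j|] ->; last by rewrite tnth0.
by rewrite tnthS; exact: Bt.
Qed.

Lemma Rintegral_tuple0 {d} {T : measurableType d} {R : realType}
    (P : probability T R) (f : 0.-tuple T -> R) :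
  measurable_fun setT f ->
  \int[tuple_prob P 0]_t f t = f [tuple].
Proof.
move=> mf; rewrite /Rintegral /= integral_dirac// ?diracE ?mem_set ?mul1e//.
exact/measurable_EFinP.
Qed.

Lemma Rintegral_pushforward {d1 d2} {T1 : measurableType d1}
    {T2 : measurableType d2} {R : realType} (P : probability T1 R)
    (phi : {mfun T1 >-> T2}) (f : T2 -> R) :
  measurable_fun setT f -> P.-integrable setT (EFin \o (f \o phi)) ->
  \int[distribution P phi]_y f y = \int[P]_x f (phi x).
Proof.
move=> mf fi; rewrite /Rintegral; congr fine.
by rewrite integral_distribution//; exact/measurable_EFinP.
Qed.

Lemma Rintegral_tupleS {d} {T : measurableType d} {R : realType}
    (P : probability T R) (n : nat) (f : n.+1.-tuple T -> R) (M : R) :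
  measurable_fun setT f -> (forall t, `|f t| <= M) ->
  \int[tuple_prob P n.+1]_t f t =
  \int[P]_x \int[tuple_prob P n]_t f (tcons (x, t)).
Proof.
move=> mf fM /=.
have mfc : measurable_fun setT (f \o (@tcons d T n)).
  by apply: measurableT_comp mf _; exact: measurable_tcons.
rewrite Rintegral_pushforward//.
  by rewrite (Rintegral_prod P (tuple_prob P n) mfc (fun z => fM _)).
exact: (@bounded_integrable _ _ _ (prod_prob P (tuple_prob P n)) _ M mfc (fun z => fM _)).
Qed.

Lemma eq_Rintegral_measure {d} {T : measurableType d} {R : realType}
    (m1 m2 : {measure set T -> \bar R}) (f : T -> R) :
  (forall A, measurable A -> m1 A = m2 A) ->
  \int[m1]_x f x = \int[m2]_x f x.
Proof.
by move=> m12; rewrite /Rintegral; congr fine; apply: eq_measure_integral => A mA _; exact: m12.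
Qed.

Lemma Rintegral_tuple_perm {d} {T : measurableType d} {R : realType}
    (P : probability T R) (n : nat) (s s' : 'I_n -> 'I_n) (f : n.-tuple T -> R) (M : R) :
  cancel s s' -> cancel s' s ->
  measurable_fun setT f -> (forall t, `|f t| <= M) ->
  \int[tuple_prob P n]_t f [tuple tnth t (s i) | i < n] =
  \int[tuple_prob P n]_t f t.
Proof.
move=> sK s'K mf fM.
pose phi (t : n.-tuple T) := [tuple tnth t (s i) | i < n].
have mphi : measurable_fun setT phi.
  apply/measurable_fun_tnthP => i.
  rewrite (_ : _ \o _ = (fun t => tnth t (s i))); first exact: measurable_tnth.
  by apply/funext => t /=; rewrite tnth_mktuple.
pose Phi : {mfun n.-tuple T >-> n.-tuple T} := mfun_Sub (mem_set mphi).
transitivity (\int[distribution (tuple_prob P n) Phi]_t f t).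
  rewrite Rintegral_pushforward//.
  apply: (@bounded_integrable _ _ _ _ _ M) => [|x]; last exact: fM.
  exact: measurableT_comp.
apply: eq_Rintegral_measure; apply: eq_measure_rectangle => B mB.
rewrite tuple_prob_rectangle//= /distribution /pushforward.
rewrite (_ : _ @^-1` _ = rectangle (fun i => B (s' i))).
  rewrite tuple_prob_rectangle// (reindex s)/=; last by exists s' => i _.
  by apply: eq_bigr => i _; rewrite sK.
apply/seteqP; split => t /= h i.
  by have := h (s' i); rewrite tnth_mktuple s'K.
by rewrite tnth_mktuple; have := h (s i); rewrite sK.
Qed.

(** Independence and the common marginal law give both vectors the same probability on rectangles,
    hence the same joint law. This is how the quantile transform reaches the whole sample. *)
Lemma Rintegral_independent_tuple {d d'} {T : measurableType d}
    {S : measurableType d'} {R : realType}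
    (P : probability T R) (Q : probability S R) (X : nat -> T -> R) (u : S -> R)
    (n : nat) (f : n.-tuple R -> R) (M : R) :
  mutually_independent P X -> (forall i, measurable_fun setT (X i)) ->
  measurable_fun setT u ->
  (forall i (B : set R), measurable B -> P (X i @^-1` B) = Q (u @^-1` B)) ->
  measurable_fun setT f -> (forall t, `|f t| <= M) ->
  \int[P]_w f [tuple X i w | i < n] =
  \int[tuple_prob Q n]_t f [tuple u (tnth t i) | i < n].
Proof.
move=> indX mX mu XQ mf fM.
have mphi : measurable_fun setT (fun w => [tuple X i w | i < n]).
  apply/measurable_fun_tnthP => i.
  rewrite (_ : _ \o _ = X i); first exact: mX.
  by apply/funext => t /=; rewrite tnth_mktuple.
have mpsi : measurable_fun setT (fun t : n.-tuple S => [tuple u (tnth t i) | i < n]).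
  apply/measurable_fun_tnthP => i.
  rewrite (_ : _ \o _ = (fun t => u (tnth t i))).
    by apply: measurableT_comp mu _; exact: measurable_tnth.
  by apply/funext => t /=; rewrite tnth_mktuple.
pose Phi : {mfun T >-> n.-tuple R} := mfun_Sub (mem_set mphi).
pose Psi : {mfun n.-tuple S >-> n.-tuple R} := mfun_Sub (mem_set mpsi).
transitivity (\int[distribution P Phi]_t f t).
  rewrite Rintegral_pushforward//.
  apply: (@bounded_integrable _ _ _ _ _ M) => [|x]; last exact: fM.
  exact: measurableT_comp.
transitivity (\int[distribution (tuple_prob Q n) Psi]_t f t); last first.
  rewrite Rintegral_pushforward//.
  apply: (@bounded_integrable _ _ _ _ _ M) => [|x]; last exact: fM.
  exact: measurableT_comp.
apply: eq_Rintegral_measure; apply: eq_measure_rectangle => B mB.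
rewrite /= /distribution /pushforward.
rewrite (_ : Psi @^-1` _ = rectangle (fun i => u @^-1` B i)); last first.
  apply/seteqP; split => t /= h i; have := h i; by rewrite tnth_mktuple.
rewrite tuple_prob_rectangle; last first.
  by move=> i; rewrite -[X in measurable X]setTI; exact: mu.
(* Independence is stated for families indexed by [nat]: extend [B] by the full set beyond [n]. *)
pose C (i : nat) := if insub i is Some j then B j else setT.
have CE (i : 'I_n) : C i = B i by rewrite /C valK.
have x := indX (iota 0 n) C (iota_uniq _ _) _.
move: x; rewrite -[iota 0 n]val_enum_ord !(@big_map _ _ _ _ _ val (enum 'I_n)) => x.
transitivity (P (\big[setI/setT]_(j <- enum 'I_n) (X j @^-1` C j))).
  congr (P _); rewrite -bigcap_seq; apply/seteqP; split => w /= h.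
    by move=> i _; have := h i; rewrite /= tnth_mktuple CE.
  by move=> i; rewrite tnth_mktuple -CE; apply: h; rewrite /= mem_enum.
rewrite x /=; last by move=> i; rewrite /C; case: insubP.
by rewrite big_enum /=; apply: eq_bigr => i _; rewrite XQ// CE.
Qed.

(** * Counting the coordinates above a threshold *)

Lemma measurable_sum_tuple {d} {T : measurableType d} {R : realType} {n : nat}
    (f : T -> n.-tuple R) (F : T * R -> R) :
  measurable_fun setT f -> measurable_fun setT F ->
  measurable_fun setT (fun z => \sum_(x <- f z) F (z, x)).
Proof.
move=> mf mF.
rewrite (_ : (fun z => _) = (fun z => \sum_(i < n) F (z, tnth (f z) i))).
  apply: measurable_sum => i; apply: measurableT_comp mF _.
  apply: measurable_fun_pair => //.
  by have /measurable_fun_tnthP := mf; exact.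
by apply/funext => z; rewrite big_tuple.
Qed.

Definition count_gt {R : realType} (s : R) (t : seq R) : nat :=
  count (fun x => s < x) t.

Lemma count_gtE {R : realType} (s : R) (t : seq R) :
  (count_gt s t)%:R = \sum_(x <- t) (s < x)%R%:R :> R.
Proof.
elim: t => [|x t IH]; first by rewrite big_nil.
by rewrite big_cons -IH /count_gt /= natrD.
Qed.

Lemma measurable_natr_bool {d} {T : measurableType d} {R : realType}
    (b : T -> bool) :
  measurable_fun setT b -> measurable_fun setT (fun z => (b z)%:R : R).
Proof.
move=> mb; rewrite (_ : (fun z => _) = (fun z => if b z then 1 else 0)).
  exact: measurable_fun_ifT.
by apply/funext => z; case: (b z).
Qed.

Lemma measurable_count_gt {d} {T : measurableType d} {R : realType} {n : nat}
    (f : T -> n.-tuple R) (g : T -> R) :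
  measurable_fun setT f -> measurable_fun setT g ->
  measurable_fun setT (fun z => (count_gt (g z) (f z))%:R : R).
Proof.
move=> mf mg; under eq_fun do rewrite count_gtE.
apply: (measurable_sum_tuple (F := fun z => (g z.1 < z.2)%R%:R)) => //.
apply: measurable_natr_bool; apply: measurable_fun_ltr => //.
exact: measurableT_comp.
Qed.

Lemma measurable_count_gt_eq {d} {T : measurableType d} {R : realType} {n : nat}
    (f : T -> n.-tuple R) (g : T -> R) (k : nat) :
  measurable_fun setT f -> measurable_fun setT g ->
  measurable_fun setT (fun z => (count_gt (g z) (f z) == k)%:R : R).
Proof.
move=> mf mg; apply: measurable_natr_bool.
rewrite (_ : (fun z => _) = (fun z => (count_gt (g z) (f z))%:R == k%:R :> R)).
  apply: measurable_fun_eqr => //; exact: measurable_count_gt.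
by apply/funext => z; rewrite eqr_nat.
Qed.

(** On a duplicate-free list [x |-> count_gt x t] is injective with values below [size t]; by the
    pigeonhole principle it takes the value [k] exactly once. *)
Lemma sum_count_gt_eq {R : realType} (t : seq R) (k : nat) :
  uniq t -> (k < size t)%N ->
  \sum_(x <- t) (count_gt x t == k)%:R = 1 :> R.
Proof.
move=> ut kt.
(* An entry [y] above [x] is counted for [x] but not for itself, which makes the inequality
   strict. *)
have mono x y : y \in t -> x < y -> (count_gt y t < count_gt x t)%N.
  move=> yt xy; rewrite /count_gt.
  have := count_predUI (fun z => y < z) (pred1 y) t.
  rewrite (@eq_count _ (predI _ _) pred0); last first.
    by move=> z /=; case: eqP => [->|]; rewrite ?ltxx ?andbF.
  rewrite count_pred0 addn0 => E.
  apply: (@leq_trans (count (predU (fun z => y < z) (pred1 y)) t)).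
    by rewrite E -addn1 leq_add2l -has_count has_pred1.
  by apply: sub_count => z /= /orP[/(lt_trans xy)//|/eqP ->].
pose c := [seq count_gt x t | x <- t].
have uc : uniq c.
  rewrite map_inj_in_uniq// => x y xt yt xy.
  by case: (ltgtP x y) => // [/(mono _ _ yt)|/(mono _ _ xt)]; rewrite xy ltnn.
have sc : {subset c <= iota 0 (size t)}.
  move=> _ /mapP[x xt ->]; rewrite mem_iota /= add0n /count_gt.
  rewrite ltn_neqAle count_size andbT.
  by apply/negP; rewrite -all_count => /allP/(_ x xt); rewrite /= ltxx.
have [_ cE] := uniq_min_size uc sc ltac:(by rewrite size_iota size_map).
rewrite -(big_map (fun x => count_gt x t) xpredT (fun i => (i == k)%:R)) -/c.
rewrite (bigD1_seq k)//=; last by rewrite cE mem_iota.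
by rewrite eqxx big1 ?addr0// => i /negPf ->.
Qed.

Definition swap0 {n : nat} (j i : 'I_n.+1) : 'I_n.+1 :=
  if i == ord0 then j else if i == j then ord0 else i.

Lemma swap0K {n : nat} (j : 'I_n.+1) : involutive (swap0 j).
Proof.
move=> i; rewrite /swap0; case: (eqVneq i ord0) => [->|i0].
  by case: (eqVneq j ord0) => [->|_]//; rewrite eqxx.
case: (eqVneq i j) => [->|ij]; first by rewrite eqxx.
by rewrite (negPf i0) (negPf ij).
Qed.

Lemma perm_tnth_swap0 {R : realType} {n : nat} (t : n.+1.-tuple R) (j : 'I_n.+1) :
  perm_eq [tuple tnth t (swap0 j i) | i < n.+1] t.
Proof.
rewrite /= -[X in perm_eq _ X](map_tnth_enum t).
rewrite (_ : [seq _ | i <- _] = [seq tnth t i | i <- [seq swap0 j i | i <- enum 'I_n.+1]]).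
  apply: perm_map; apply: uniq_perm; rewrite ?enum_uniq//.
    by rewrite map_inj_uniq ?enum_uniq//; exact: inv_inj (swap0K j).
  move=> i; rewrite mem_enum inE; apply/mapP; exists (swap0 j i).
    by rewrite mem_enum.
  by rewrite swap0K.
by rewrite -map_comp.
Qed.

Lemma Rintegral_bool {d} {T : measurableType d} {R : realType}
    (P : probability T R) (b : T -> bool) :
  measurable_fun setT b -> \int[P]_x (b x)%:R = fine (P [set x | b x]).
Proof.
move=> mb.
have mB : measurable [set x | b x] by rewrite -[X in measurable X]setTI; exact: mb.
rewrite -[in RHS](setIT [set x | b x]) -integral_indic//.
rewrite /Rintegral; congr fine; apply: eq_integral => x _.
by rewrite indicE; case: (boolP (b x)) => bx; [rewrite mem_set|rewrite memNset//; exact/negP].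
Qed.

(** A tie between two given coordinates is a null event because [Q] has no atoms, and there are
    finitely many pairs. *)
Lemma tuple_prob_uniq {R : realType} (Q : probability R R) (n : nat) :
  (forall x, Q [set x] = 0%E) ->
  {ae tuple_prob Q n, forall t : n.-tuple R, uniq t}.
Proof.
move=> Q0.
have mE m (i j : 'I_m) : measurable_fun setT
    (fun t : m.-tuple R => (tnth t i == tnth t j)).
  by apply: measurable_fun_eqr; exact: measurable_tnth.
have Z m (i j : 'I_m) : i != j ->
    \int[tuple_prob Q m]_t (tnth t i == tnth t j)%:R = 0 :> R.
  (* The head against a coordinate of the tail: integrate over the head first, so that the event
     becomes a single point. *)
  have Z0 p (l : 'I_p) : \int[Q]_x \int[tuple_prob Q p]_t (x == tnth t l)%:R = 0 :> R.
    rewrite (@Rintegral_swap _ _ _ _ _ Q (tuple_prob Q p)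
      (fun z : R * p.-tuple R => (z.1 == tnth z.2 l)%:R) 1); last 2 first.
    - apply: measurable_natr_bool; apply: measurable_fun_eqr => //.
      exact: (measurableT_comp (measurable_tnth l) measurable_snd).
    - by move=> z; case: (_ == _); rewrite ?normr1 ?normr0.
    rewrite -[RHS](Rintegral_prob_cst (tuple_prob Q p)).
    apply: eq_Rintegral => t _ /=; rewrite Rintegral_bool; last exact: measurable_fun_eqr.
    by rewrite (_ : [set x | _] = [set tnth t l]) ?Q0//; apply/seteqP; split => x /= /eqP.
  elim: m i j => [[]//|m IH] i j ij.
  rewrite (@Rintegral_tupleS _ _ _ _ _ _ 1); last 2 first.
  - exact: (measurable_natr_bool (mE _ i j)).
  - by move=> z; case: (_ == _); rewrite ?normr1 ?normr0.
  case: (unliftP ord0 i) ij => [i'|] ->; case: (unliftP ord0 j) => [j'|] -> ij.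
  - rewrite -[RHS](Rintegral_prob_cst Q); apply: eq_Rintegral => x _.
    under eq_Rintegral do rewrite !tnthS.
    by apply: IH; apply: contra ij => /eqP ->.
  - rewrite -[RHS](Z0 _ i'); apply: eq_Rintegral => x _; apply: eq_Rintegral => t _.
    by rewrite tnthS tnth0 eq_sym.
  - rewrite -[RHS](Z0 _ j'); apply: eq_Rintegral => x _; apply: eq_Rintegral => t _.
    by rewrite tnthS tnth0.
  - by rewrite eqxx in ij.
have AE : {ae tuple_prob Q n, forall t : n.-tuple R,
    forall ij : 'I_n * 'I_n, ij.1 != ij.2 -> tnth t ij.1 != tnth t ij.2}.
  apply: filter_forall => -[i j] /=.
  have [->|ij] := eqVneq i j; first by apply: aeW.
  exists [set t | tnth t i == tnth t j]; split.
  - by rewrite -[X in measurable X]setTI; exact: mE.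
  - have := Z _ _ _ ij; rewrite Rintegral_bool; last exact: mE.
    move=> Z0.
    by rewrite -[LHS]fineK ?fin_num_measure// ?Z0// -[X in measurable X]setTI; exact: mE.
  - by move=> t /= h; apply: contrapT => tij; apply: h => _; exact/negP.
apply: filterS AE => t h; apply/tuple_uniqP => i j tij; apply/eqP.
by apply: contraT => ij; have := h (i, j) ij; rewrite tij eqxx.
Qed.

Lemma eq_Rintegral_ae {d} {T : measurableType d} {R : realType}
    (mu : {measure set T -> \bar R}) (f g : T -> R) :
  measurable_fun setT f -> measurable_fun setT g ->
  {ae mu, forall x, f x = g x} -> \int[mu]_x f x = \int[mu]_x g x.
Proof.
move=> mf mg fg; rewrite /Rintegral; congr fine.
apply: ae_eq_integral => //; [exact/measurable_EFinP|exact/measurable_EFinP|].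
by apply: filterS fg => x -> _.
Qed.

Lemma Rintegral_sum {d} {T : measurableType d} {R : realType}
    (mu : {measure set T -> \bar R}) (I : Type) (r : seq I) (f : I -> T -> R) :
  (forall i, mu.-integrable setT (EFin \o f i)) ->
  \int[mu]_x \sum_(i <- r) f i x = \sum_(i <- r) \int[mu]_x f i x.
Proof.
move=> fi; elim: r => [|i r IH].
  rewrite big_nil; under eq_Rintegral do rewrite big_nil.
  by rewrite /Rintegral integral0.
rewrite big_cons -IH -RintegralD//.
  by apply: eq_Rintegral => x _; rewrite big_cons.
elim: r {IH} => [|j r IH].
  by under [X in _.-integrable _ (_ \o X)]eq_fun do rewrite big_nil; exact: integrable0.
rewrite (_ : EFin \o _ = ((EFin \o f j) \+ (EFin \o (fun x => \sum_(i <- r) f i x)%R))%E).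
  exact: integrableD.
by apply/funext => x; rewrite /= big_cons.
Qed.

(* Almost surely exactly one coordinate has [k] coordinates above it; by
   symmetry it can be moved to the head. *)
Lemma Rintegral_symmetric_head {R : realType} (Q : probability R R) (n k : nat)
    (f : n.+1.-tuple R -> R) (M : R) :
  (forall x, Q [set x] = 0%E) -> (k <= n)%N ->
  measurable_fun setT f -> (forall t, `|f t| <= M) ->
  (forall t t' : n.+1.-tuple R, perm_eq t t' -> f t = f t') ->
  \int[tuple_prob Q n.+1]_t f t =
  n.+1%:R * \int[tuple_prob Q n.+1]_t (f t * (count_gt (thead t) t == k)%:R).
Proof.
move=> Q0 kn mf fM fsym.
have mB (j : 'I_n.+1) : measurable_fun setT
    (fun t : n.+1.-tuple R => f t * (count_gt (tnth t j) t == k)%:R).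
  apply: measurable_funM => //; apply: measurable_count_gt_eq => //.
  exact: measurable_tnth.
have BM (j : 'I_n.+1) (t : n.+1.-tuple R) :
    `|f t * (count_gt (tnth t j) t == k)%:R| <= M.
  rewrite normrM; case: (_ == k); rewrite ?normr1 ?normr0 ?mulr1 ?mulr0//.
  by apply: le_trans (fM t).
transitivity (\int[tuple_prob Q n.+1]_t
    \sum_(j < n.+1) (f t * (count_gt (tnth t j) t == k)%:R)).
  apply: eq_Rintegral_ae => //; first exact: measurable_sum.
  apply: filterS (tuple_prob_uniq n.+1 Q0) => t ut.
  rewrite -mulr_sumr -[LHS]mulr1; congr (_ * _).
  by have := @sum_count_gt_eq R t k ut; rewrite size_tuple ltnS big_tuple => ->.
rewrite Rintegral_sum; last by move=> j; exact: (@bounded_integrable _ _ _ _ _ M).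
rewrite (eq_bigr (fun=> \int[tuple_prob Q n.+1]_t
    (f t * (count_gt (thead t) t == k)%:R))).
  by rewrite sumr_const card_ord mulr_natl.
move=> j _.
rewrite -(Rintegral_tuple_perm Q (swap0K j) (swap0K j) (mB ord0) (BM ord0)).
apply: eq_Rintegral => t _; have pt := perm_tnth_swap0 t j.
rewrite (fsym _ _ pt); congr (_ * (_ == k)%:R).
by rewrite tnth_mktuple /swap0 eqxx /count_gt; have /permP -> := pt.
Qed.

Lemma natr_bool_bound {R : realType} (b : bool) (x : R) (M : R) :
  `|x| <= M -> `|b%:R * x| <= M.
Proof.
move=> xM; case: b; first by rewrite mul1r.
by rewrite mul0r normr0; exact: le_trans xM.
Qed.

Lemma natr_bool_le1 {R : realType} (b : bool) : `|b%:R : R| <= 1.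
Proof. by case: b; rewrite ?normr1 ?normr0. Qed.

Lemma normr_cos_le1 {R : realType} (x : R) : `|cos x| <= 1.
Proof. by rewrite ler_norml cos_geN1 cos_le1. Qed.

Lemma measurable_cos {R : realType} : measurable_fun setT (@cos R).
Proof. by apply: continuous_measurable_fun; exact: continuous_cos. Qed.

Lemma measurable_fun_cos {d} {T : measurableType d} {R : realType} (f : T -> R) :
  measurable_fun setT f -> measurable_fun setT (fun x => cos (f x)).
Proof. exact: measurableT_comp measurable_cos. Qed.

Lemma measurable_sum_tuple_gt {d} {T : measurableType d} {R : realType} {n : nat}
    (f : T -> n.-tuple R) (g : T -> R) (F : T * R -> R) :
  measurable_fun setT f -> measurable_fun setT g -> measurable_fun setT F ->
  measurable_fun setT (fun z => \sum_(x <- f z | g z < x) F (z, x)).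
Proof.
move=> mf mg mF; under eq_fun do rewrite big_mkcond.
apply: (measurable_sum_tuple (F := fun z => if g z.1 < z.2 then F z else 0)) => //.
apply: measurable_fun_ifT => //; apply: measurable_fun_ltr => //.
exact: measurableT_comp.
Qed.

(** The product formula for characteristic functions in real form: an exceedance multiplies by
    [q * exp (i m)], that is, contracts by [q] and rotates by [m]. The hypothesis holds for all
    phases, so the phase of the peeled coordinate is absorbed into [b]. The errors are relative to
    the probability of having [k] exceedances, which lets them be summed later over the
    threshold. *)
Lemma Rintegral_count_gt_cos {R : realType} (Q : probability R R)
    (theta : R -> R) (s p q m delta : R) :
  measurable_fun setT theta ->
  p = \int[Q]_x (s < x)%R%:R -> 0 <= q <= 1 -> 0 <= delta ->
  (forall b, `|\int[Q]_x ((s < x)%R%:R * cos (b + theta x)) - p * (q * cos (b + m))|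
     <= p * delta) ->
  forall n k b,
  `|\int[tuple_prob Q n]_t ((count_gt s t == k)%:R *
      cos (b + \sum_(x <- t | s < x) theta x))
    - q ^+ k * cos (b + k%:R * m) * \int[tuple_prob Q n]_t (count_gt s t == k)%:R|
  <= k%:R * delta * \int[tuple_prob Q n]_t (count_gt s t == k)%:R.
Proof.
move=> mtheta pE /andP[q0 q1] d0 H.
have mS n : measurable_fun setT (fun t : n.-tuple R => \sum_(x <- t | s < x) theta x).
  apply: (measurable_sum_tuple_gt (F := fun z => theta z.2)) => //.
  exact: measurableT_comp.
have mC n k : measurable_fun setT (fun t : n.-tuple R => (count_gt s t == k)%:R : R).
  exact: measurable_count_gt_eq.
have mI n k b : measurable_fun setT (fun t : n.-tuple R => (count_gt s t == k)%:R *
    cos (b + \sum_(x <- t | s < x) theta x)).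
  apply: (measurable_funM (mC _ _)); apply: measurable_fun_cos.
  exact: (measurable_funD (measurable_cst _) (mS n)).
have bI n k b (t : n.-tuple R) : `|(count_gt s t == k)%:R *
    cos (b + \sum_(x <- t | s < x) theta x)| <= 1.
  by apply: natr_bool_bound; exact: normr_cos_le1.
have iI n k b := bounded_integrable (tuple_prob Q n) (mI n k b) (bI n k b).
have iC n k := bounded_integrable (tuple_prob Q n) (mC n k) (fun t => natr_bool_le1 _).
have ms : measurable_fun setT (fun x : R => (s < x)%R%:R : R).
  by apply: measurable_natr_bool; exact: measurable_fun_ltr.
have isx := bounded_integrable Q ms (fun x => natr_bool_le1 _).
pose PI n k := \int[tuple_prob Q n]_t ((count_gt s t == k)%:R : R).
have PI0 n k : 0 <= PI n k by apply: Rintegral_ge0 => t _.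
have p0 : 0 <= p by rewrite pE; apply: Rintegral_ge0 => t _.
have p1 : p <= 1.
  by rewrite pE (le_trans (ler_norm _))//; apply: Rintegral_le_bound => // x; exact: natr_bool_le1.
elim=> [|n IH] k b.
  rewrite !Rintegral_tuple0//=; case: k => [|k] /=.
    by rewrite big_nil mul0r !addr0 expr0 !mul1r !mulr1 subrr normr0 !mul0r.
  by rewrite mul0r !mulr0 subrr normr0.
(* Condition on the first coordinate: below the threshold it changes nothing; above, it uses up one
   exceedance and shifts the phase. *)
have E1 j c : \int[tuple_prob Q n.+1]_t ((count_gt s t == j)%:R *
      cos (c + \sum_(x <- t | s < x) theta x)) =
    (if j is j'.+1 then \int[tuple_prob Q n]_t ((count_gt s t == j')%:R *
       \int[Q]_x ((s < x)%R%:R * cos ((c + \sum_(x <- t | s < x) theta x) + theta x)))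
     else 0) + (1 - p) * \int[tuple_prob Q n]_t ((count_gt s t == j)%:R *
      cos (c + \sum_(x <- t | s < x) theta x)).
  rewrite (Rintegral_tupleS _ (mI _ _ _) (bI _ _ _)).
  set L := \int[_]_t (_ * cos (c + _)).
  pose K x := if j is j'.+1 then \int[tuple_prob Q n]_t ((count_gt s t == j')%:R *
     cos ((c + \sum_(x <- t | s < x) theta x) + theta x)) else 0.
  have FE x : \int[tuple_prob Q n]_t ((count_gt s (tcons (x, t)) == j)%:R *
      cos (c + \sum_(y <- tcons (x, t) | s < y) theta y)) =
      (s < x)%R%:R * K x + L * (1 - (s < x)%R%:R).
    case: (boolP (s < x)) => sx; last first.
      rewrite subr0 mulr1 mul0r add0r; apply: eq_Rintegral => t _.
      by rewrite /count_gt /= big_cons (negPf sx).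
    rewrite subrr mulr0 addr0 mul1r /K; case: (j) => [|j'].
      rewrite -[RHS](Rintegral_prob_cst (tuple_prob Q n)).
      by apply: eq_Rintegral => t _; rewrite /count_gt /= sx mul0r.
    apply: eq_Rintegral => t _.
    rewrite /count_gt /= sx big_cons sx eqSS; congr (_ * cos _); ring.
  under eq_Rintegral do rewrite FE.
  have mj j' : measurable_fun setT (fun z : R * n.-tuple R => (count_gt s z.2 == j')%:R *
      cos ((c + \sum_(x <- z.2 | s < x) theta x) + theta z.1)).
    apply: measurable_funM; first exact: measurableT_comp (mC n j') measurable_snd.
    apply: measurable_fun_cos; apply: measurable_funD.
      exact: (measurable_funD (measurable_cst _) (measurableT_comp (mS n) measurable_snd)).
    exact: measurableT_comp.
  have bj j' (z : R * n.-tuple R) : `|(count_gt s z.2 == j')%:R *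
      cos ((c + \sum_(x <- z.2 | s < x) theta x) + theta z.1)| <= 1.
    by apply: natr_bool_bound; exact: normr_cos_le1.
  have iK : Q.-integrable setT (EFin \o (fun x => (s < x)%R%:R * K x)).
    apply: (@bounded_integrable _ _ _ _ _ 1) => [|x]; last first.
      apply: natr_bool_bound; rewrite /K; case: (j) => [|j']; rewrite ?normr0//.
      apply: Rintegral_le_bound => [|t]; last exact: (bj j' (x, t)).
      apply: (@bounded_integrable _ _ _ _ _ 1) => [|t]; last exact: (bj j' (x, t)).
      exact: measurableT_comp (mj j') (measurable_fun_pair _ _).
    apply: measurable_funM => //; rewrite /K; case: (j) => [|j'] //.
    exact: measurable_Rintegral2 (mj j') (bj j').
  have iL : Q.-integrable setT (EFin \o (fun x => 1 - (s < x)%R%:R)).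
    apply: (@bounded_integrable _ _ _ _ _ 1) => [|x]; first exact: measurable_funB.
    by case: (s < x); rewrite ?subrr ?subr0 ?normr0 ?normr1.
  rewrite RintegralD//; last first.
    exact: integrable_funZl.
  rewrite RintegralZl// RintegralB//; last exact: finite_measure_integrable_cst.
  rewrite Rintegral_prob_cst -pE mulrC; congr (_ + _).
  rewrite /K; case: (j) => [|j'].
    by under eq_Rintegral do rewrite mulr0; rewrite Rintegral_prob_cst.
  under eq_Rintegral => x _.
    rewrite -RintegralZl//; last first.
      apply: (@bounded_integrable _ _ _ _ _ 1) => [|t]; last exact: (bj j' (x, t)).
      exact: measurableT_comp (mj j') (measurable_fun_pair _ _).
    over.
  rewrite (@Rintegral_swap _ _ _ _ _ Q (tuple_prob Q n)
    (fun z : R * n.-tuple R => (s < z.1)%R%:R * ((count_gt s z.2 == j')%:R *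
      cos ((c + \sum_(x <- z.2 | s < x) theta x) + theta z.1))) 1); last 2 first.
  - by apply: measurable_funM => //; exact: measurableT_comp ms measurable_fst.
  - by move=> z; apply: natr_bool_bound; exact: bj.
  apply: eq_Rintegral => t _ /=; rewrite -RintegralZl//; last first.
    apply: (@bounded_integrable _ _ _ _ _ 1) => [|x].
      apply: measurable_funM => //; apply: measurable_fun_cos; exact: measurable_funD.
    by apply: natr_bool_bound; exact: normr_cos_le1.
  by apply: eq_Rintegral => x _; rewrite mulrCA.
(* The same recursion without the cosine, for the probability of exactly [j] exceedances. *)
have E2 j : PI n.+1 j = (if j is j'.+1 then p * PI n j' else 0) + (1 - p) * PI n j.
  rewrite /PI (Rintegral_tupleS Q (mC n.+1 j) (fun t => natr_bool_le1 _)).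
  transitivity (\int[Q]_x ((s < x)%R%:R * (if j is j'.+1 then PI n j' else 0) +
      (1 - (s < x)%R%:R) * PI n j)).
    apply: eq_Rintegral => x _; rewrite /PI; case: (boolP (s < x)) => sx; last first.
      rewrite subr0 mul1r mul0r add0r; apply: eq_Rintegral => t _.
      by rewrite /count_gt /= (negPf sx).
    rewrite subrr mul0r addr0 mul1r; case: (j) => [|j'].
      rewrite -[RHS](Rintegral_prob_cst (tuple_prob Q n)).
      by apply: eq_Rintegral => t _; rewrite /count_gt /= sx.
    by apply: eq_Rintegral => t _; rewrite /count_gt /= sx.
  have iB : Q.-integrable setT (EFin \o (fun x => 1 - (s < x)%R%:R)).
    apply: integrable_funB => //; exact: finite_measure_integrable_cst.
  rewrite RintegralD//; last 2 first.
  - by under [X in _.-integrable _ (_ \o X)]eq_fun do rewrite mulrC; exact: integrable_funZl.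
  - by under [X in _.-integrable _ (_ \o X)]eq_fun do rewrite mulrC; exact: integrable_funZl.
  rewrite !RintegralZr// RintegralB//; last exact: finite_measure_integrable_cst.
  by rewrite Rintegral_prob_cst -pE; case: (j) => // ; rewrite mulr0.
rewrite E1 -/(PI n.+1 k) E2.
have {}IH j c := IH j c; rewrite -/(PI _ _) in IH.
set I0 := \int[_]_t (_ * cos _).
have I0E : `|I0 - q ^+ k * cos (b + k%:R * m) * PI n k| <= k%:R * delta * PI n k by exact: IH.
case: k @I0 I0E => [|k] I0 I0E.
  rewrite !add0r; move: I0E; rewrite !mul0r normr_le0 subr_eq0 => /eqP ->.
  by rewrite mulrCA subrr normr0.
set J := \int[_]_t (_ * _).
have JE : `|J - p * q * \int[tuple_prob Q n]_t ((count_gt s t == k)%:R *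
    cos ((b + m) + \sum_(x <- t | s < x) theta x))| <= p * delta * PI n k.
  pose G t := \int[Q]_x ((s < x)%R%:R * cos ((b + \sum_(x <- t | s < x) theta x) + theta x)).
  have mG : measurable_fun setT (fun t : n.-tuple R => G t).
    apply: (@measurable_Rintegral2 _ _ _ _ _ Q (fun z : n.-tuple R * R =>
      (s < z.2)%R%:R * cos ((b + \sum_(x <- z.1 | s < x) theta x) + theta z.2)) 1).
      apply: measurable_funM; first exact: measurableT_comp ms measurable_snd.
      apply: measurable_fun_cos; apply: measurable_funD; last exact: measurableT_comp.
      exact: (measurable_funD (measurable_cst _) (measurableT_comp (mS n) measurable_fst)).
    by move=> z; apply: natr_bool_bound; exact: normr_cos_le1.
  have bG (t : n.-tuple R) : `|G t| <= 1.
    apply: Rintegral_le_bound => [|x]; last by apply: natr_bool_bound; exact: normr_cos_le1.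
    apply: (@bounded_integrable _ _ _ _ _ 1) => [|x]; last first.
      by apply: natr_bool_bound; exact: normr_cos_le1.
    by apply: measurable_funM => //; apply: measurable_fun_cos; exact: measurable_funD.
  rewrite -RintegralZl// /J -RintegralZl//.
  apply: Rintegral_dist_le.
  - apply: (@bounded_integrable _ _ _ _ _ 1) => [|t]; last by apply: natr_bool_bound; exact: bG.
    exact: measurable_funM (mC n k) mG.
  - exact: integrable_funZl.
  - exact: integrable_funZl.
  - move=> t; rewrite mulrCA -mulrBr normrM; case: (_ == k); last by rewrite normr0 mul0r mulr0.
    rewrite normr1 mul1r mulr1 -mulrA addrAC; exact: H.
have := IH k (b + m); set J' := \int[_]_t (_ * cos _) => J'E.
have Eb : b + k.+1%:R * m = b + m + k%:R * m by rewrite -natr1; ring.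
rewrite Eb in I0E *.
set C := cos _ in I0E J'E *.
(* Three errors: the one-coordinate approximation of the head, then the induction hypothesis at
   phase [b + m] with [k] exceedances, then the induction hypothesis at phase [b] when the head is
   below the threshold. *)
rewrite (_ : _ - _ = (J - p * q * J') + (p * q * (J' - q ^+ k * C * PI n k)) +
  (1 - p) * (I0 - q ^+ k.+1 * C * PI n k.+1)); last by rewrite exprS; ring.
rewrite (le_trans (ler_normD _ _))// (le_trans (lerD (ler_normD _ _) (lexx _)))//.
rewrite !normrM (ger0_norm p0) (ger0_norm q0) (@ger0_norm _ (1 - p)) ?subr_ge0//.
apply: (le_trans (lerD (lerD JE (ler_wpM2l _ J'E)) (ler_wpM2l _ I0E))).
- exact: mulr_ge0.
- by rewrite subr_ge0.
have : p * q * (k%:R * delta * PI n k) <= p * (k%:R * delta * PI n k).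
  by rewrite -mulrA ler_wpM2l// ler_piMl// !mulr_ge0.
rewrite -/(PI n k) -natr1; lra.
Qed.

(** The count is binomial. Mean and variance go through one induction, because the centring of the
    tail kills the cross term in the square. *)
Lemma Rintegral_count_gt_sqr {R : realType} (Q : probability R R) (s p : R) (n : nat) :
  p = \int[Q]_x (s < x)%R%:R ->
  \int[tuple_prob Q n]_t ((count_gt s t)%:R - n%:R * p) = 0 /\
  \int[tuple_prob Q n]_t ((count_gt s t)%:R - n%:R * p) ^+ 2 <= n%:R * p.
Proof.
move=> pE.
have ms : measurable_fun setT (fun x : R => (s < x)%R%:R : R).
  by apply: measurable_natr_bool; exact: measurable_fun_ltr.
have isx := bounded_integrable Q ms (fun x => natr_bool_le1 _).
have p0 : 0 <= p by rewrite pE; apply: Rintegral_ge0 => t _.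
have p1 : p <= 1.
  by rewrite pE (le_trans (ler_norm _))//; apply: Rintegral_le_bound => // x; exact: natr_bool_le1.
pose c m (t : seq R) : R := (count_gt s t)%:R - m%:R * p.
have mc m : measurable_fun setT (fun t : m.-tuple R => c m t).
  apply: measurable_funB => //; exact: measurable_count_gt.
have bc m (t : m.-tuple R) : `|c m t| <= m%:R.
  have : (count_gt s t)%:R <= m%:R :> R by rewrite ler_nat -[leqRHS](size_tuple t) count_size.
  have : 0 <= (count_gt s t)%:R :> R by [].
  have : m%:R * p <= m%:R by rewrite ler_piMr.
  have : 0 <= m%:R * p by rewrite mulr_ge0.
  by rewrite /c => ? ? ? ?; rewrite ler_norml; apply/andP; split; lra.
have bc2 m (t : m.-tuple R) : `|c m t ^+ 2| <= m%:R ^+ 2.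
  by rewrite normrX lerXn2r ?nnegrE.
have mc2 m : measurable_fun setT (fun t : m.-tuple R => c m t ^+ 2) by apply: measurable_funX; exact: mc.
have ic m := bounded_integrable (tuple_prob Q m) (mc m) (bc m).
have ic2 m := bounded_integrable (tuple_prob Q m) (mc2 m) (bc2 m).
have icst (a : R) m : (tuple_prob Q m).-integrable setT (EFin \o (fun=> a)).
  exact: finite_measure_integrable_cst.
pose xi x : R := (s < x)%R%:R - p.
have cS m x (t : m.-tuple R) : c m.+1 (tcons (x, t)) = xi x + c m t.
  by rewrite /c /xi /count_gt /= natrD -natr1; ring.
have ip (a : R) : Q.-integrable setT (EFin \o (fun=> a)) by exact: finite_measure_integrable_cst.
have xi0 : \int[Q]_x xi x = 0.
  by rewrite /xi RintegralB// Rintegral_prob_cst -pE subrr.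
elim: n => [|n [IH1 IH2]].
  rewrite -/(c _ _) !Rintegral_tuple0//.
  by rewrite /c /= mul0r subrr expr0n mulr0n.
split.
  rewrite (Rintegral_tupleS Q (mc n.+1) (bc n.+1)) -[RHS]xi0.
  apply: eq_Rintegral => x _; under eq_Rintegral do rewrite cS.
  by rewrite RintegralD// IH1 addr0 Rintegral_prob_cst.
rewrite (Rintegral_tupleS Q (mc2 n.+1) (bc2 n.+1)).
(* An indicator is its own square, so [xi x ^+ 2] is affine in it. *)
have E x : \int[tuple_prob Q n]_t (c n.+1 (tcons (x, t)) ^+ 2) =
    (1 - 2 * p) * (s < x)%R%:R + (p ^+ 2 + \int[tuple_prob Q n]_t (c n t ^+ 2)).
  under eq_Rintegral do rewrite cS.
  transitivity (\int[tuple_prob Q n]_t (xi x ^+ 2 + (2 * xi x * c n t + c n t ^+ 2))).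
    by apply: eq_Rintegral => t _; ring.
  rewrite RintegralD//; last by apply: integrable_funD => //; exact: integrable_funZl.
  rewrite Rintegral_prob_cst RintegralD//; last exact: integrable_funZl.
  rewrite RintegralZl// IH1 mulr0 add0r /xi.
  by case: (s < x) => /=; ring.
under eq_Rintegral do rewrite E.
rewrite RintegralD//; last exact: integrable_funZl.
rewrite RintegralZl// -pE Rintegral_prob_cst -natr1.
by move: IH2; nra.
Qed.

Lemma chebyshev_count_gt {R : realType} (Q : probability R R) (s p a : R) (n : nat)
    (b : n.-tuple R -> bool) :
  p = \int[Q]_x (s < x)%R%:R -> 0 < a -> measurable_fun setT b ->
  (forall t, b t -> a <= `|(count_gt s t)%:R - n%:R * p|) ->
  \int[tuple_prob Q n]_t (b t)%:R <= n%:R * p / a ^+ 2.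
Proof.
move=> pE a0 mb ba; have [_ H] := Rintegral_count_gt_sqr n pE.
rewrite ler_pdivlMr ?exprn_gt0// mulrC; apply: le_trans H.
have ib : (tuple_prob Q n).-integrable setT (EFin \o (fun t => (b t)%:R : R)).
  apply: (@bounded_integrable _ _ _ _ _ 1); first exact: measurable_natr_bool.
  by move=> t; exact: natr_bool_le1.
rewrite -RintegralZl//; apply: le_Rintegral => //; first exact: integrable_funZl.
  have mc : measurable_fun setT (fun t : n.-tuple R => ((count_gt s t)%:R - n%:R * p) ^+ 2).
    apply: measurable_funX; apply: measurable_funB => //; exact: measurable_count_gt.
  apply: (@bounded_integrable _ _ _ _ _ ((n%:R + `|n%:R * p|) ^+ 2)) => // t.
  rewrite normrX lerXn2r ?nnegrE ?addr_ge0// (le_trans (ler_normB _ _))// lerD2r.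
  by rewrite ger0_norm// ler_nat -[leqRHS](size_tuple t) count_size.
move=> t _; case: (boolP (b t)) => bt; last by rewrite mulr0 sqr_ge0.
rewrite mulr1 -[leRHS]real_normK ?num_real//.
by apply: lerXn2r; rewrite ?nnegrE ?(ltW a0)//; exact: ba.
Qed.

(** * Second-order regular variation *)

Lemma near_pinfty_ge {R : realType} (P : R -> Prop) :
  (\forall s \near +oo, P s) -> exists s0, forall s, s0 <= s -> P s.
Proof.
move=> [M [_ MP]]; exists (M + 1) => s Ms; apply: MP.
by apply: lt_le_trans Ms; rewrite ltrDl.
Qed.

Lemma cvgy_dist {R : realType} (f : R -> R) (l : R) :
  f x @[x --> +oo] --> l ->
  forall e : R, 0 < e -> exists s0 : R, forall s, s0 <= s -> `|f s - l| < e.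
Proof.
move=> fl e e0; apply: near_pinfty_ge.
move/cvgrPdist_lt : fl => /(_ e e0); apply: filterS => s.
by rewrite distrC.
Qed.

(** The length 4 makes the pigeonhole argument work: two such sets of measure above 3, one of them
    translated by at most 1, lie in [[-1, 5]], of length 6, and cannot be disjoint. *)
Definition oscillation_set {R : realType} (h : R -> R) (a : nat -> R) (e : R) (n : nat) : set R :=
  [set y | 0 <= y <= 4 /\ forall m, (n <= m)%N -> `|h (a m + y) - h (a m)| < e].

Lemma measurable_oscillation_set {R : realType} (h : R -> R) (a : nat -> R) (e : R) (n : nat) :
  measurable_fun setT h -> measurable (oscillation_set h a e n).
Proof.
move=> mh; rewrite (_ : oscillation_set _ _ _ _ =
    `[0, 4]%classic `&` \bigcap_(m in [set m | (n <= m)%N]) [set y | `|h (a m + y) - h (a m)| < e]); last first.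
  by apply/seteqP; split => y /=; rewrite in_itv/=; move=> [y04 yh]; split.
apply: measurableI => //; apply: bigcap_measurable => [|m _]; first by exists n => /=.
rewrite -[X in measurable X]setTI.
apply: (@measurable_fun_ltr _ _ _ _ (fun y => `|h (a m + y) - h (a m)|) (cst e) _ _
  measurableT [set true]) => //.
apply: measurableT_comp => //; apply: measurable_funB => //.
apply: measurableT_comp => //; exact: measurable_funD.
Qed.

(** Pointwise convergence makes these sets increase to the whole of [[0, 4]]; conclude by continuity
    of the measure from below. *)
Lemma oscillation_set_large {R : realType} (h : R -> R) (a : nat -> R) (e : R) :
  measurable_fun setT h -> 0 < e ->
  a n @[n --> \oo] --> +oo ->
  (forall v, h (s + v) - h s @[s --> +oo] --> 0) ->
  exists N, forall n, (N <= n)%N -> (3%:E < lebesgue_measure (oscillation_set h a e n))%E.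
Proof.
move=> mh e0 ay hv.
have mE n := measurable_oscillation_set a e n mh.
have ndE n m : (n <= m)%N -> oscillation_set h a e n `<=` oscillation_set h a e m.
  by move=> nm y [y04 yh]; split => // p mp; apply: yh; exact: leq_trans mp.
have UE : \bigcup_n oscillation_set h a e n = `[0, 4]%classic.
  apply/seteqP; split => y /=; first by move=> [n _ [y04 _]]; rewrite in_itv.
  rewrite in_itv /= => y04.
  have [s0 H] := cvgy_dist (hv y) e0.
  have [N _ HN] : \forall n \near \oo, s0 <= a n by move/cvgryPge : ay; exact.
  exists N => //; split => // m Nm.
  by have := H (a m) (HN m Nm); rewrite subr0.
have [N EN] : exists N, (3%:E < lebesgue_measure (oscillation_set h a e N))%E.
  apply: contrapT => /forallNP H.
  have cv := @nondecreasing_cvg_mu _ _ R lebesgue_measure (oscillation_set h a e) mE.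
  have {}cv := cv (bigcup_measurable (fun n _ => mE n)) _.
  have /cv {}cv : nondecreasing_seq (oscillation_set h a e).
    by move=> n m nm; apply/subsetPset; exact: ndE.
  have le3 : (lebesgue_measure (\bigcup_n oscillation_set h a e n) <= 3%:E)%E.
    rewrite -(cvg_lim _ cv)//; apply: lime_le; first by apply/cvg_ex; eexists; exact: cv.
    by apply: nearW => n; rewrite leNgt; apply/negP; exact: H.
  move: le3; rewrite UE lebesgue_measure_itv /= lte_fin ifT; last by lra.
  by rewrite -EFinB lee_fin; lra.
exists N => n Nn; apply: (lt_le_trans EN).
by apply: le_measure; [rewrite inE; exact: mE|rewrite inE; exact: mE|exact: ndE].
Qed.

(* The two sets of good shifts, one seen from [s n], the other from [s n + v n],
   are too large to be disjoint. *)
Lemma uniform_convergence_theorem {R : realType} (h : R -> R) :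
  measurable_fun setT h ->
  (forall v, h (s + v) - h s @[s --> +oo] --> 0) ->
  forall e : R, 0 < e -> exists s0 : R, forall s v : R, s0 <= s -> `|v| <= 1 ->
    `|h (s + v) - h s| < e.
Proof.
move=> mh hv e e0; apply: contrapT => /forallNP H.
have /choice[sv svP] : forall n : nat, exists sv : R * R,
    [/\ n%:R <= sv.1, `|sv.2| <= 1 & e <= `|h (sv.1 + sv.2) - h sv.1| ].
  move=> n; have /existsNP[s /existsNP[v]] := H n%:R.
  move=> /not_implyP[ns /not_implyP[v1 /negP]]; rewrite -leNgt => ev.
  by exists (s, v).
have sy : (sv n).1 @[n --> \oo] --> +oo.
  apply/cvgryPge => A; near=> n; apply: (@le_trans _ _ n%:R); last by have [] := svP n.
  by near: n; exact: nbhs_infty_ger.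
have svy : (sv n).1 + (sv n).2 @[n --> \oo] --> +oo.
  apply/cvgryPge => A; near=> n; apply: (@le_trans _ _ (n%:R - 1)).
    by rewrite lerBrDr; near: n; exact: nbhs_infty_ger.
  have [n1 n2 _] := svP n; apply: lerD => //.
  by move: n2; rewrite ler_norml => /andP[].
have e20 : 0 < e / 2 by rewrite divr_gt0.
have [N1 HN1] := oscillation_set_large mh e20 sy hv.
have [N2 HN2] := oscillation_set_large mh e20 svy hv.
pose n := maxn N1 N2.
have {}HN1 := HN1 n (leq_maxl _ _); have {}HN2 := HN2 n (leq_maxr _ _).
have mE := measurable_oscillation_set (fun n => (sv n).1) (e / 2) n mh.
have mF := measurable_oscillation_set (fun n => (sv n).1 + (sv n).2) (e / 2) n mh.
set E := oscillation_set _ _ _ _ in HN1 mE.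
set F := oscillation_set _ _ _ _ in HN2 mF.
have [n1 n2 n3] := svP n.
have mF' : measurable [set x | F (x + - (sv n).2)].
  have mg : measurable_fun setT (fun x : R => x + - (sv n).2) by exact: measurable_funD.
  rewrite -[X in measurable X]setTI; exact: (mg measurableT F mF).
have F'E := lebesgue_measure_shift (- (sv n).2) mF.
have [y [Ey Fy]] : exists y, E y /\ F (y + - (sv n).2).
  apply: contrapT => /forallNP disj.
  have EF0 : E `&` [set x | F (x + - (sv n).2)] = set0.
    by apply/seteqP; split => // y [? ?]; exact: disj y (conj _ _).
  have : (lebesgue_measure (E `|` [set x | F (x + - (sv n).2)%R]) <= 6%:E)%E.
    apply: (@le_trans _ _ (lebesgue_measure `[(-1 : R), 5]%classic)).
      apply: le_measure; rewrite ?inE//; first exact: measurableU.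
      move: n2; rewrite ler_norml => /andP[? ?].
      by move=> y /= [[/andP[? ?] _]|[/andP[? ?] _]]; rewrite in_itv/=; lra.
    rewrite lebesgue_measure_itv /= lte_fin ifT; last by lra.
    by rewrite -EFinB lee_fin; lra.
  have -> : lebesgue_measure (E `|` [set x | F (x + - (sv n).2)%R]) =
      (lebesgue_measure E + lebesgue_measure F)%E.
    by rewrite -F'E measureU.
  apply/negP; rewrite -ltNge (_ : 6%:E = 3%:E + 3%:E)%E; first exact: lteD.
  by rewrite -EFinD; congr EFin; lra.
have [_ /(_ n (leqnn n)) h1] := Ey; have [_ /(_ n (leqnn n)) h2] := Fy.
move: h2; rewrite (_ : (sv n).1 + (sv n).2 + (y + - (sv n).2) = (sv n).1 + y); last by ring.
move=> h2; have : `|h ((sv n).1 + (sv n).2) - h (sv n).1| < e.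
  rewrite (_ : _ - _ = (h ((sv n).1 + y) - h (sv n).1) -
    (h ((sv n).1 + y) - h ((sv n).1 + (sv n).2))); last by ring.
  by apply: (le_lt_trans (ler_normB _ _)); rewrite [e]splitr ltrD.
by rewrite ltNge n3.
Unshelve. all: by end_near.
Qed.

(** The increment of [H] over [[s + v, s + v + 1]] can be normalised by [B s] or by [B (s + v)]. The
    quotient of the two limits is [(kap (v + 1) - kap v) / kap 1 = expR (rho * v)]; so [B] is
    regularly varying in the variable [expR s]. *)
Lemma second_order_ratio {R : realType} (H B : R -> R) (rho : R) :
  rho < 0 -> (forall s, 0 < B s) ->
  (forall z, (H (s + z) - H s) / B s @[s --> +oo] --> (expR (rho * z) - 1) / rho) ->
  forall v, B (s + v) / B s @[s --> +oo] --> expR (rho * v).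
Proof.
move=> rho0 B0 HB v.
pose kap z := (expR (rho * z) - 1) / rho.
have kap1 : kap 1 != 0.
  rewrite /kap mulr1 mulf_neq0 ?invr_eq0 ?lt_eqF//.
  by rewrite subr_lt0 expR_lt1.
have HBv : (H (s + v + 1) - H (s + v)) / B (s + v) @[s --> +oo] --> kap 1.
  apply: (cvg_comp (fun s => s + v) (fun s => (H (s + 1) - H s) / B s)); last exact: HB.
  exact: cvg_addrr.
have -> : expR (rho * v) = (kap (v + 1) - kap v) / kap 1.
  rewrite /kap mulr1 mulrDr mulr1 expRD.
  have : expR rho != 1 by rewrite lt_eqF// expR_lt1.
  have : rho != 0 by rewrite lt_eqF.
  by move=> ? ?; field; rewrite subr_eq0; apply/andP.
have L : (((H (s + (v + 1)) - H s) / B s - (H (s + v) - H s) / B s) /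
   ((H (s + v + 1) - H (s + v)) / B (s + v))) @[s --> +oo] --> (kap (v + 1) - kap v) / kap 1.
  by apply: cvgM; [apply: cvgB; exact: HB|exact: cvgV].
apply: cvg_trans L; apply: near_eq_cvg.
near=> s; have : (H (s + v + 1) - H (s + v)) / B (s + v) != 0.
  by near: s; exact: cvgr_neq0 HBv kap1.
rewrite mulf_eq0 negb_or invr_eq0 => /andP[N1 N2].
have N3 : B s != 0 by rewrite gt_eqF.
rewrite addrA; set x := H _; set y := H _ in N1 *; set z := H s.
by field; rewrite N1 N2 N3.
Unshelve. all: by end_near.
Qed.

(** The uniform convergence theorem is applied to [ln B]; it gives geometric decay of [B] along unit
    steps, hence a bound for [H] along integer steps by a geometric series. A real [z] is reached by
    the detour [s], [s + j], [s + j + z], [s + z], with [j] so large that the middle increment,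
    which vanishes as [j] grows with [z] fixed, is below [B s]. *)
Lemma second_order_bound_pos {R : realType} (H B : R -> R) (rho : R) :
  rho < 0 -> measurable_fun setT B -> (forall s, 0 < B s) ->
  B s @[s --> +oo] --> 0 ->
  (forall z, (H (s + z) - H s) / B s @[s --> +oo] --> (expR (rho * z) - 1) / rho) ->
  (exists C s0 : R, forall s z, s0 <= s -> 0 <= z -> `|H (s + z) - H s| <= C * B s) /\
  (forall e : R, 0 < e -> exists eta s0 : R, 0 < eta /\ forall s v, s0 <= s -> `|v| <= eta ->
     `|B (s + v) / B s - 1| <= e).
Proof.
move=> rho0 mB B0 Bcv HB.
have Brat := second_order_ratio rho0 B0 HB.
(* With its linear drift removed, [ln B] has vanishing increments. *)
pose h s := ln (B s) - rho * s.
have mh : measurable_fun setT h.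
  apply: measurable_funB; first by apply: measurableT_comp mB; exact: measurable_ln.
  exact: measurable_funM.
have hE s v : B (s + v) / B s = expR (rho * v + (h (s + v) - h s)).
  rewrite /h (_ : rho * v + _ = ln (B (s + v)) - ln (B s)); last by ring.
  by rewrite expRD expRN !lnK// posrE.
have hv v : h (s + v) - h s @[s --> +oo] --> 0.
  have -> : (0 : R) = ln (expR (rho * v)) - rho * v by rewrite expRK subrr.
  rewrite (_ : (fun s => _) = (fun s => ln (B (s + v) / B s) - rho * v)).
    apply: cvgB; last exact: cvg_cst.
    apply: (cvg_comp _ _ (Brat v)); apply: continuous_ln; exact: expR_gt0.
  by apply/funext => s; rewrite hE expRK; ring.
have UCT := uniform_convergence_theorem mh hv.
split; last first.
  move=> e e0.
  have E0 : expR x @[x --> (0:R)] --> (1 : R) by rewrite -expR0; exact: continuous_expR.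
  move/cvgrPdist_le : E0 => /(_ e e0) [/= d d0 Hd].
  have [s0 Hs0] := UCT _ (divr_gt0 d0 (ltr0n R 4)).
  (* The bound 1 is the range of the uniform convergence theorem; the other bound keeps [rho * v]
     within [d / 4], as is the increment of [h]. *)
  exists (Num.min 1 (d / (4 * `|rho|))), s0; split.
    by rewrite lt_min ltr01 divr_gt0// mulr_gt0// normr_gt0 lt_eqF.
  move=> s v ss; rewrite le_min => /andP[v1 vd].
  rewrite hE distrC; apply: Hd => /=; rewrite sub0r normrN.
  have := Hs0 s v ss v1; move: vd; rewrite ler_pdivlMr ?mulr_gt0 ?normr_gt0 ?lt_eqF// => vd.
  have : `|rho * v| <= d / 4 by rewrite normrM; lra.
  have := ler_normD (rho * v) (h (s + v) - h s).
  lra.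
(* An increment of [h] below 1 bounds [B (s + v) / B s] by [expR 1] on unit intervals; below
   [- rho / 2] it leaves the decay factor [expR (rho / 2)] per unit step. *)
have c0 : 0 < Num.min 1 (- rho / 2) by rewrite lt_min ltr01 divr_gt0// oppr_gt0.
have [s1 Hs1] := UCT _ c0.
pose w := expR (rho / 2).
have w0 : 0 < w by exact: expR_gt0.
have w1 : w < 1 by rewrite expR_lt1; nra.
have B1 s v : s1 <= s -> 0 <= v <= 1 -> B (s + v) <= expR 1 * B s.
  move=> ss /andP[v0 v1]; rewrite -ler_pdivrMr// hE ler_expR.
  have := Hs1 s v ss; rewrite ger0_norm// => /(_ v1).
  by rewrite lt_min => /andP[+ _]; rewrite ltr_norml => /andP[_]; nra.
have Bw s : s1 <= s -> B (s + 1) <= w * B s.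
  move=> ss; rewrite -ler_pdivrMr// hE ler_expR.
  have := Hs1 s 1 ss; rewrite normr1 => /(_ (lexx _)).
  by rewrite lt_min => /andP[_]; rewrite ltr_norml => /andP[_]; lra.
have Bj s j : s1 <= s -> B (s + j%:R) <= w ^+ j * B s.
  move=> ss; elim: j => [|j IH]; first by rewrite addr0 expr0 mul1r.
  rewrite -natr1 addrA exprS -mulrA (le_trans (Bw _ _))//.
    by rewrite (le_trans ss)// lerDl.
  by rewrite ler_wpM2l// ltW.
have Bz s z : s1 <= s -> 0 <= z -> B (s + z) <= expR 1 * B s.
  move=> ss z0; pose j := Num.truncn z.
  have /andP[jz zj] := truncn_itv z0.
  rewrite (_ : s + z = (s + j%:R) + (z - j%:R)); last by rewrite /j; ring.
  apply: (le_trans (B1 _ _ _ _)).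
  - by rewrite (le_trans ss)// lerDl.
  - by rewrite subr_ge0 jz /= lerBlDr addrC natr1 ltW.
  - rewrite ler_wpM2l ?expR_ge0// (le_trans (Bj _ _ ss))//.
    by apply: ler_piMl; [exact: ltW|apply: exprn_ile1; exact: ltW].
have [s2 Hs2] := cvgy_dist (HB 1) ltr01.
pose K := `|(expR (rho * 1) - 1) / rho| + 1.
have K0 : 0 <= K by rewrite addr_ge0.
have H1 s : s2 <= s -> `|H (s + 1) - H s| <= K * B s.
  move=> ss; have := Hs2 s ss => Hd.
  rewrite -ler_pdivrMr//.
  have -> : `|H (s + 1) - H s| / B s = `|(H (s + 1) - H s) / B s|.
    by rewrite normrM normfV (gtr0_norm (B0 s)).
  rewrite -[X in `|X|](subrK ((expR (rho * 1) - 1) / rho)) (le_trans (ler_normD _ _))//.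
  by rewrite /K addrC lerD2l ltW.
(* Sum of the geometric series of the unit-step bounds [K * w ^+ j]. *)
pose C2 := K / (1 - w).
have C20 : 0 <= C2 by rewrite divr_ge0// subr_ge0 ltW.
have Hj s j : Num.max s1 s2 <= s -> `|H (s + j%:R) - H s| <= C2 * B s.
  rewrite ge_max => /andP[ss1 ss2].
  have : `|H (s + j%:R) - H s| <= C2 * (1 - w ^+ j) * B s.
    elim: j => [|j IH]; first by rewrite addr0 subrr normr0 expr0 subrr mulr0 mul0r.
    rewrite -natr1 addrA.
    rewrite (_ : _ - _ = (H (s + j%:R + 1) - H (s + j%:R)) + (H (s + j%:R) - H s)); last by ring.
    apply: (le_trans (ler_normD _ _)); apply: (le_trans (lerD (H1 _ _) IH)).
      by rewrite (le_trans ss2)// lerDl.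
    have Kw : K = C2 * (1 - w) by rewrite divfK// subr_eq0 gt_eqF.
    have : K * B (s + j%:R) <= K * (w ^+ j * B s) by rewrite ler_wpM2l// Bj.
    rewrite exprS [in X in _ <= X -> _]Kw; lra.
  move=> /le_trans; apply; have wj := exprn_ge0 j (ltW w0).
  by have := mulr_ge0 (mulr_ge0 C20 wj) (ltW (B0 s)); lra.
exists (C2 * expR 1 + 1 + C2), (Num.max s1 s2) => s z ss z0.
have D0 : H (t + z) - H t @[t --> +oo] --> 0.
  have -> : (0 : R) = (expR (rho * z) - 1) / rho * 0 by rewrite mulr0.
  rewrite (_ : (fun t => _) = (fun t => (H (t + z) - H t) / B t * B t)).
    by apply: cvgM => //; exact: HB.
  by apply/funext => t; rewrite divfK// gt_eqF.
have [t0 Ht0] := cvgy_dist D0 (B0 s).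
(* The number of unit steps depends on [z] through [t0]; the integer-step bound [C2] does not depend
   on it. *)
pose j := (Num.truncn (t0 - s)).+1.
have jt : t0 <= s + j%:R by rewrite -lerBlDl ltW// truncnS_gt.
have := Ht0 _ jt; rewrite subr0 => Hm.
have sz : Num.max s1 s2 <= s + z by rewrite (le_trans ss)// lerDl.
have ss1 : s1 <= s by move: ss; rewrite ge_max => /andP[].
have := Hj s j ss; have := Hj (s + z) j sz => A1 A2.
have A3 : C2 * B (s + z) <= C2 * (expR 1 * B s) by rewrite ler_wpM2l// Bz.
rewrite (_ : H (s + z) - H s = - (H (s + z + j%:R) - H (s + z)) +
  (H (s + j%:R + z) - H (s + j%:R)) + (H (s + j%:R) - H s)); last first.
  by rewrite (addrAC s z); ring.
apply: (le_trans (ler_normD _ _)); apply: (le_trans (lerD (ler_normD _ _) (lexx _))).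
rewrite normrN; lra.
Qed.

Lemma second_order_bound {R : realType} (H B : R -> R) (rho : R) :
  rho < 0 -> measurable_fun setT B ->
  ((\forall s \near +oo, 0 < B s) \/ (\forall s \near +oo, B s < 0)) ->
  B s @[s --> +oo] --> 0 ->
  (forall z, (H (s + z) - H s) / B s @[s --> +oo] --> (expR (rho * z) - 1) / rho) ->
  (exists C s0 : R, forall s z : R, s0 <= s -> 0 <= z -> `|H (s + z) - H s| <= C * `|B s|) /\
  (forall e : R, 0 < e -> exists eta s0 : R, 0 < eta /\ forall s v : R, s0 <= s -> `|v| <= eta ->
     `|B (s + v) / B s - 1| <= e).
Proof.
move=> rho0 mB sB Bcv HB.
have [s1 [sg sgE Bs1]] : exists s1 : R, exists2 sg : R, sg ^+ 2 = 1 &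
    forall s, s1 <= s -> 0 < sg * B s.
  case: sB => /near_pinfty_ge[s1 Bs]; exists s1.
    by exists 1; rewrite ?expr1n// => s /Bs; rewrite mul1r.
  by exists (-1); rewrite ?sqrrN ?expr1n// => s /Bs; rewrite mulN1r oppr_gt0.
(* Made positive on the whole line without changing it, up to the sign, near infinity. *)
pose B' s := if s1 <= s then sg * B s else 1.
have B'0 s : 0 < B' s by rewrite /B'; case: ifP => // /Bs1.
have mB' : measurable_fun setT B'.
  apply: measurable_fun_ifT => //; first exact: measurable_fun_ler.
  exact: measurable_funM.
have near1 : \forall s \near +oo, B' s = sg * B s.
  by near=> s; rewrite /B' ifT//; near: s; exact: nbhs_pinfty_ge.
have B'cv : B' s @[s --> +oo] --> 0.
  have L : sg * B s @[s --> +oo] --> sg * 0 by apply: cvgM => //; exact: cvg_cst.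
  rewrite mulr0 in L; apply: cvg_trans L; apply: near_eq_cvg.
  by apply: filterS near1 => s ->.
pose H' s := sg * H s.
have sg0 : sg != 0 by apply/eqP => s0; move: sgE; rewrite s0 expr0n/= => /eqP; rewrite eq_sym oner_eq0.
have H'B z : (H' (s + z) - H' s) / B' s @[s --> +oo] --> (expR (rho * z) - 1) / rho.
  apply: cvg_trans (HB z); apply: near_eq_cvg.
  apply: filterS near1 => s ->.
  by rewrite /H' -mulrBr -mulf_div divff// mul1r.
have [[C [s0 HC]] He] := second_order_bound_pos rho0 mB' B'0 B'cv H'B.
have sgn : `|sg| = 1.
  by apply/eqP; rewrite -sqrp_eq1// -normrX sgE normr1.
split.
  exists C, (Num.max s0 s1) => s z; rewrite ge_max => /andP[ss0 ss1] z0.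
  have := HC s z ss0 z0; rewrite /H' -mulrBr normrM sgn mul1r /B' ss1.
  by rewrite -[sg * B s]gtr0_norm ?Bs1// normrM sgn mul1r.
move=> e e0; have [eta [s2 [eta0 Hs2]]] := He e e0.
(* The margin [eta] keeps [s + v] beyond [s1], where [B'] agrees with [sg * B]. *)
exists eta, (Num.max s2 (s1 + eta)); split => // s v; rewrite ge_max => /andP[ss2 ss1] ve.
have := Hs2 s v ss2 ve; rewrite /B' !ifT.
- by rewrite -mulf_div divff// mul1r.
- by rewrite (le_trans _ ss1)// lerDl ltW.
- by move: ve; rewrite ler_norml => /andP[? _]; lra.
Unshelve. all: by end_near.
Qed.

(** From [ln (1 + y) = y + O (y^2)] with [y = A t * q t], which tends to 0. It passes from the
    second-order condition on a ratio to one on its logarithm. *)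
Lemma ln_div_cvg {R : realType} (q A : R -> R) (kap : R) :
  (\forall t \near +oo, A t != 0) -> A t @[t --> +oo] --> 0 ->
  q t @[t --> +oo] --> kap ->
  ln (1 + A t * q t) / A t @[t --> +oo] --> kap.
Proof.
move=> An0 A0 qk.
have y0 : A t * q t @[t --> +oo] --> 0.
  by rewrite -(mul0r kap); exact: cvgM.
have lnb (y : R) : `|y| <= 1 / 2 -> `|ln (1 + y) - y| <= 2 * y ^+ 2.
  rewrite ler_norml => /andP[yl yu].
  have up : ln (1 + y) <= y by apply: le_ln1Dx; lra.
  have y1 : 0 < 1 + y by lra.
  have lo : - ln (1 + y) <= (1 + y)^-1 - 1.
    rewrite -lnV ?posrE// -[X in ln X](subrK 1) addrC; apply: le_ln1Dx.
    by rewrite ltrBrDr addNr invr_gt0.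
  have : (1 + y)^-1 <= 1 - y + 2 * y ^+ 2.
    rewrite -[(1 + y)^-1]mul1r ler_pdivrMr//.
    have : 0 <= y ^+ 2 * (1 + 2 * y) by rewrite mulr_ge0 ?sqr_ge0//; lra.
    have -> : (1 - y + 2 * y ^+ 2) * (1 + y) = 1 + y ^+ 2 * (1 + 2 * y) by ring.
    lra.
  have := sqr_ge0 y; rewrite ler_norml => ? ?; apply/andP; split; lra.
have Aq2 : 2 * (`|A t| * q t ^+ 2) @[t --> +oo] --> 0.
  have -> : (0 : R) = 2 * (`|0 : R| * kap ^+ 2) by rewrite normr0 mul0r mulr0.
  apply: cvgM; first exact: cvg_cst.
  by apply: cvgM; [exact: cvg_norm|rewrite expr2; exact: cvgM].
have D0 : ln (1 + A t * q t) / A t - q t @[t --> +oo] --> 0.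
  apply/cvgr0Pnorm_le => e e0; near=> t.
  have At : A t != 0 by near: t.
  have Ay : `|A t * q t| <= 1 / 2.
    by near: t; move/cvgr0Pnorm_le : y0; apply; rewrite divr_gt0.
  rewrite (_ : _ - _ = (ln (1 + A t * q t) - A t * q t) / A t); last by field.
  rewrite normrM normfV ler_pdivrMr ?normr_gt0// (le_trans (lnb _ Ay))//.
  have : 2 * (`|A t| * q t ^+ 2) <= e.
    rewrite (le_trans (ler_norm _))//.
    by near: t; move/cvgr0Pnorm_le : Aq2; apply.
  have -> : 2 * (A t * q t) ^+ 2 = 2 * (`|A t| * q t ^+ 2) * `|A t|.
    by rewrite exprMn -[A t ^+ 2]real_normK ?num_real//; ring.
  by move=> ?; rewrite ler_wpM2r.
rewrite (_ : (fun t => _) = (fun t => (ln (1 + A t * q t) / A t - q t) + q t)).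
  by rewrite -[X in _ --> X]add0r; exact: cvgD.
by apply/funext => t; rewrite subrK.
Unshelve. all: by end_near.
Qed.

Lemma squeeze_norm_cvgr0 {T : Type} {F : set_system T} {FF : Filter F} {R : realType}
    (f g : T -> R) :
  (\forall x \near F, `|f x| <= g x) -> g @ F --> 0 -> f @ F --> 0.
Proof.
move=> fg g0; apply/cvgr0Pnorm_le => e e0; near=> x.
apply: (@le_trans _ _ (g x)); first by near: x.
rewrite (le_trans (ler_norm _))//.
by near: x; move/cvgr0Pnorm_le : g0; apply.
Unshelve. all: by end_near.
Qed.

(** * Taylor bounds for sine and cosine *)

Lemma sin_le_norm {R : realType} (x : R) : `|sin x| <= `|x|.
Proof.
wlog x0 : x / 0 <= x.
  move=> W; case: (leP 0 x) => [/W//|x0].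
  by rewrite -normrN -sinN -[leRHS]normrN; apply: W; rewrite oppr_ge0 ltW.
have [<-|xn0] := eqVneq 0 x; first by rewrite sin0.
have xp : 0 < x by rewrite lt_neqAle xn0.
have [c _] := @MVT R sin cos 0 x xp (fun y _ => is_derive_sin y)
  (continuous_subspaceT (@continuous_sin R)).
rewrite sin0 !subr0 => ->; rewrite normrM ler_piMl//.
by rewrite ler_norml cos_geN1 cos_le1.
Qed.

(** Mean value theorem, with the bound already known for the derivative; the next bounds are
    obtained in the same way, with constants that are not sharp. *)
Lemma cosB1_le {R : realType} (x : R) : `|1 - cos x| <= x ^+ 2.
Proof.
wlog x0 : x / 0 <= x.
  move=> W; case: (leP 0 x) => [/W//|x0].
  by rewrite -cosN -sqrrN; apply: W; rewrite oppr_ge0 ltW.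
have [<-|xn0] := eqVneq 0 x; first by rewrite cos0 subrr normr0 expr0n.
have xp : 0 < x by rewrite lt_neqAle xn0.
have [c] := @MVT R cos (fun y => - sin y) 0 x xp (fun y _ => is_derive_cos y)
  (continuous_subspaceT (@continuous_cos R)).
rewrite in_itv /= => /andP[c0 cx]; rewrite cos0 subr0 distrC => ->.
rewrite normrM normrN expr2 ler_pM//; last by rewrite ger0_norm.
by rewrite (le_trans (sin_le_norm _))// ger0_norm ltW.
Qed.

Lemma sinB_le {R : realType} (x : R) : `|x - sin x| <= `|x| ^+ 3.
Proof.
wlog x0 : x / 0 <= x.
  move=> W; case: (leP 0 x) => [/W//|x0].
  have Nx : 0 <= - x by rewrite oppr_ge0 ltW.
  by have := W _ Nx; rewrite sinN opprK -[X in X <= _]normrN opprD !opprK normrN.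
have [<-|xn0] := eqVneq 0 x; first by rewrite sin0 subrr normr0 expr0n.
have xp : 0 < x by rewrite lt_neqAle xn0.
have dF (y : R) : is_derive y 1 (fun z => z - sin z) (1 - cos y) by exact: is_deriveB.
have cF : {within `[0, x], continuous (fun z : R => z - sin z)}.
  apply: continuous_subspaceT => y; apply: cvgB; first exact: cvg_id.
  exact: continuous_sin.
have [c] := MVT xp (fun y _ => dF y) cF.
rewrite in_itv /= => /andP[c0 cx]; rewrite sin0 !subr0 => ->.
rewrite normrM exprSr ler_pM// (le_trans (cosB1_le _))//.
by rewrite lerXn2r ?nnegrE ?normr_ge0// ?ltW// (lt_le_trans cx)// ler_norm.
Qed.

Lemma cosB1_le_norm {R : realType} (x : R) : `|1 - cos x| <= `|x|.
Proof.
wlog x0 : x / 0 <= x.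
  move=> W; case: (leP 0 x) => [/W//|x0].
  by rewrite -cosN -[leRHS]normrN; apply: W; rewrite oppr_ge0 ltW.
have [<-|xn0] := eqVneq 0 x; first by rewrite cos0 subrr normr0.
have xp : 0 < x by rewrite lt_neqAle xn0.
have [c _] := @MVT R cos (fun y => - sin y) 0 x xp (fun y _ => is_derive_cos y)
  (continuous_subspaceT (@continuous_cos R)).
rewrite cos0 subr0 distrC => ->.
by rewrite normrM normrN ler_piMl// ler_norml sin_geN1 sin_le1.
Qed.

Lemma sinB_le_sqr {R : realType} (x : R) : `|x - sin x| <= x ^+ 2.
Proof.
wlog x0 : x / 0 <= x.
  move=> W; case: (leP 0 x) => [/W//|x0].
  have Nx : 0 <= - x by rewrite oppr_ge0 ltW.
  by have := W _ Nx; rewrite sinN opprK -[X in X <= _]normrN opprD !opprK sqrrN.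
have [<-|xn0] := eqVneq 0 x; first by rewrite sin0 subrr normr0 expr0n.
have xp : 0 < x by rewrite lt_neqAle xn0.
have dF (y : R) : is_derive y 1 (fun z => z - sin z) (1 - cos y) by exact: is_deriveB.
have cF : {within `[0, x], continuous (fun z : R => z - sin z)}.
  apply: continuous_subspaceT => y; apply: cvgB; first exact: cvg_id.
  exact: continuous_sin.
have [c] := MVT xp (fun y _ => dF y) cF.
rewrite in_itv /= => /andP[c0 cx]; rewrite sin0 !subr0 => ->.
rewrite normrM (ger0_norm x0) expr2 ler_pM// (le_trans (cosB1_le_norm _))//.
by rewrite gtr0_norm// ltW.
Qed.

Lemma cosB1D_le {R : realType} (x : R) : `|cos x - 1 + x ^+ 2 / 2| <= `|x| ^+ 3.
Proof.
wlog x0 : x / 0 <= x.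
  move=> W; case: (leP 0 x) => [/W//|x0].
  have Nx : 0 <= - x by rewrite oppr_ge0 ltW.
  by have := W _ Nx; rewrite cosN sqrrN normrN.
have [<-|xn0] := eqVneq 0 x.
  by rewrite cos0 subrr expr0n mul0r addr0 normr0 expr0n.
have xp : 0 < x by rewrite lt_neqAle xn0.
have dF (y : R) : is_derive y 1 (fun z => cos z - 1 + z ^+ 2 / 2) (y - sin y).
  apply: is_derive_eq.
  by rewrite /GRing.scale/=; field.
have cF : {within `[0, x], continuous (fun z : R => cos z - 1 + z ^+ 2 / 2)}.
  apply: continuous_subspaceT => y; apply: differentiable_continuous.
  by apply/derivable1_diffP; have := dF y => /@ex_derive.
have [c] := MVT xp (fun y _ => dF y) cF.
rewrite in_itv /= => /andP[c0 cx].
rewrite cos0 subrr expr0n mul0r addr0 !subr0 => ->.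
rewrite normrM exprSr ler_pM// (le_trans (sinB_le_sqr _))//.
by rewrite -[leLHS]real_normK ?num_real// lerXn2r ?nnegrE// !gtr0_norm// ltW.
Qed.

(** The cubic bound makes the remainder negligible pointwise; the quadratic one dominates it under a
    second moment alone. Together they yield the Lindeberg-type argument for one term. *)
Lemma cos_taylor2 {R : realType} (b x : R) :
  `|cos (b + x) - cos b + x * sin b + x ^+ 2 / 2 * cos b| <= 2 * `|x| ^+ 3 /\
  `|cos (b + x) - cos b + x * sin b + x ^+ 2 / 2 * cos b| <= 3 * x ^+ 2.
Proof.
have -> : cos (b + x) - cos b + x * sin b + x ^+ 2 / 2 * cos b =
    cos b * (cos x - 1 + x ^+ 2 / 2) + sin b * (x - sin x).
  by rewrite cosD; ring.
have le1 (a y M : R) : `|a| <= 1 -> `|y| <= M -> `|a * y| <= M.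
  by move=> a1 yM; rewrite normrM (le_trans _ yM)// ler_piMl.
have c1 : `|cos b| <= 1 by rewrite ler_norml cos_geN1 cos_le1.
have s1 : `|sin b| <= 1 by rewrite ler_norml sin_geN1 sin_le1.
split; apply: (le_trans (ler_normD _ _)).
  have := le1 _ _ _ c1 (cosB1D_le x); have := le1 _ _ _ s1 (sinB_le x); lra.
have := le1 _ _ _ s1 (sinB_le_sqr x).
have : `|cos x - 1 + x ^+ 2 / 2| <= 2 * x ^+ 2.
  apply: (le_trans (ler_normD _ _)); have := cosB1_le x; rewrite distrC.
  have : `|x ^+ 2 / 2| = x ^+ 2 / 2 by rewrite ger0_norm// divr_ge0// sqr_ge0.
  have := sqr_ge0 x; lra.
move=> /(le1 _ _ _ c1); lra.
Qed.

Lemma cos_taylor1 {R : realType} (b x : R) :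
  `|cos (b + x) - cos b + x * sin b| <= 2 * x ^+ 2 /\
  `|cos (b + x) - cos b| <= 2 * `|x|.
Proof.
have le1 (a y M : R) : `|a| <= 1 -> `|y| <= M -> `|a * y| <= M.
  by move=> a1 yM; rewrite normrM (le_trans _ yM)// ler_piMl.
have c1 : `|cos b| <= 1 by rewrite ler_norml cos_geN1 cos_le1.
have s1 : `|sin b| <= 1 by rewrite ler_norml sin_geN1 sin_le1.
have -> : cos (b + x) - cos b + x * sin b = - (cos b * (1 - cos x)) + sin b * (x - sin x).
  by rewrite cosD; ring.
have -> : cos (b + x) - cos b = - (cos b * (1 - cos x)) - (sin b * sin x).
  by rewrite cosD; ring.
split.
  apply: (le_trans (ler_normD _ _)); rewrite normrN.
  have := le1 _ _ _ c1 (cosB1_le x); have := le1 _ _ _ s1 (sinB_le_sqr x); lra.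
apply: (le_trans (ler_normB _ _)); rewrite normrN.
have := le1 _ _ _ c1 (cosB1_le_norm x); have := le1 _ _ _ s1 (sin_le_norm x); lra.
Qed.

Lemma sin_dist_le {R : realType} (b x : R) : `|sin (b + x) - sin b| <= 2 * `|x|.
Proof.
have le1 (a y M : R) : `|a| <= 1 -> `|y| <= M -> `|a * y| <= M.
  by move=> a1 yM; rewrite normrM (le_trans _ yM)// ler_piMl.
have c1 : `|cos b| <= 1 by rewrite ler_norml cos_geN1 cos_le1.
have s1 : `|sin b| <= 1 by rewrite ler_norml sin_geN1 sin_le1.
have -> : sin (b + x) - sin b = cos b * sin x - sin b * (1 - cos x).
  by rewrite sinD; ring.
apply: (le_trans (ler_normB _ _)).
have := le1 _ _ _ s1 (cosB1_le_norm x); have := le1 _ _ _ c1 (sin_le_norm x); lra.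
Qed.

Lemma normr_le1Dsqr {R : realType} (x : R) : `|x| <= 1 + x ^+ 2.
Proof.
rewrite -[x ^+ 2]real_normK ?num_real//.
by have := sqr_ge0 (`|x| - 1); have := normr_ge0 x; lra.
Qed.

(** * Gaussian integrals and the cosine transform of the normal law *)

Lemma measurable_gauss_bump {R : realType} (c : R) :
  measurable_fun setT (fun x : R => expR (c * x ^+ 2)).
Proof.
apply: continuous_measurable_fun => x.
apply: (@continuous_comp _ _ _ (fun x : R => c * x ^+ 2) expR); last exact: continuous_expR.
apply: cvgM; first exact: cvg_cst.
exact: sqr_continuous.
Qed.

Lemma normal_pdf0E {R : realType} (s x : R) : s != 0 ->
  normal_pdf 0 s x = normal_peak s * expR (- (2 * s ^+ 2)^-1 * x ^+ 2).
Proof.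
move=> s0; rewrite normal_pdfE// /normal_fun subr0; congr (_ * expR _).
by field; rewrite s0.
Qed.

Lemma integrable_gauss_bump {R : realType} (c : R) : c < 0 ->
  lebesgue_measure.-integrable setT (EFin \o (fun x : R => expR (c * x ^+ 2))).
Proof.
(* The standard deviation for which the bump is a normal density up to a constant factor. *)
move=> c0; pose s := Num.sqrt (- (2 * c)^-1).
have sp : 0 < - (2 * c)^-1 by rewrite oppr_gt0 invr_lt0; lra.
have s0 : s != 0 by rewrite gt_eqF// sqrtr_gt0.
have sE : s ^+ 2 = - (2 * c)^-1 by rewrite sqr_sqrtr// ltW.
have pk : normal_peak s != 0 by rewrite gt_eqF// normal_peak_gt0.
rewrite (_ : EFin \o _ = EFin \o (fun x => (normal_peak s)^-1 * normal_pdf 0 s x)).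
  by apply: integrable_funZl; exact: integrable_normal_pdf.
have cE : c = - (2 * s ^+ 2)^-1 by rewrite sE; field; lra.
by apply/funext => x; rewrite /comp normal_pdf0E// mulKf// -cE.
Qed.

(* [x^2 e^(c x^2) <= (2 / -c) e^(c x^2 / 2)] *)
Lemma integrable_sqr_gauss_bump {R : realType} (c : R) : c < 0 ->
  lebesgue_measure.-integrable setT (EFin \o (fun x : R => x ^+ 2 * expR (c * x ^+ 2))).
Proof.
move=> c0; have c20 : c / 2 < 0 by lra.
have := integrable_funZl (- (2 / c)) (integrable_gauss_bump c20).
apply: le_integrable => //.
  apply/measurable_EFinP; apply: measurable_funM; last exact: measurable_gauss_bump.
  exact: exprn_measurable.
move=> x _ /=; rewrite lee_fin !ger0_norm; last 2 first.
- by rewrite mulr_ge0 ?expR_ge0// oppr_ge0 mulr_ge0_le0// invr_le0 ltW.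
- by rewrite mulr_ge0 ?sqr_ge0// expR_ge0.
have -> : expR (c * x ^+ 2) = expR (c / 2 * x ^+ 2) * expR (c / 2 * x ^+ 2).
  by rewrite -expRD; congr expR; field.
rewrite mulrA ler_wpM2r ?expR_ge0//.
have := expR_ge1Dx (- (c / 2 * x ^+ 2)); rewrite expRN => H.
have e0 := expR_gt0 (c / 2 * x ^+ 2).
have {}H : - (c / 2 * x ^+ 2) * expR (c / 2 * x ^+ 2) <= 1.
  by rewrite -ler_pdivlMr// div1r (le_trans _ H)// lerDr.
rewrite -(@ler_nM2l _ (c / 2))//.
have -> : c / 2 * - (2 / c) = - 1 by field; lra.
by move: H; rewrite mulrA; lra.
Qed.

Lemma is_derive_gauss_bump {R : realType} (c x : R) :
  is_derive x 1 (fun y : R => expR (c * y ^+ 2)) (2 * c * x * expR (c * x ^+ 2)).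
Proof.
apply: is_derive_eq.
by rewrite /GRing.scale/= !mulr1; ring.
Qed.

(** The fundamental theorem of calculus on growing symmetric intervals, passed to the limit by
    dominated convergence. *)
Lemma Rintegral_derive_vanishing {R : realType} (F f : R -> R) :
  (forall x : R, is_derive x 1 F (f x)) -> continuous f ->
  lebesgue_measure.-integrable setT (EFin \o f) ->
  F n%:R @[n --> \oo] --> 0 -> F (- n%:R) @[n --> \oo] --> 0 ->
  \int[lebesgue_measure]_x f x = 0.
Proof.
move=> dF cf fi F0 FN0.
have mf : measurable_fun setT f by apply/measurable_EFinP; exact: measurable_int fi.
(* The successor keeps the interval nondegenerate at [n = 0]. *)
pose I n := `[- (n.+1%:R : R), n.+1%:R]%classic.
have mI n : measurable_fun setT (fun x : R => (x \in I n)%:R : R).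
  rewrite (_ : (fun x => _) = \1_(I n)); first by apply: measurable_indic; exact: measurable_itv.
  by apply/funext => x; rewrite indicE.
have L1 : \int[lebesgue_measure]_x ((x \in I n)%:R * f x) @[n --> \oo] -->
    \int[lebesgue_measure]_x f x.
  apply: (@Rintegral_dct _ _ _ lebesgue_measure
    (fun n (x : R) => (x \in I n)%:R * f x) f (fun x => `|f x|)) => //.
  - by move=> n; exact: (measurable_funM (mI n) mf).
  - exact: integrable_norm.
  - apply: aeW => x; apply: cvg_near_cst; near=> n.
    have xI : I n x.
      rewrite /I /= in_itv /= -ler_norml.
      apply: (@le_trans _ _ n%:R); last by rewrite ler_nat.
      by near: n; exact: nbhs_infty_ger.
    by rewrite mem_set// mul1r.
  - apply: aeW => x n; rewrite normrM; case: (x \in I n).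
      by rewrite normr1 mul1r.
    by rewrite normr0 mul0r.
have E n : \int[lebesgue_measure]_x ((x \in I n)%:R * f x) = F n.+1%:R - F (- n.+1%:R).
  rewrite /Rintegral.
  have := @continuous_FTC2 R f F (- n.+1%:R) n.+1%:R.
  move=> /(_ _ _ _ _)/= H.
  have -> : (\int[lebesgue_measure]_x ((x \in I n)%:R * f x)%:E =
      \int[lebesgue_measure]_(x in I n) (f x)%:E)%E.
    rewrite [RHS]integral_mkcond; apply: eq_integral => x _.
    by rewrite patchE; case: ifP => _; rewrite ?mul1r ?mul0r.
  rewrite H//.
  - by rewrite (@lt_trans _ _ 0)// ?oppr_lt0 ltr0n.
  - exact: continuous_subspaceT.
  - have cF : continuous F.
      move=> y; apply: differentiable_continuous.
      by apply/derivable1_diffP; have := dF y => /@ex_derive.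
    split.
    + by move=> y _; have := dF y => /@ex_derive.
    + by apply: cvg_at_right_filter; exact: cF.
    + by apply: cvg_at_left_filter; exact: cF.
  - by move=> y _; rewrite derive1E; have := dF y => /@derive_val.
have L2 : \int[lebesgue_measure]_x ((x \in I n)%:R * f x) @[n --> \oo] --> 0 - 0.
  under eq_fun do rewrite E.
  by apply: cvgB; rewrite (cvg_shiftS (fun n => F _)).
by have := cvg_unique _ L1 L2; rewrite subr0 => ->.
Unshelve. all: by end_near.
Qed.

Lemma integrable_norm_gauss_bump {R : realType} (c : R) : c < 0 ->
  lebesgue_measure.-integrable setT (EFin \o (fun x : R => `|x| * expR (c * x ^+ 2))).
Proof.
move=> c0.
have := integrable_funD (integrable_gauss_bump c0) (integrable_sqr_gauss_bump c0).
apply: le_integrable => //.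
  apply/measurable_EFinP; apply: measurable_funM; last exact: measurable_gauss_bump.
  exact: normr_measurable.
move=> x _ /=; rewrite lee_fin -[X in _ <= `|X + _|]mul1r -mulrDl !normrM ler_wpM2r//.
by rewrite normr_id ger0_norm ?normr_le1Dsqr// addr_ge0// sqr_ge0.
Qed.

Lemma gauss_bump_vanishing {R : realType} (c : R) (a : nat -> R) (u : R -> R) :
  c < 0 -> (forall n, n%:R <= `|a n|) -> (forall x, `|u x| <= 1) ->
  expR (c * a n ^+ 2) * u (a n) @[n --> \oo] --> 0.
Proof.
move=> c0 an u1.
apply: (@squeeze_norm_cvgr0 _ _ _ _ _ (fun n : nat => (- c)^-1 * (n%:R)^-1)); last first.
  rewrite -[X in _ --> X](mulr0 (- c)^-1); apply: cvgM; first exact: cvg_cst.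
  apply/gtr0_cvgV0; last exact: cvgr_idn.
  by near=> n; rewrite ltr0n; near: n; exact: nbhs_infty_gt.
near=> n; have n1 : (1 : R) <= n%:R by rewrite ler1n; near: n; exact: nbhs_infty_gt.
rewrite normrM (ger0_norm (expR_ge0 _)) (le_trans (ler_piMr (expR_ge0 _) (u1 _)))//.
have y0 : 0 < - c * n%:R by nra.
rewrite -invfM -[expR _]invrK -expRN lef_pV2 ?posrE ?expR_gt0//.
apply: le_trans (expR_ge1Dx _); have := an n.
rewrite -[a n ^+ 2]real_normK ?num_real// => H.
have H2 : n%:R <= `|a n| ^+ 2 by nra.
nra.
Unshelve. all: by end_near.
Qed.

(** Integration by parts: the integrand is the derivative of [expR (c * x ^+ 2) * sin (b + t * x)],
    which vanishes at both infinities. *)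
Lemma Rintegral_gauss_cos_parts {R : realType} (c b t : R) : c < 0 ->
  2 * c * \int[lebesgue_measure]_x (x * sin (b + t * x) * expR (c * x ^+ 2)) +
  t * \int[lebesgue_measure]_x (cos (b + t * x) * expR (c * x ^+ 2)) = 0.
Proof.
move=> c0.
have msin : measurable_fun setT (fun x : R => sin (b + t * x)).
  apply: measurableT_comp; first by apply: continuous_measurable_fun; exact: continuous_sin.
  by apply: measurable_funD => //; exact: measurable_funM.
have mcos : measurable_fun setT (fun x : R => cos (b + t * x)).
  apply: measurableT_comp; first by apply: continuous_measurable_fun; exact: continuous_cos.
  by apply: measurable_funD => //; exact: measurable_funM.
have is1 : lebesgue_measure.-integrable setT
    (EFin \o (fun x : R => x * sin (b + t * x) * expR (c * x ^+ 2))).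
  apply: le_integrable (integrable_norm_gauss_bump c0) => //.
    apply/measurable_EFinP; apply: measurable_funM; last exact: measurable_gauss_bump.
    exact: measurable_funM.
  move=> x _ /=; rewrite lee_fin !normrM ler_wpM2r// normr_id ler_piMr//.
  by rewrite ler_norml sin_geN1 sin_le1.
have ic1 : lebesgue_measure.-integrable setT
    (EFin \o (fun x : R => cos (b + t * x) * expR (c * x ^+ 2))).
  apply: le_integrable (integrable_gauss_bump c0) => //.
    by apply/measurable_EFinP; apply: measurable_funM => //; exact: measurable_gauss_bump.
  move=> x _ /=; rewrite lee_fin !normrM ler_piMl//.
  by rewrite ler_norml cos_geN1 cos_le1.
rewrite -RintegralZl// -RintegralZl// -RintegralD//; [|exact: integrable_funZl..].
apply: (@Rintegral_derive_vanishing R (fun x => expR (c * x ^+ 2) * sin (b + t * x))).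
- move=> x; have dg := is_derive_gauss_bump c x.
  have dl : is_derive x 1 (fun y : R => b + t * y) t.
    by apply: is_derive_eq; rewrite /GRing.scale/=; ring.
  have ds : is_derive x 1 (fun y : R => sin (b + t * y)) (cos (b + t * x) * t).
    exact: (@is_derive1_comp _ sin (fun y => b + t * y)).
  apply: (is_derive_eq (is_deriveM dg ds)).
  by rewrite /GRing.scale/=; ring.
- have ccb : continuous (fun x : R => expR (c * x ^+ 2)).
    move=> x; apply: differentiable_continuous; apply/derivable1_diffP.
    by have := is_derive_gauss_bump c x => /@ex_derive.
  have cl : continuous (fun x : R => b + t * x).
    by move=> x; apply: cvgD; [exact: cvg_cst|apply: cvgM; [exact: cvg_cst|exact: cvg_id]].
  have csn : continuous (fun x : R => sin (b + t * x)).
    by move=> x; apply: (continuous_comp (cl x)); exact: continuous_sin.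
  have ccs : continuous (fun x : R => cos (b + t * x)).
    by move=> x; apply: (continuous_comp (cl x)); exact: continuous_cos.
  move=> x; apply: cvgD; apply: cvgM; [exact: cvg_cst| |exact: cvg_cst|].
    by apply: cvgM; [apply: cvgM; [exact: cvg_id|exact: csn]|exact: ccb].
  by apply: cvgM; [exact: ccs|exact: ccb].
- by apply: integrable_funD; exact: integrable_funZl.
- apply: (gauss_bump_vanishing (u := fun x => sin (b + t * x))) => // [n|x].
    by rewrite ger0_norm.
  by rewrite ler_norml sin_geN1 sin_le1.
- apply: (gauss_bump_vanishing (u := fun x => sin (b + t * x))) => // [n|x].
    by rewrite normrN ger0_norm.
  by rewrite ler_norml sin_geN1 sin_le1.
Qed.

Lemma normal_probE {R : realType} (s : R) (A : set R) : measurable A ->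
  normal_prob 0 s A = (\int[lebesgue_measure]_(x in A) (normal_pdf 0 s x)%:E)%E.
Proof. by []. Qed.

Lemma integrable_normal_sqr {R : realType} (s : R) : s != 0 ->
  (normal_prob 0 s).-integrable setT (EFin \o (fun x : R => x ^+ 2)).
Proof.
move=> s0.
apply: (@integrable_density _ _ _ (normal_prob 0 s) lebesgue_measure _ _
  (measurable_normal_pdf 0 s) (normal_pdf_ge0 0 s) (@normal_probE R s) (exprn_measurable _)).2.
have c0 : - (2 * s ^+ 2)^-1 < 0 by rewrite oppr_lt0 invr_gt0 mulr_gt0// exprn_even_gt0.
have := integrable_funZl (normal_peak s) (integrable_sqr_gauss_bump c0).
apply: eq_integrable => // x _ /=; rewrite normal_pdf0E//; congr EFin; ring.
Qed.

(** A quadratic bound on the remainder survives integration, so it serves to differentiate under the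
    integral sign. *)
Lemma is_derive_quadratic {R : realType} (f : R -> R) (x D C : R) :
  (forall h, `|f (x + h) - f x - h * D| <= C * h ^+ 2) -> is_derive x 1 f D.
Proof.
move=> H.
have L : h^-1 *: ((f \o shift x) (h *: (1 : R)) - f x) @[h --> 0^'] --> D.
  have C0 : 0 <= C by have := H 1; rewrite expr1n mulr1; exact: le_trans.
  apply/cvgrPdist_le => e e0; near=> h.
  have h0 : h != 0 by near: h; exact: nbhs_dnbhs_neq.
  have hd : `|h| <= e / (C + 1).
    by near: h; apply: dnbhs0_le; rewrite divr_gt0// ltr_wpDl.
  rewrite /= /GRing.scale/= mulr1 distrC.
  rewrite (_ : _ - D = h^-1 * (f (x + h) - f x - h * D)); last first.
    by rewrite (addrC h x); field; exact: h0.
  rewrite normrM normfV mulrC ler_pdivrMr ?normr_gt0// (le_trans (H h))//.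
  rewrite -[h ^+ 2]real_normK ?num_real// expr2 mulrA ler_wpM2r//.
  move: hd; rewrite ler_pdivlMr; last by rewrite ltr_wpDl.
  by apply: le_trans; rewrite mulrC ler_wpM2l// lerDl.
exact: (DeriveDef (cvgP _ L) (cvg_lim _ L)).
Unshelve. all: by end_near.
Qed.

(** As a function of [t] the transform solves [phi' = - s^2 t phi], by the integration by parts
    above; multiplied by the integrating factor [expR (s^2 t^2 / 2)] it is constant. *)
Lemma Rintegral_normal_cos {R : realType} (s b t : R) : s != 0 ->
  \int[normal_prob 0 s]_x cos (b + t * x) = expR (- (s ^+ 2 * t ^+ 2 / 2)) * cos b.
Proof.
move=> s0.
pose phi t := \int[normal_prob 0 s]_x cos (b + t * x).
have mlin (u : R) : measurable_fun setT (fun x : R => b + u * x).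
  by apply: measurable_funD => //; exact: measurable_funM.
have mcos (u : R) : measurable_fun setT (fun x : R => cos (b + u * x)).
  by apply: measurableT_comp (mlin u); apply: continuous_measurable_fun; exact: continuous_cos.
have msin (u : R) : measurable_fun setT (fun x : R => sin (b + u * x)).
  by apply: measurableT_comp (mlin u); apply: continuous_measurable_fun; exact: continuous_sin.
have c1 (x : R) : `|cos x| <= 1 by rewrite ler_norml cos_geN1 cos_le1.
have s1 (x : R) : `|sin x| <= 1 by rewrite ler_norml sin_geN1 sin_le1.
have icos u : (normal_prob 0 s).-integrable setT (EFin \o (fun x : R => cos (b + u * x))).
  by apply: (@bounded_integrable _ _ _ _ _ 1) => [|x]; [exact: mcos|exact: c1].
have isqr : (normal_prob 0 s).-integrable setT (EFin \o (fun x : R => x ^+ 2)) by exact: integrable_normal_sqr.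
have ixsin u : (normal_prob 0 s).-integrable setT (EFin \o (fun x : R => x * sin (b + u * x))).
  have := integrable_funD (finite_measure_integrable_cst (normal_prob 0 s) 1 measurableT) isqr.
  apply: le_integrable => //; first by apply/measurable_EFinP; apply: measurable_funM; [exact: measurable_id|exact: msin].
  move=> x _ /=; rewrite lee_fin normrM (le_trans (ler_piMr (normr_ge0 _) (s1 _)))//.
  exact: (le_trans (normr_le1Dsqr x) (ler_norm _)).
have parts u : \int[normal_prob 0 s]_x (x * sin (b + u * x)) = s ^+ 2 * u * phi u.
  have nd := normal_probE s.
  rewrite /phi !(Rintegral_density (g := normal_pdf 0 s) (mu := lebesgue_measure))//; last 4 first.
  - exact: measurable_normal_pdf.
  - by move=> x; exact: normal_pdf_ge0.
  - exact: measurable_normal_pdf.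
  - by move=> x; exact: normal_pdf_ge0.
  have c0 : - (2 * s ^+ 2)^-1 < 0 by rewrite oppr_lt0 invr_gt0 mulr_gt0// exprn_even_gt0.
  have := Rintegral_gauss_cos_parts b u c0.
  set c := - (2 * s ^+ 2)^-1 in c0 *; set I1 := \int[_]_x _; set I2 := \int[_]_x _ => E.
  have is1 : lebesgue_measure.-integrable setT
      (EFin \o (fun x : R => x * sin (b + u * x) * expR (c * x ^+ 2))).
    apply: le_integrable (integrable_norm_gauss_bump c0) => //.
      apply/measurable_EFinP; apply: measurable_funM; last exact: measurable_gauss_bump.
      by apply: measurable_funM; [exact: measurable_id|exact: msin].
    by move=> x _ /=; rewrite lee_fin !normrM ler_wpM2r// normr_id ler_piMr.
  have ic1 : lebesgue_measure.-integrable setT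
      (EFin \o (fun x : R => cos (b + u * x) * expR (c * x ^+ 2))).
    apply: le_integrable (integrable_gauss_bump c0) => //.
      by apply/measurable_EFinP; apply: measurable_funM; [exact: mcos|exact: measurable_gauss_bump].
    by move=> x _ /=; rewrite lee_fin !normrM ler_piMl.
  transitivity (normal_peak s * I1).
    rewrite /I1 -RintegralZl//; apply: eq_Rintegral => x _; rewrite normal_pdf0E//; ring.
  transitivity (s ^+ 2 * u * (normal_peak s * I2)); last first.
    congr (_ * _); rewrite /I2 -RintegralZl//; apply: eq_Rintegral => x _; rewrite normal_pdf0E//; ring.
  have -> : I1 = s ^+ 2 * u * I2.
    have cE : 2 * c * s ^+ 2 = - 1 by rewrite /c; field.
    have : s ^+ 2 * (2 * c * I1 + u * I2) = 0 by rewrite E mulr0.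
    have -> : s ^+ 2 * (2 * c * I1 + u * I2) = 2 * c * s ^+ 2 * I1 + s ^+ 2 * u * I2 by ring.
    by rewrite cE; lra.
  ring.
have dphi (u : R) : is_derive u 1 phi (- (s ^+ 2 * u * phi u)).
  (* The constant is the expectation of the bound [2 * (h * x) ^+ 2] from [cos_taylor1], divided by
     [h ^+ 2]. *)
  apply: (@is_derive_quadratic _ phi u _ (2 * \int[normal_prob 0 s]_x x ^+ 2)) => h.
  rewrite -parts mulrN opprK /phi -RintegralB// -RintegralZl// -RintegralD//; last 2 first.
  - exact: integrable_funB.
  - exact: integrable_funZl.
  rewrite mulrAC -RintegralZl//.
  rewrite -[X in `|X|]subr0 -[X in `|_ - X|](Rintegral_prob_cst (normal_prob 0 s)).
  apply: Rintegral_dist_le.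
  - by apply: integrable_funD; [exact: integrable_funB|exact: integrable_funZl].
  - exact: finite_measure_integrable_cst.
  - exact: integrable_funZl.
  move=> x; rewrite subr0.
  have [+ _] := cos_taylor1 (b + u * x) (h * x).
  rewrite (_ : b + u * x + h * x = b + (u + h) * x); last by ring.
  by rewrite exprMn mulrA; move=> /le_trans; apply => //; rewrite mulrA.
pose g u := expR (s ^+ 2 * u ^+ 2 / 2) * phi u.
have dg (u : R) : is_derive u 1 g 0.
  have de : is_derive u 1 (fun v : R => s ^+ 2 * v ^+ 2 / 2) (s ^+ 2 * u).
    by apply: is_derive_eq; rewrite /GRing.scale/=; field.
  have dE : is_derive u 1 (fun v : R => expR (s ^+ 2 * v ^+ 2 / 2))
      (expR (s ^+ 2 * u ^+ 2 / 2) * (s ^+ 2 * u)).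
    exact: (@is_derive1_comp _ expR (fun v => s ^+ 2 * v ^+ 2 / 2)).
  apply: (is_derive_eq (is_deriveM dE (dphi u))).
  by rewrite /GRing.scale/=; ring.
have gc (u : R) : g u = g 0 by exact: is_derive_0_is_cst.
have : g t = cos b.
  rewrite gc /g /phi expr0n mulr0 mul0r expR0 mul1r.
  by under eq_Rintegral do rewrite mul0r addr0; rewrite Rintegral_prob_cst.
by rewrite /g => <-; rewrite mulrA -expRD addNr expR0 mul1r.
Qed.

(** * The exponential distribution *)

Definition std_exp {R : realType} : probability (measurableTypeR R) R :=
  exponential_distribution_exponential_prob__canonical__probability_measure_Probability
    (@ltr01 R).

Lemma std_expE {R : realType} (A : set R) : measurable A ->
  @std_exp R A = (\int[lebesgue_measure]_(x in A) (exponential_pdf 1 x)%:E)%E.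
Proof. by []. Qed.

Lemma std_exp_set1 {R : realType} (x : R) : @std_exp R [set x] = 0%E.
Proof.
rewrite std_expE//; apply: null_set_integral => //; last exact: lebesgue_measure_set1.
apply/measurable_funTS; apply/measurable_EFinP; exact: measurable_exponential_pdf.
Qed.

Lemma ge0_integral_std_exp {R : realType} (f : R -> R) :
  measurable_fun setT f -> (forall x, 0 <= f x) ->
  (\int[@std_exp R]_x (f x)%:E =
   \int[lebesgue_measure]_(x in `[0%R, +oo[) (f x * expR (- x))%:E)%E.
Proof.
move=> mf f0.
rewrite (@ge0_integral_density _ _ _ std_exp lebesgue_measure (exponential_pdf 1))//.
- rewrite [RHS]integral_mkcond; apply: eq_integral => x _.
  rewrite patchE /exponential_pdf patchE; case: ifP => _; last by rewrite mulr0.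
  by rewrite mul1r mulN1r.
- exact: measurable_exponential_pdf.
- by move=> x; exact: exponential_pdf_ge0.
Qed.

Lemma std_exp_lt0 {R : realType} : @std_exp R `]-oo, 0[%classic = 0%E.
Proof.
rewrite std_expE//; apply: integral0_eq => x; rewrite /= in_itv /= => x0.
by rewrite lt0_exponential_pdf.
Qed.

Lemma std_exp_itv0c {R : realType} (x : R) : 0 <= x ->
  @std_exp R `]-oo, x]%classic = (1 - expR (- x))%:E.
Proof.
rewrite le_eqVlt => /predU1P[<-|x0].
  rewrite oppr0 expR0 subrr (_ : `]-oo, 0]%classic = `]-oo, 0[%classic `|` [set 0]); last first.
    apply/seteqP; split => y /=; rewrite !in_itv /= le_eqVlt; first by case/orP => [/eqP|]; [right|left].
    by move=> [->|->]; rewrite ?orbT ?eqxx.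
  rewrite measureU//; last first.
    by apply/seteqP; split => // y /= []; rewrite in_itv /= => /[swap] ->; rewrite ltxx.
  by rewrite -[RHS]add0e; congr (_ + _)%E; [exact: std_exp_lt0|exact: std_exp_set1].
rewrite (_ : `]-oo, x]%classic = `]-oo, 0[%classic `|` `[0, x]%classic); last first.
  apply/seteqP; split => y /=; rewrite !in_itv /=.
    by move=> yx; case: (ltP y 0) => y0; [left|right].
  by move=> [/ltW yx|/andP[]//]; exact: le_trans (ltW x0).
rewrite measureU//; last first.
  apply/seteqP; split => // y /= []; rewrite !in_itv /= => y0 /andP[+ _].
  by rewrite leNgt y0.
rewrite -[RHS]add0e; congr (_ + _)%E; first exact: std_exp_lt0.
by have := @exponential_prob_itv0c R 1 x x0; rewrite mulN1r.
Qed.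

Lemma std_exp_gt {R : realType} (s : R) : 0 <= s ->
  \int[@std_exp R]_x (s < x)%R%:R = expR (- s).
Proof.
move=> s0; rewrite Rintegral_bool; last exact: measurable_fun_ltr.
rewrite (_ : [set x | _] = ~` `]-oo, s]%classic).
  by rewrite probability_setC// std_exp_itv0c// -EFinB /=; ring.
by rewrite setCitvl; apply/seteqP; split => x /=; rewrite in_itv /= andbT.
Qed.

Lemma ge0_integral_lebesgue_shift {R : realType} (a : R) (f : R -> R) :
  measurable_fun setT f -> (forall x, 0 <= f x) ->
  (\int[lebesgue_measure]_x (f (x + a))%:E = \int[lebesgue_measure]_x (f x)%:E)%E.
Proof.
move=> mf f0.
have mphi : @measurable_fun _ _ (measurableTypeR R) (measurableTypeR R) setT
    (fun x : R => x + a) by exact: measurable_funD.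
have := @ge0_integral_pushforward _ _ (measurableTypeR R) (measurableTypeR R) R _ mphi
  lebesgue_measure setT (EFin \o f) measurableT.
have mE : measurable_fun setT (EFin \o f) by exact/measurable_EFinP.
move=> /(_ mE (fun x _ => f0 x)); rewrite preimage_setT => H.
apply: (etrans (esym H)).
by apply: eq_measure_integral => A mA _; exact: lebesgue_measure_shift.
Qed.

Lemma std_exp_memoryless {R : realType} (s : R) (f : R -> R) :
  0 <= s -> measurable_fun setT f -> (forall x, 0 <= f x) ->
  (\int[@std_exp R]_x ((s < x)%R%:R * f (x - s))%:E =
   (expR (- s))%:E * \int[@std_exp R]_x (f x)%:E)%E.
Proof.
move=> s0 mf f0.
have mfs : measurable_fun setT (fun x : R => f (x - s)).
  by apply: measurableT_comp mf _; exact: measurable_funB.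
have mi (a : R) : measurable_fun setT (fun x : R => (a < x)%R%:R : R).
  by apply: measurable_natr_bool; exact: measurable_fun_ltr.
have me : measurable_fun setT (fun x : R => expR (- x)).
  by apply: measurableT_comp => //; exact: measurable_expR.
rewrite !ge0_integral_std_exp//; last 2 first.
- exact: measurable_funM.
- by move=> x; rewrite mulr_ge0.
(* The indicator turns the half-line integral into one over the whole line, which is translation
   invariant; the endpoint 0 is a null set. *)
pose g x : R := (0 < x)%R%:R * (f x * expR (- x)).
have mg : measurable_fun setT g by apply: measurable_funM => //; exact: measurable_funM.
have g0 x : 0 <= g x by rewrite /g !mulr_ge0// expR_ge0.
transitivity (\int[lebesgue_measure]_x (expR (- s) * g (x + - s))%:E)%E.
  rewrite [LHS]integral_mkcond; apply: eq_integral => x _.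
  rewrite patchE /g subr_gt0 opprB expRD !expRN.
  case: ifPn => [_|]; first by congr EFin; field; rewrite !gt_eqF ?expR_gt0.
  rewrite notin_setE /= in_itv /= andbT => /negP; rewrite -ltNge => x0.
  by rewrite ltNge (le_trans (ltW x0) s0) /= !mul0r mulr0.
under eq_integral do rewrite EFinM.
have mgs : measurable_fun setT (fun x : R => (g (x + - s))%:E).
  apply/measurable_EFinP; apply: measurableT_comp mg _; exact: measurable_funD.
rewrite ge0_integralZl ?lee_fin ?expR_ge0//; last by move=> x _; rewrite lee_fin.
rewrite ge0_integral_lebesgue_shift//; congr (_ * _)%E.
rewrite -integral_itv_obnd_cbnd; last first.
  by apply: measurable_funTS; apply/measurable_EFinP; exact: measurable_funM.
rewrite [RHS]integral_mkcond; apply: eq_integral => x _.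
rewrite patchE /g; case: ifPn => [|].
  by rewrite inE /= in_itv /= andbT => ->; rewrite mul1r.
by rewrite notin_setE /= in_itv /= andbT => /negP/negbTE ->; rewrite mul0r.
Qed.

(** The Taylor term of order [n + 1] of [expR (- c * x)] already bounds the product by a multiple of
    [x^-1]. *)
Lemma expR_vanishing {R : realType} (c : R) (n : nat) : c < 0 ->
  x ^+ n * expR (c * x) @[x --> +oo] --> 0.
Proof.
move=> c0; pose C := ((- c) ^+ n.+1)^-1 * (n.+1)`!%:R.
have C0 : 0 <= C by rewrite mulr_ge0// invr_ge0 exprn_ge0// oppr_ge0 ltW.
apply: (@squeeze_norm_cvgr0 _ _ _ _ _ (fun x => C * x^-1)); last first.
  rewrite -[X in _ --> X](mulr0 C); apply: cvgM; first exact: cvg_cst.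
  apply/gtr0_cvgV0; last exact: cvg_id.
  exact: nbhs_pinfty_gt.
near=> x; have x0 : 0 < x by near: x; exact: nbhs_pinfty_gt.
have cx0 : 0 <= - c * x by rewrite mulr_ge0 ?oppr_ge0 ?ltW.
rewrite ger0_norm ?mulr_ge0 ?exprn_ge0 ?expR_ge0 ?(ltW x0)//.
have := expR_ge1Dxn n cx0; rewrite mulNr expRN => H.
have H' : (- c * x) ^+ n.+1 / (n.+1)`!%:R <= (expR (c * x))^-1.
  by apply: le_trans H; rewrite mulNr lerDr.
have E0 := expR_gt0 (c * x); have f0 : 0 < (n.+1)`!%:R :> R by rewrite ltr0n fact_gt0.
have K0 : 0 < (- c) ^+ n.+1 by rewrite exprn_gt0// oppr_gt0.
rewrite ler_pdivlMr// mulrAC -exprSr /C ler_pdivlMl//.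
move: H'; rewrite ler_pdivrMr// exprMn ler_pdivlMl// => H'.
by rewrite mulrA (mulrC (_ * x ^+ _)).
Unshelve. all: by end_near.
Qed.

(** Each integrand has an explicit antiderivative vanishing at infinity. The absolute value, which
    is harmless on the support, makes the first-order integrand nonnegative on the whole line. *)
Lemma std_exp_moments {R : realType} (a : R) : a < 1 ->
  [/\ (\int[@std_exp R]_x (expR (a * x))%:E = ((1 - a)^-1)%:E)%E,
      (\int[@std_exp R]_x (`|x| * expR (a * x))%:E = ((1 - a) ^- 2)%:E)%E &
      (\int[@std_exp R]_x (x ^+ 2 * expR (a * x))%:E = (2 * (1 - a) ^- 3)%:E)%E].
Proof.
move=> a1; set c := a - 1; have c0 : c < 0 by rewrite subr_lt0.
have ce : continuous (fun x : R => expR (c * x)).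
  move=> x; apply: (@continuous_comp _ _ _ (fun x : R => c * x) expR); last exact: continuous_expR.
  by apply: cvgM; [exact: cvg_cst|exact: cvg_id].
have de (x : R) : is_derive x 1 (fun y : R => expR (c * y)) (expR (c * x) * c).
  have dl : is_derive x 1 (fun y : R => c * y) c by apply: is_derive_eq; rewrite /GRing.scale/=; ring.
  exact: (@is_derive1_comp _ expR (fun y => c * y)).
have key (f F : R -> R) : (forall x, 0 <= x -> 0 <= f x) ->
    (forall x : R, is_derive x 1 F (f x * expR (c * x))) ->
    continuous f -> F x @[x --> +oo] --> (0 : R) ->
    (\int[lebesgue_measure]_(x in `[0%R, +oo[) (f x * expR (c * x))%:E = (- F 0)%:E)%E.
  move=> f0 dF cf Foo.
  have cF : continuous F.
    move=> y; apply: differentiable_continuous.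
    by apply/derivable1_diffP; have := dF y => /@ex_derive.
  rewrite (@ge0_continuous_FTC2y R _ F 0 0) ?sub0e ?EFinN//.
  - by move=> x x0; rewrite mulr_ge0 ?f0// expR_ge0.
  - by apply: continuous_subspaceT => x; apply: cvgM; [exact: cf|exact: ce].
  - by apply: cvg_at_right_filter; exact: cF.
  - by move=> x _; rewrite derive1E; have := dF x => /@derive_val.
have cn0 : c != 0 by rewrite lt_eqF.
have aE : 1 - a = - c by rewrite /c; ring.
have mexp : measurable_fun setT (fun x : R => expR (a * x)).
  by apply: measurableT_comp => //; exact: measurable_funM.
have eE (x : R) : expR (a * x) * expR (- x) = expR (c * x).
  by rewrite -expRD; congr expR; rewrite /c; ring.
have van n : x ^+ n * expR (c * x) @[x --> +oo] --> (0 : R) by exact: expR_vanishing.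
split.
- rewrite ge0_integral_std_exp//.
  under eq_integral do rewrite eE -[expR _]mul1r.
  have D (x : R) : is_derive x 1 (fun x : R => c^-1 * expR (c * x)) (1 * expR (c * x)).
    have de' := de x; apply: (is_derive_eq (is_deriveZ c^-1 de')).
    by rewrite /GRing.scale/=; field.
  rewrite (key (fun=> 1) _ _ D)//.
  + by rewrite mulr0 expR0 mulr1 aE invrN.
  + by move=> x; exact: cst_continuous.
  + rewrite -[X in _ --> X](mulr0 c^-1); apply: cvgM; first exact: cvg_cst.
    by have := van 0%N; under eq_fun do rewrite expr0 mul1r.
- rewrite ge0_integral_std_exp; last 2 first.
  + by apply: measurable_funM => //; exact: normr_measurable.
  + by move=> x; rewrite mulr_ge0// expR_ge0.
  transitivity (\int[lebesgue_measure]_(x in `[0%R, +oo[) (x * expR (c * x))%:E)%E.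
    apply: eq_integral => x; rewrite inE /= in_itv /= andbT => x0.
    by rewrite -mulrA eE ger0_norm.
  have D (x : R) : is_derive x 1 (fun x : R => (x * c^-1 - c ^- 2) * expR (c * x)) (id x * expR (c * x)).
    have de' := de x.
    have dl : is_derive x 1 (fun y : R => y * c^-1 - c ^- 2) c^-1.
      by apply: is_derive_eq; rewrite /GRing.scale/=; ring.
    apply: (is_derive_eq (is_deriveM dl de')).
    by rewrite /GRing.scale/=; field.
  rewrite (key id _ _ D)//; last 2 first.
  + by move=> x; exact: cvg_id.
  + have vE : (0 : R) = 0 * c^-1 - 0 * c ^- 2 by ring.
    rewrite (_ : (fun x : R => _) = (fun x : R => x ^+ 1 * expR (c * x) * c^-1 - x ^+ 0 * expR (c * x) * c ^- 2)); last first.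
      by apply/funext => x; rewrite expr1 expr0; ring.
    rewrite [X in _ --> X]vE; apply: cvgB; (apply: cvgM; [exact: van|exact: cvg_cst]).
  + by rewrite mul0r mulr0 expR0 mulr1 sub0r opprK aE sqrrN.
- rewrite ge0_integral_std_exp; last 2 first.
  + by apply: measurable_funM => //; exact: exprn_measurable.
  + by move=> x; rewrite mulr_ge0 ?expR_ge0// sqr_ge0.
  under eq_integral do rewrite -mulrA eE.
  have D (x : R) : is_derive x 1 (fun x : R => (x ^+ 2 * c^-1 - (2 * c ^- 2) * x + 2 * c ^- 3) * expR (c * x)) (x ^+ 2 * expR (c * x)).
    have de' := de x.
    have dl : is_derive x 1 (fun y : R => y ^+ 2 * c^-1 - (2 * c ^- 2) * y + 2 * c ^- 3)
        (2 * x * c^-1 - 2 * c ^- 2).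
      by apply: is_derive_eq; rewrite /GRing.scale/=; field.
    apply: (is_derive_eq (is_deriveM dl de')).
    by rewrite /GRing.scale/=; field.
  rewrite (key (fun x => x ^+ 2) _ _ D)//.
  + by rewrite expr0n !mul0r !mulr0 expR0 mulr1 subrr add0r aE exprNn /=; congr EFin; field.
  + by move=> x _; exact: sqr_ge0.
  + exact: sqr_continuous.
  + have vE : (0 : R) = 0 * c^-1 - 0 * (2 * c ^- 2) + 0 * (2 * c ^- 3) by ring.
    rewrite (_ : (fun x : R => _) = (fun x : R => x ^+ 2 * expR (c * x) * c^-1 -
       x ^+ 1 * expR (c * x) * (2 * c ^- 2) + x ^+ 0 * expR (c * x) * (2 * c ^- 3))); last first.
      by apply/funext => x; rewrite expr1 expr0; ring.
    rewrite [X in _ --> X]vE.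
    apply: cvgD; last by apply: cvgM; [exact: van|exact: cvg_cst].
    by apply: cvgB; (apply: cvgM; [exact: van|exact: cvg_cst]).
Qed.

(** * Sorting and order statistics *)

Lemma sort_map_nondecreasing {R : realType} (u : R -> R) (t : seq R) :
  {homo u : x y / x <= y} ->
  sort <=%R [seq u x | x <- t] = [seq u x | x <- sort <=%R t].
Proof.
move=> hu; apply: (@sorted_eq _ <=%R).
- exact: le_trans.
- exact: le_anti.
- exact: sort_le_sorted.
- by apply: homo_sorted (sort_le_sorted t).
- by rewrite perm_sort perm_map// perm_sym perm_sort.
Qed.

Lemma sort_split {R : realType} (s : R) (l : seq R) :
  uniq (s :: l) ->
  sort <=%R (s :: l) = sort <=%R [seq x <- l | x < s] ++ s :: sort <=%R [seq x <- l | s < x].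
Proof.
move=> /andP[sl ul]; apply: (@sorted_eq _ <=%R).
- exact: le_trans.
- exact: le_anti.
- exact: sort_le_sorted.
- rewrite sorted_pairwise; last exact: le_trans.
  rewrite pairwise_cat /= -!sorted_pairwise; try exact: le_trans.
  rewrite !sort_le_sorted andbT /=; apply/andP; split.
  + apply/allrelP => x y; rewrite mem_sort mem_filter => /andP[xs _].
    rewrite inE mem_sort mem_filter => /orP[/eqP ->|/andP[sy _]]; rewrite ltW//.
    exact: lt_trans sy.
  + by apply/allP => x; rewrite mem_sort mem_filter => /andP[/ltW].
- rewrite perm_sort perm_sym.
  apply: perm_trans (_ : perm_eq (s :: ([seq x <- l | x < s] ++ [seq x <- l | s < x])) _).
    rewrite perm_sym -cat1s perm_catCA /= perm_cat ?perm_cons// perm_sym perm_sort//.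
  rewrite perm_cons.
  rewrite (@eq_in_filter _ (fun x => s < x) (predC (fun x => x < s))).
    by rewrite perm_filterC.
  move=> x xl /=; rewrite -leNgt le_eqVlt; case: eqP => // sx.
  by rewrite sx xl in sl.
Qed.

Lemma size_sort_split {R : realType} (s : R) (l : seq R) : uniq (s :: l) ->
  (size (sort <=%R [seq x <- l | (x < s)%R]) + count_gt s l = size l)%N.
Proof.
move=> /andP[sl _]; rewrite size_sort size_filter -(count_predC (fun x => (x < s)%R) l).
congr (_ + _)%N; apply: eq_in_count => x xl /=; rewrite -leNgt [in RHS]le_eqVlt.
by case: eqP => // sx; rewrite sx xl in sl.
Qed.

(** With [k] entries above [s] among [n], the value [s] has rank [n - k], which is index
    [(n - k).-1] because [nth] counts from 0. *)
Lemma order_stat_threshold {R : realType} (u : R -> R) (s : R) (l : seq R) :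
  {homo u : x y / x <= y} -> uniq (s :: l) ->
  nth 0 (sort <=%R [seq u x | x <- s :: l]) ((size l).+1 - count_gt s l).-1 = u s.
Proof.
move=> hu usl; rewrite sort_map_nondecreasing// sort_split// map_cat nth_cat.
by rewrite size_map -(size_sort_split usl) -addSn addnK /= ltnn subnn.
Qed.

Lemma sum_order_stat_above {R : realType} (u g : R -> R) (s : R) (l : seq R) :
  {homo u : x y / x <= y} -> uniq (s :: l) ->
  \sum_(0 <= i < count_gt s l)
     g (nth 0 (sort <=%R [seq u x | x <- s :: l]) ((size l).+1 - i).-1) =
  \sum_(x <- l | s < x) g (u x).
Proof.
move=> hu usl; rewrite sort_map_nondecreasing// sort_split//.
rewrite -(size_sort_split usl); set lo := sort _ _; set hi := sort <=%R [seq x <- l | s < x].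
have szhi : size hi = count_gt s l by rewrite size_sort size_filter.
transitivity (\sum_(0 <= i < count_gt s l) g (nth 0 [seq u x | x <- hi] (count_gt s l - i.+1))).
  apply: eq_big_nat => i /andP[_ ik]; congr g.
  rewrite map_cat nth_cat size_map.
  (* The index skips the lower part and [s] itself, hence the extra successor on the right. *)
  have -> : ((size lo + count_gt s l).+1 - i).-1 = (size lo + (count_gt s l - i.+1).+1)%N by lia.
  by rewrite ltnNge leq_addr /= addKn.
rewrite big_nat_rev /= add0n.
transitivity (\sum_(0 <= i < size [seq u x | x <- hi]) g (nth 0 [seq u x | x <- hi] i)).
  rewrite size_map szhi; apply: eq_big_nat => i /andP[_ ik].
  by congr (g (nth _ _ _)); lia.
rewrite -(big_nth 0 xpredT) big_map -[RHS]big_filter.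
by apply: perm_big; rewrite perm_sort.
Qed.

(** The entry of index [j] of the sorted list is at least [x] exactly when at most [j] entries are
    below [x], and this count is a measurable sum of indicators. *)
Lemma measurable_sorted_nth {R : realType} (n j : nat) :
  measurable_fun setT (fun t : n.-tuple R => nth 0 (sort <=%R t) j).
Proof.
(* Beyond the length, [nth] returns its default value 0. *)
have [nj|jn] := leqP n j.
  rewrite (_ : (fun t => _) = cst 0)//; apply/funext => t /=.
  by rewrite nth_default// size_sort size_tuple.
apply: (measurability (@RGenCInfty.G R)) => [|/= _ [_] [x] -> <-].
  exact: RGenCInfty.measurableE.
have mc : measurable_fun setT (fun t : n.-tuple R => \sum_(y <- t) (y < x)%R%:R : R).
  apply: (measurable_sum_tuple (F := fun z : n.-tuple R * R => (z.2 < x)%R%:R)) => //.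
  by apply: measurable_natr_bool; exact: measurable_fun_ltr.
rewrite [X in measurable X](_ : _ = setT `&` (fun t : n.-tuple R =>
    (\sum_(y <- t) (y < x)%R%:R : R) <= j%:R) @^-1` [set true]).
  have mb := measurable_fun_ler mc (@measurable_cst _ _ _ _ setT (j%:R : R)).
  exact: (mb measurableT [set true]).
congr (_ `&` _); apply/seteqP; split => t /=; rewrite in_itv /= andbT.
all: have -> : \sum_(y <- t) (y < x)%R%:R = (count (fun y => (y < x)%R) (sort <=%R t))%:R :> R
  by rewrite (permP (_ : perm_eq (sort <=%R t) t)) ?perm_sort//; elim: (tval t) => [|y l IH];
     rewrite ?big_nil// big_cons IH /= natrD.
all: rewrite ler_nat.
- move=> xt; rewrite leqNgt; apply/negP => jc.
  have := nth_count_lt 0 (sort_le_sorted t) jc.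
  by rewrite ltNge xt.
- move=> cj; apply: nth_count_ge; first exact: sort_le_sorted.
  by rewrite cj size_sort size_tuple.
Qed.

(** * Convergence in distribution in the plane *)

Lemma Rintegral_sub_le {d} {T : measurableType d} {R : realType}
    (P : probability T R) (f g : T -> R) (e : R) :
  P.-integrable setT (EFin \o f) -> P.-integrable setT (EFin \o g) ->
  (forall x, `|f x - g x| <= e) ->
  `|\int[P]_x f x - \int[P]_x g x| <= e.
Proof.
move=> fi gi fg; rewrite -[leRHS](Rintegral_prob_cst P).
apply: Rintegral_dist_le => //; exact: finite_measure_integrable_cst.
Qed.

(* A continuous function on the plane is the limit of its values on the grids
   [n^-1 Z]^2, which are step functions. *)
Lemma continuous_measurable_fun2 {R : realType} (f : R * R -> R) :
  continuous f -> measurable_fun setT f.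
Proof.
move=> cf.
pose r n (x : R) : R := (Num.floor (n.+1%:R * x))%:~R / n.+1%:R.
have rcv (x : R) : r n x @[n --> \oo] --> x.
  apply/cvgrPdist_le => e e0; near=> n.
  have n0 : 0 < n.+1%:R :> R by rewrite ltr0n.
  have := floor_le_tmp (n.+1%:R * x); have := floorD1_gt (n.+1%:R * x).
  rewrite intrD; set fl := (Num.floor _)%:~R => h1 h2.
  rewrite /r -/fl.
  have -> : x - fl / n.+1%:R = (n.+1%:R * x - fl) / n.+1%:R by field; rewrite gt_eqF.
  rewrite ger0_norm ?divr_ge0 ?subr_ge0// ler_pdivrMr//.
  apply: (@le_trans _ _ 1); first by lra.
  rewrite -ler_pdivrMl//; apply: (@le_trans _ _ n%:R); last by rewrite ler_nat.
  rewrite mulr1; near: n; exact: nbhs_infty_ger.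
pose f_ n (z : R * R) := f (r n z.1, r n z.2).
apply: (@measurable_fun_cvg _ _ R setT f_).
  move=> n _ Y mY; rewrite setTI.
  pose ff (ij : int * int) : R := f (ij.1%:~R / n.+1%:R, ij.2%:~R / n.+1%:R).
  rewrite (_ : _ @^-1` _ = \bigcup_(ij : int * int)
    [set z : R * R | [/\ ff ij \in Y, Num.floor (n.+1%:R * z.1) = ij.1 &
                         Num.floor (n.+1%:R * z.2) = ij.2]]); last first.
    apply/seteqP; split => z /=; rewrite /f_ /r.
      move=> Yz; exists (Num.floor (n.+1%:R * z.1), Num.floor (n.+1%:R * z.2)) => //=.
      by split => //; rewrite inE.
    by move=> [[i j] _ /= [/set_mem Yij E1 E2]]; rewrite /ff /= in Yij; rewrite E1 E2.
  apply: countable_bigcupT_measurable; first exact: countableP.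
  move=> [i j] /=; have [Yij|Yij] := boolP (ff (i, j) \in Y); last first.
    by rewrite (_ : [set _ | _] = set0)// -subset0 => z /= [].
  have mfl (l : int) : measurable [set x : R | Num.floor (n.+1%:R * x) = l].
    rewrite (_ : [set _ | _] = (fun x : R => n.+1%:R * x) @^-1` `[l%:~R, (l + 1)%:~R[); last first.
      apply/seteqP; split => x /=; rewrite in_itv /=.
        by move=> <-; rewrite floor_le_tmp floorD1_gt.
      by move=> h; apply/floor_def.
    rewrite -[X in measurable X]setTI.
    by apply: measurable_funM => //.
  rewrite (_ : [set _ | _] = [set x | Num.floor (n.+1%:R * x) = i] `*` [set x | Num.floor (n.+1%:R * x) = j]).
    exact: measurableX.
  by apply/seteqP; split => z /= => [[_ ? ?]|[? ?]].
move=> [z1 z2] _; apply: (cvg_comp (fun n => (r n z1, r n z2)) f _ (cf (z1, z2))).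
exact: (cvg_pair (rcv z1) (rcv z2)).
Unshelve. all: by end_near.
Qed.

Lemma Rintegral_ge_bound {d} {T : measurableType d} {R : realType}
    (P : probability T R) (f g : T -> R) :
  P.-integrable setT (EFin \o f) -> P.-integrable setT (EFin \o g) ->
  (forall x, f x <= g x) -> \int[P]_x f x <= \int[P]_x g x.
Proof. by move=> fi gi fg; apply: le_Rintegral. Qed.

Definition dist2 {R : realType} (x y : R * R) : R := `|x.1 - y.1| + `|x.2 - y.2|.

Lemma lipschitz2_continuous {R : realType} (f : R * R -> R) (L : R) :
  (forall x y, `|f x - f y| <= L * dist2 x y) -> continuous f.
Proof.
move=> fL z.
have d0 : L * dist2 z y @[y --> z] --> 0.
  have h1 : `|z.1 - y.1| @[y --> z] --> (0 : R).
    rewrite -(@normr0 _ R) -(subrr z.1).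
    by apply: cvg_norm; apply: cvgB; [exact: cvg_cst|exact: cvg_fst].
  have h2 : `|z.2 - y.2| @[y --> z] --> (0 : R).
    rewrite -(@normr0 _ R) -(subrr z.2).
    by apply: cvg_norm; apply: cvgB; [exact: cvg_cst|exact: cvg_snd].
  rewrite -(mulr0 L) -(addr0 0); apply: cvgM; first exact: cvg_cst.
  exact: (cvgD h1 h2).
apply/cvgrPdist_le => e e0; near=> y.
rewrite (le_trans (fL _ _))// (le_trans (ler_norm _))//.
by near: y; move/cvgr0Pnorm_le : d0; apply.
Unshelve. all: by end_near.
Qed.

(** The Pasch-Hausdorff envelope: for bounded [f], its largest minorant that is [m]-Lipschitz for
    [dist2]. *)
Definition inf_conv {R : realType} (f : R * R -> R) (m : R) (x : R * R) : R :=
  inf [set f y + m * dist2 x y | y in setT].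

Lemma dist2xx {R : realType} (x : R * R) : dist2 x x = 0.
Proof.
by rewrite /dist2 !subrr normr0 addr0.
Qed.

Lemma dist2_triangle {R : realType} (y x z : R * R) : dist2 x z <= dist2 x y + dist2 y z.
Proof.
by rewrite /dist2 addrACA; apply: lerD; exact: ler_distD.
Qed.

Lemma dist2C {R : realType} (x y : R * R) : dist2 x y = dist2 y x.
Proof.
by rewrite /dist2 distrC [X in _ + X]distrC.
Qed.

Lemma dist2_ge0 {R : realType} (x y : R * R) : 0 <= dist2 x y.
Proof.
by rewrite addr_ge0.
Qed.

Lemma inf_conv_props {R : realType} (f : R * R -> R) (M : R) :
  (forall z, `|f z| <= M) ->
  forall m, 0 <= m -> [/\ forall x, inf_conv f m x <= f x,
     forall x, `|inf_conv f m x| <= M &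
     forall x y, `|inf_conv f m x - inf_conv f m y| <= m * dist2 x y].
Proof.
move=> fM m m0.
have lb x : lbound [set f y + m * dist2 x y | y in setT] (- M).
  move=> _ [y _ <-]; have := fM y; rewrite ler_norml => /andP[h _].
  by have := mulr_ge0 m0 (dist2_ge0 x y); lra.
have ne x : [set f y + m * dist2 x y | y in setT] !=set0 by exists (f x + m * dist2 x x), x.
have infle x y : inf_conv f m x <= f y + m * dist2 x y.
  by apply: ge_inf; [exists (- M)|exists y].
have h1 x : inf_conv f m x <= f x by have := infle x x; rewrite dist2xx mulr0 addr0.
have h3 x y : inf_conv f m x - inf_conv f m y <= m * dist2 x y.
  rewrite lerBlDr -lerBlDl; apply: lb_le_inf => // _ [z _ <-].
  have := infle x z; have := ler_wpM2l m0 (dist2_triangle y x z).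
  by rewrite mulrDr; lra.
split => // [x|x y].
  rewrite ler_norml (le_trans (h1 x))/= ?andbT; last by have := fM x; rewrite ler_norml => /andP[].
  exact: lb_le_inf.
by rewrite ler_norml h3 andbT lerNl opprB dist2C h3.
Qed.

Lemma inf_conv_cvg {R : realType} (f : R * R -> R) (M : R) (x : R * R) :
  (forall z, `|f z| <= M) -> continuous f ->
  inf_conv f n%:R x @[n --> \oo] --> f x.
Proof.
move=> fM cf; apply/cvgrPdist_le => e e0.
have := cf x => /cvgrPdist_le/(_ e e0)/nbhs_ballP[D /= D0 HD].
near=> n.
have [h1 _ _] := inf_conv_props fM (ler0n R n).
rewrite ger0_norm ?subr_ge0// lerBlDl -lerBlDr.
apply: lb_le_inf; first by exists (f x + n%:R * dist2 x x), x.
move=> _ [y _ <-]; have n0 : 0 <= n%:R :> R by [].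
(* Near [x], continuity bounds [f y] from below; away from [x], the penalty [n * D] exceeds the
   oscillation [2 * M]. *)
have [xy|xy] := ltP (dist2 x y) D.
  have := mulr_ge0 n0 (dist2_ge0 x y).
  suff : `|f x - f y| <= e by rewrite ler_norml => /andP[_]; lra.
  apply: HD; split; rewrite /ball/=; apply: le_lt_trans xy; rewrite /dist2.
    by rewrite lerDl.
  by rewrite lerDr.
have nD : 2 * M <= n%:R * dist2 x y.
  apply: (@le_trans _ _ (n%:R * D)); last exact: ler_wpM2l.
  rewrite -ler_pdivrMr//; near: n; exact: nbhs_infty_ger.
have := fM x; have := fM y; rewrite !ler_norml => /andP[? ?] /andP[? ?]; lra.
Unshelve. all: by end_near.
Qed.

(** * Smoothing by Gaussian kernels *)

Lemma Rintegral_normal_density {R : realType} (m s : R) (f : R -> R) :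
  (normal_prob m s).-integrable setT (EFin \o f) ->
  \int[normal_prob m s]_x f x = \int[lebesgue_measure]_x (f x * normal_pdf m s x).
Proof.
move=> fi.
apply: (@Rintegral_density _ _ _ (normal_prob m s) lebesgue_measure (normal_pdf m s)) => //.
- exact: measurable_normal_pdf.
- by move=> x; exact: normal_pdf_ge0.
Qed.

(** Both sides are the Lebesgue integral of [h] times the two densities. Thus a kernel can be read
    either as a weight or as a probability. *)
Lemma Rintegral_normal_exchange {R : realType} (m s m' s' : R) (h : R -> R) (M : R) :
  s != 0 -> s' != 0 -> measurable_fun setT h -> (forall x, `|h x| <= M) ->
  \int[normal_prob m s]_x (h x * normal_pdf m' s' x) =
  \int[normal_prob m' s']_x (h x * normal_pdf m s x).
Proof.
move=> s0 s'0 mh hM.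
have M0 : 0 <= M by exact: le_trans (normr_ge0 _) (hM 0).
have bnd (p q : R) : q != 0 -> forall x, `|h x * normal_pdf p q x| <= M * normal_peak q.
  move=> q0 x; rewrite normrM ler_pM// ger0_norm ?normal_pdf_ge0//.
  exact: normal_pdf_ub.
have mp (p q : R) : measurable_fun setT (fun x => h x * normal_pdf p q x).
  by apply: measurable_funM => //; exact: measurable_normal_pdf.
have ip (p q p' q' : R) : q' != 0 ->
    (normal_prob p q).-integrable setT (EFin \o (fun x => h x * normal_pdf p' q' x)).
  move=> q0; apply: (@bounded_integrable _ _ _ _ _ (M * normal_peak q')); [exact: mp|exact: bnd].
transitivity (\int[lebesgue_measure]_x (h x * normal_pdf m' s' x * normal_pdf m s x)).
  by rewrite (Rintegral_normal_density (ip _ _ _ _ s'0)).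
rewrite (Rintegral_normal_density (ip _ _ _ _ s0)).
by apply: eq_Rintegral => x _; rewrite mulrAC.
Qed.

Lemma Rintegral_normal_pdf {R : realType} (m s : R) : s != 0 ->
  \int[lebesgue_measure]_x normal_pdf m s x = 1.
Proof.
by move=> s0; rewrite /Rintegral integral_normal_pdf.
Qed.

(* [u <= exp (u^2 / 4)] turns the first absolute moment into the total mass of a
   wider Gaussian. *)
Lemma norm_normal_pdf_le {R : realType} (m s x : R) : 0 < s ->
  `|x - m| * normal_pdf m s x <= 2 * s * normal_pdf m (2 * s) x.
Proof.
move=> s0; have s20 : 0 < 2 * s by rewrite mulr_gt0.
rewrite !normal_pdfE ?gt_eqF// /normal_fun.
have -> : normal_peak (2 * s) = normal_peak s / 2 :> R.
  rewrite /normal_peak exprMn -!mulrnAr -mulrA sqrtrM ?sqr_ge0//.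
  by rewrite sqrtr_sqr ger0_norm// invfM mulrC.
have -> : 2 * s * (normal_peak s / 2 * expR (- (x - m) ^+ 2 / ((2 * s) ^+ 2 *+ 2))) =
    normal_peak s * (s * expR (- (x - m) ^+ 2 / ((2 * s) ^+ 2 *+ 2))) by field.
rewrite mulrCA ler_wpM2l ?normal_peak_ge0//.
set v := `|x - m| / s.
have v0 : 0 <= v by rewrite divr_ge0// ltW.
have -> : `|x - m| = s * v by rewrite /v mulrCA divff ?gt_eqF// mulr1.
rewrite -mulrA ler_wpM2l ?(ltW s0)//.
have E : (x - m) ^+ 2 = s ^+ 2 * v ^+ 2.
  by rewrite /v exprMn real_normK ?num_real// exprVn mulrCA divff ?expf_neq0 ?gt_eqF// mulr1.
clearbody v; rewrite -ler_pdivlMr ?expR_gt0// -expRN -expRD.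
apply: (@le_trans _ _ (1 + v ^+ 2 * (3 / 8))).
  by have := sqr_ge0 (v - 4 / 3); rewrite sqrrB; lra.
apply: (le_trans (expR_ge1Dx _)); rewrite ler_expR E.
by rewrite exprMn [leRHS](_ : _ = v ^+ 2 * (3 / 8))//; field; exact: lt0r_neq0.
Qed.

Lemma normal_first_moment {R : realType} (m s : R) : 0 < s ->
  (normal_prob m s).-integrable setT (EFin \o (fun x : R => `|x - m|)) /\
  \int[normal_prob m s]_x `|x - m| <= 2 * s.
Proof.
move=> s0; have s20 : 0 < 2 * s by rewrite mulr_gt0.
have mn : measurable_fun setT (fun x : R => `|x - m|).
  by apply: measurableT_comp => //; exact: measurable_funB.
have mpdf := @measurable_normal_pdf R.
have i2 : lebesgue_measure.-integrable setT (EFin \o (fun x : R => 2 * s * normal_pdf m (2 * s) x)).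
  by apply: integrable_funZl; apply: integrable_normal_pdf; rewrite gt_eqF.
have i1 : lebesgue_measure.-integrable setT (EFin \o (fun x : R => `|x - m| * normal_pdf m s x)).
  apply: (le_integrable _ _ _ i2) => //.
    by apply/measurable_EFinP; apply: measurable_funM => //; exact: mpdf.
  move=> x _ /=; rewrite lee_fin [leLHS]ger0_norm ?mulr_ge0 ?normal_pdf_ge0//.
  rewrite [leRHS]ger0_norm ?mulr_ge0 ?normal_pdf_ge0 ?(ltW s0)//.
  exact: norm_normal_pdf_le.
have i0 : (normal_prob m s).-integrable setT (EFin \o (fun x : R => `|x - m|)).
  apply/(@integrable_density _ _ _ (normal_prob m s) lebesgue_measure (normal_pdf m s)) => //.
  - exact: mpdf.
  - by move=> x; exact: normal_pdf_ge0.
split=> //.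
rewrite (@Rintegral_density _ _ _ (normal_prob m s) lebesgue_measure (normal_pdf m s)) //.
- apply: (@le_trans _ _ (\int[lebesgue_measure]_x (2 * s * normal_pdf m (2 * s) x))).
    by apply: le_Rintegral => // x _; exact: norm_normal_pdf_le.
  rewrite RintegralZl//; last by apply: integrable_normal_pdf; rewrite gt_eqF.
  by rewrite Rintegral_normal_pdf ?gt_eqF// mulr1.
- exact: mpdf.
- by move=> x; exact: normal_pdf_ge0.
Qed.

Lemma Rintegral_normal_lipschitz {R : realType} (m s L : R) (h : R -> R) (M : R) :
  0 < s -> measurable_fun setT h -> (forall x, `|h x| <= M) -> 0 <= L ->
  (forall x, `|h x - h m| <= L * `|x - m|) ->
  `|\int[normal_prob m s]_x h x - h m| <= 2 * L * s.
Proof.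
move=> s0 mh hM L0 hL.
have [i1 le1] := normal_first_moment m s0.
rewrite -[X in _ - X](Rintegral_prob_cst (normal_prob m s)).
apply: (@le_trans _ _ (\int[normal_prob m s]_x (L * `|x - m|))).
  apply: Rintegral_dist_le => //.
  - by apply: (@bounded_integrable _ _ _ _ _ M).
  - exact: finite_measure_integrable_cst.
  - exact: integrable_funZl.
by rewrite RintegralZl//; have := ler_wpM2l L0 le1; lra.
Qed.

Definition normal_pdf2 {R : realType} (s : R) (z c : R * R) : R :=
  normal_pdf z.1 s c.1 * normal_pdf z.2 s c.2.

(** The exponent is written so as to be recognised as the cosine transform, at [c - z], of the
    normal law of standard deviation [s^-1]. *)
Lemma normal_pdfC {R : realType} (s z c : R) : s != 0 ->
  normal_pdf z s c = normal_peak s * expR (- (s^-1 ^+ 2 * (c - z) ^+ 2 / 2)).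
Proof.
move=> s0; rewrite normal_pdfE// /normal_fun; congr (_ * expR _).
by rewrite -mulr_natr; field.
Qed.

Lemma measurable_normal_pdf2 {R : realType} (s : R) d (T : measurableType d) (z c : T -> R * R) :
  s != 0 -> measurable_fun setT z -> measurable_fun setT c ->
  measurable_fun setT (fun t => normal_pdf2 s (z t) (c t)).
Proof.
move=> s0 mz mc; rewrite /normal_pdf2.
have mE (u v : T -> R) : measurable_fun setT u -> measurable_fun setT v ->
    measurable_fun setT (fun t => normal_pdf (u t) s (v t)).
  move=> mu mv; under eq_fun do rewrite normal_pdfC//.
  apply: measurable_funM => //; apply: measurableT_comp => //.
  apply: measurableT_comp => //; apply: measurable_funM => //; apply: measurable_funM => //.
  by apply: measurable_funX; exact: measurable_funB.
apply: measurable_funM; apply: mE; apply: measurableT_comp => //;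
  (exact: measurable_fst || exact: measurable_snd).
Qed.

Lemma normal_pdf2_bound {R : realType} (s : R) (z c : R * R) : s != 0 ->
  `|normal_pdf2 s z c| <= normal_peak s ^+ 2.
Proof.
move=> s0; rewrite /normal_pdf2 normrM expr2 !ger0_norm ?normal_pdf_ge0//.
by rewrite ler_pM ?normal_pdf_ge0 ?normal_pdf_ub.
Qed.

(** The smoothing integral is taken against a Gaussian probability, for which every bounded
    integrand is integrable. The price is that the function actually smoothed is [F] times the
    standard Gaussian density. *)
Lemma Rintegral_normal_pdf2_exchange {R : realType} (s : R) (z : R * R) (F : R * R -> R) (M : R) :
  s != 0 -> measurable_fun setT F -> (forall c, `|F c| <= M) ->
  \int[prod_prob (normal_prob 0 1) (normal_prob 0 1)]_c (F c * normal_pdf2 s z c) =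
  \int[normal_prob z.1 s]_x \int[normal_prob z.2 s]_y (F (x, y) * normal_pdf2 1 (0, 0) (x, y)).
Proof.
move=> s0 mF FM; have n10 : (1 : R) != 0 by exact: oner_neq0.
have M0 : 0 <= M by exact: le_trans (normr_ge0 _) (FM (0, 0)).
rewrite (@Rintegral_prod _ _ _ _ _ _ _ _ (M * normal_peak s ^+ 2)); last 2 first.
- by apply: measurable_funM => //; apply: measurable_normal_pdf2 => //; exact: measurable_cst.
- by move=> c; rewrite normrM ler_pM// normal_pdf2_bound.
transitivity (\int[normal_prob 0 1]_x (\int[normal_prob z.2 s]_y (F (x, y) * normal_pdf 0 1 y) * normal_pdf z.1 s x)).
  apply: eq_Rintegral => x _.
  transitivity (\int[normal_prob 0 1]_y (F (x, y) * normal_pdf z.1 s x * normal_pdf z.2 s y)).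
    by apply: eq_Rintegral => y _; rewrite /normal_pdf2 /= mulrA.
  rewrite (@Rintegral_normal_exchange _ _ _ _ _ _ (M * normal_peak s))//.
  - rewrite mulrC -RintegralZl//.
      by apply: eq_Rintegral => y _; ring.
    apply: (@bounded_integrable _ _ _ _ _ (M * normal_peak 1)).
      by apply: measurable_funM; [exact: measurableT_comp|exact: measurable_normal_pdf].
    by move=> y; rewrite normrM ler_pM// ger0_norm ?normal_pdf_ge0// normal_pdf_ub.
  - apply: measurable_funM => //; exact: measurableT_comp.
  - by move=> y; rewrite normrM ler_pM// ger0_norm ?normal_pdf_ge0// normal_pdf_ub.
have Gb x y : `|F (x, y) * normal_pdf 0 1 y| <= M * normal_peak 1.
  by rewrite normrM ler_pM// ger0_norm ?normal_pdf_ge0// normal_pdf_ub.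
have mG : measurable_fun setT (fun c : R * R => F c * normal_pdf 0 1 c.2).
  by apply: measurable_funM => //; apply: measurableT_comp => //; exact: measurable_normal_pdf.
rewrite (@Rintegral_normal_exchange _ _ _ _ _ _ (M * normal_peak 1))//.
- apply: eq_Rintegral => x _; rewrite mulrC -RintegralZl//.
    by apply: eq_Rintegral => y _; rewrite /normal_pdf2 /=; ring.
  apply: (@bounded_integrable _ _ _ _ _ (M * normal_peak 1)) => //.
  by apply: measurable_funM; [exact: measurableT_comp|exact: measurable_normal_pdf].
- apply: (@measurable_Rintegral2 _ _ _ _ _ (normal_prob z.2 s) (fun c : R * R => F c * normal_pdf 0 1 c.2) (M * normal_peak 1)) => //.
  by move=> [x y]; exact: Gb.
- move=> x; apply: Rintegral_le_bound => //.
  apply: (@bounded_integrable _ _ _ _ _ (M * normal_peak 1)) => //.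
  by apply: measurable_funM; [exact: measurableT_comp|exact: measurable_normal_pdf].
Qed.

(** One coordinate is moved at a time; each costs [L] times the first absolute moment of the kernel,
    at most [2 * s]. *)
Lemma gaussian_smoothing_dist {R : realType} (s : R) (z : R * R) (F : R * R -> R) (M L : R) :
  0 < s -> measurable_fun setT F -> (forall c, `|F c| <= M) -> 0 <= L ->
  let f c := F c * normal_pdf2 1 (0, 0) c in
  (forall x y, `|f x - f y| <= L * dist2 x y) ->
  `|\int[prod_prob (normal_prob 0 1) (normal_prob 0 1)]_c (F c * normal_pdf2 s z c) - f z| <= 4 * L * s.
Proof.
move=> s0 mF FM L0 f fL; rewrite (Rintegral_normal_pdf2_exchange _ _ mF FM) ?gt_eqF//.
have M0 : 0 <= M by exact: le_trans (normr_ge0 _) (FM (0, 0)).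
have fM c : `|f c| <= M * normal_peak 1 ^+ 2.
  by rewrite normrM ler_pM// normal_pdf2_bound// oner_neq0.
have mf : measurable_fun setT f.
  by apply: measurable_funM => //; apply: measurable_normal_pdf2 => //; exact: oner_neq0.
have m1 : measurable_fun setT (fun x => \int[normal_prob z.2 s]_y f (x, y)).
  by apply: (@measurable_Rintegral2 _ _ _ _ _ (normal_prob z.2 s) f (M * normal_peak 1 ^+ 2)).
have i1 x : (normal_prob z.2 s).-integrable setT (EFin \o (fun y => f (x, y))).
  by apply: (@bounded_integrable _ _ _ _ _ (M * normal_peak 1 ^+ 2)) => //; exact: measurableT_comp.
have -> : f z = f (z.1, z.2) by case: (z).
rewrite -(subrK (\int[normal_prob z.1 s]_x f (x, z.2)) (\int[normal_prob z.1 s]_x _)) -addrA.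
rewrite (le_trans (ler_normD _ _))// (_ : 4 * L * s = 2 * L * s + 2 * L * s); last by ring.
apply: lerD.
  apply: Rintegral_sub_le.
  - apply: (@bounded_integrable _ _ _ _ _ (M * normal_peak 1 ^+ 2)); first exact: m1.
    by move=> x; apply: Rintegral_le_bound; [exact: i1|move=> y; exact: fM].
  - by apply: (@bounded_integrable _ _ _ _ _ (M * normal_peak 1 ^+ 2)) => //; exact: measurableT_comp.
  - move=> x; apply: (@Rintegral_normal_lipschitz _ _ _ _ (fun y => f (x, y)) (M * normal_peak 1 ^+ 2)) => //.
      exact: measurableT_comp.
    by move=> y; rewrite (le_trans (fL _ _))// /dist2 /= subrr normr0 add0r.
apply: (@Rintegral_normal_lipschitz _ _ _ _ (fun x => f (x, z.2)) (M * normal_peak 1 ^+ 2)) => //.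
  exact: measurableT_comp.
by move=> y; rewrite (le_trans (fL _ _))// /dist2 /= subrr normr0 addr0.
Qed.

Lemma normal_pdf2_cos {R : realType} (s : R) (z c : R * R) : s != 0 ->
  normal_pdf2 s z c = normal_peak s ^+ 2 *
   \int[prod_prob (normal_prob 0 s^-1) (normal_prob 0 s^-1)]_m
     (cos (m.1 * (c.1 - z.1)) * cos (m.2 * (c.2 - z.2))).
Proof.
move=> s0; have sv0 : s^-1 != 0 by rewrite invr_eq0.
have mc (d : measure_display) (T : measurableType d) (u : T -> R) (t : R) : measurable_fun setT u ->
    measurable_fun setT (fun x => cos (u x * t)).
  by move=> mu; apply: measurable_fun_cos; exact: measurable_funM.
have c1 (x : R) : `|cos x| <= 1 by exact: normr_cos_le1.
have E (t : R) : \int[normal_prob 0 s^-1]_x cos (x * t) = expR (- (s^-1 ^+ 2 * t ^+ 2 / 2)).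
  have := Rintegral_normal_cos 0 t sv0; rewrite cos0 mulr1 => <-.
  by apply: eq_Rintegral => x _; rewrite add0r mulrC.
rewrite (@Rintegral_prod _ _ _ _ _ _ _ _ 1); last 2 first.
- by apply: measurable_funM; exact: mc.
- by move=> m; rewrite normrM mulr_ile1.
have i1 t : (normal_prob 0 s^-1).-integrable setT (EFin \o (fun x : R => cos (x * t))).
  by apply: (@bounded_integrable _ _ _ _ _ 1) => //; exact: mc.
transitivity (normal_peak s ^+ 2 * \int[normal_prob 0 s^-1]_x
    (expR (- (s^-1 ^+ 2 * (c.2 - z.2) ^+ 2 / 2)) * cos (x * (c.1 - z.1)))).
  by rewrite (RintegralZl _ _ (i1 _))// E /normal_pdf2 !normal_pdfC//; ring.
congr (_ * _); apply: eq_Rintegral => x _.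
by rewrite /= (RintegralZl _ _ (i1 _))// E mulrC.
Qed.

(** Write the kernel as an average of cosines over the frequencies, exchange the integrals, and
    apply dominated convergence in the frequency. *)
Lemma cvg_normal_pdf2 {d} {T : measurableType d} {R : realType}
    (P : probability T R) (Y : nat -> T -> R * R)
    {d'} {T' : measurableType d'} (Q : probability T' R) (Z : T' -> R * R) (s : R) (c : R * R) :
  s != 0 ->
  (forall n, measurable_fun setT (Y n)) -> measurable_fun setT Z ->
  (forall a b c, \int[P]_w cos (a * (Y n w).1 + b * (Y n w).2 + c) @[n --> \oo] -->
     \int[Q]_w cos (a * (Z w).1 + b * (Z w).2 + c)) ->
  \int[P]_w normal_pdf2 s (Y n w) c @[n --> \oo] --> \int[Q]_w normal_pdf2 s (Z w) c.
Proof.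
move=> s0 mY mZ H.
pose N := prod_prob (normal_prob 0 s^-1) (normal_prob 0 s^-1).
have c1 (x : R) : `|cos x| <= 1 by exact: normr_cos_le1.
pose g (y m : R * R) := cos (m.1 * (c.1 - y.1)) * cos (m.2 * (c.2 - y.2)).
have gb y m : `|g y m| <= 1 by rewrite normrM mulr_ile1.
have mg d0 (S : measurableType d0) (y m : S -> R * R) : measurable_fun setT y ->
    measurable_fun setT m -> measurable_fun setT (fun t => g (y t) (m t)).
  move=> my mm; apply: measurable_funM; apply: measurable_fun_cos; apply: measurable_funM.
  - exact: measurableT_comp.
  - by apply: measurable_funB => //; exact: measurableT_comp.
  - exact: measurableT_comp.
  - by apply: measurable_funB => //; exact: measurableT_comp.
have SW d0 (S : measurableType d0) (U : probability S R) (y : S -> R * R) : measurable_fun setT y ->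
    \int[U]_w normal_pdf2 s (y w) c =
    normal_peak s ^+ 2 * \int[N]_m \int[U]_w g (y w) m.
  move=> my; under eq_Rintegral do rewrite normal_pdf2_cos//.
  rewrite RintegralZl//.
    congr (_ * _); apply: (@Rintegral_swap _ _ _ _ _ U N (fun z => g (y z.1) z.2) 1) => //.
    by apply: mg => //; exact: measurableT_comp.
  apply: (@bounded_integrable _ _ _ _ _ 1).
    apply: (@measurable_Rintegral2 _ _ _ _ _ N (fun z => g (y z.1) z.2) 1) => //.
    by apply: mg => //; exact: measurableT_comp.
  move=> w; apply: (@Rintegral_le_bound _ _ _ N (g (y w))); last exact: (gb (y w)).
  apply: (@bounded_integrable _ _ _ _ _ 1); last exact: (gb (y w)).
  by apply: (mg _ _ (cst (y w)) id).
(* Product-to-sum formula: the product of two cosines becomes cosines of linear combinations, to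
   which the hypothesis applies. *)
have IN d0 (S : measurableType d0) (U : probability S R) (y : S -> R * R) m : measurable_fun setT y ->
    \int[U]_w g (y w) m =
    2^-1 * (\int[U]_w cos (- m.1 * (y w).1 + - m.2 * (y w).2 + (m.1 * c.1 + m.2 * c.2)) +
            \int[U]_w cos (- m.1 * (y w).1 + m.2 * (y w).2 + (m.1 * c.1 - m.2 * c.2))).
  move=> my.
  have mi (a b e : R) : U.-integrable setT (EFin \o (fun w => cos (a * (y w).1 + b * (y w).2 + e))).
    apply: (@bounded_integrable _ _ _ _ _ 1) => //.
    apply: measurable_fun_cos; apply: measurable_funD => //.
    by apply: measurable_funD; apply: measurable_funM => //; exact: measurableT_comp.
  rewrite -RintegralD// -RintegralZl//; last exact: integrable_funD.
  apply: eq_Rintegral => w _; rewrite /g.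
  set A := m.1 * _; set B := m.2 * _.
  rewrite (_ : - m.1 * (y w).1 + - m.2 * (y w).2 + (m.1 * c.1 + m.2 * c.2) = A + B); last by rewrite /A /B; ring.
  rewrite (_ : - m.1 * (y w).1 + m.2 * (y w).2 + (m.1 * c.1 - m.2 * c.2) = A - B); last by rewrite /A /B; ring.
  by rewrite cosD cosB; field.
rewrite SW//; under eq_fun do rewrite SW//.
apply: cvgM; first exact: cvg_cst.
apply: (@Rintegral_dct _ _ _ N (fun n m => \int[P]_w g (Y n w) m) _ (fun=> 1)).
- move=> n; apply: (@measurable_Rintegral2 _ _ _ _ _ P (fun z : (R * R) * T => g (Y n z.2) z.1) 1) => //.
  by apply: mg => //; exact: measurableT_comp.
- apply: (@measurable_Rintegral2 _ _ _ _ _ Q (fun z : (R * R) * T' => g (Z z.2) z.1) 1) => //.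
  by apply: mg => //; exact: measurableT_comp.
- exact: finite_measure_integrable_cst.
- apply: aeW => m; rewrite IN//; under eq_fun do rewrite IN//.
  apply: cvgM; first exact: cvg_cst.
  by apply: cvgD; exact: H.
- apply: aeW => m n.
  apply: (@Rintegral_le_bound _ _ _ P (fun w => g (Y n w) m)) => [|w]; last exact: gb.
  apply: (@bounded_integrable _ _ _ _ _ 1) => [|w]; last exact: gb.
  by apply: (mg _ _ (Y n) (cst m)).
Qed.

(** The same exchange of integrals, now with dominated convergence in the centre [c] of the
    kernel. *)
Lemma cvg_smoothed {d} {T : measurableType d} {R : realType}
    (P : probability T R) (Y : nat -> T -> R * R)
    {d'} {T' : measurableType d'} (Q : probability T' R) (Z : T' -> R * R)
    (s : R) (F : R * R -> R) (M : R) :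
  s != 0 -> measurable_fun setT F -> (forall c, `|F c| <= M) ->
  (forall n, measurable_fun setT (Y n)) -> measurable_fun setT Z ->
  (forall a b c, \int[P]_w cos (a * (Y n w).1 + b * (Y n w).2 + c) @[n --> \oo] -->
     \int[Q]_w cos (a * (Z w).1 + b * (Z w).2 + c)) ->
  let g z := \int[prod_prob (normal_prob 0 1) (normal_prob 0 1)]_c (F c * normal_pdf2 s z c) in
  \int[P]_w g (Y n w) @[n --> \oo] --> \int[Q]_w g (Z w).
Proof.
move=> s0 mF FM mY mZ H g.
have M0 : 0 <= M by exact: le_trans (normr_ge0 _) (FM (0, 0)).
have hb z c : `|F c * normal_pdf2 s z c| <= M * normal_peak s ^+ 2.
  by rewrite normrM ler_pM// normal_pdf2_bound.
pose N := prod_prob (@normal_prob R 0 1) (normal_prob 0 1).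
have mh d0 (S : measurableType d0) (y m : S -> R * R) : measurable_fun setT y ->
    measurable_fun setT m -> measurable_fun setT (fun t => F (m t) * normal_pdf2 s (y t) (m t)).
  move=> my mm; apply: measurable_funM; first exact: measurableT_comp.
  exact: measurable_normal_pdf2.
have ip d0 (S : measurableType d0) (U : probability S R) (y : S -> R * R) c :
    measurable_fun setT y -> U.-integrable setT (EFin \o (fun w => normal_pdf2 s (y w) c)).
  move=> my; apply: (@bounded_integrable _ _ _ _ _ (normal_peak s ^+ 2)) => [|w].
    by apply: measurable_normal_pdf2 => //; exact: measurable_cst.
  exact: normal_pdf2_bound.
have SW d0 (S : measurableType d0) (U : probability S R) (y : S -> R * R) : measurable_fun setT y ->
    \int[U]_w g (y w) = \int[N]_c (F c * \int[U]_w normal_pdf2 s (y w) c).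
  move=> my.
  transitivity (\int[N]_c \int[U]_w (F c * normal_pdf2 s (y w) c)).
    apply: (@Rintegral_swap _ _ _ _ _ U N (fun z => F z.2 * normal_pdf2 s (y z.1) z.2) (M * normal_peak s ^+ 2)) => //.
    by apply: (mh _ _ (fun z => y z.1) (fun z => z.2)); [exact: measurableT_comp|exact: measurable_snd].
  by apply: eq_Rintegral => c _; rewrite RintegralZl//; exact: ip.
rewrite SW//; under eq_fun do rewrite SW//.
have mint d0 (S : measurableType d0) (U : probability S R) (y : S -> R * R) : measurable_fun setT y ->
    measurable_fun setT (fun c => F c * \int[U]_w normal_pdf2 s (y w) c).
  move=> my; apply: measurable_funM => //.
  apply: (@measurable_Rintegral2 _ _ _ _ _ U (fun z : (R * R) * S => normal_pdf2 s (y z.2) z.1) (normal_peak s ^+ 2)).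
    apply: measurable_normal_pdf2 => //; exact: measurableT_comp.
  by move=> z; exact: normal_pdf2_bound.
apply: (@Rintegral_dct _ _ _ N (fun n c => F c * \int[P]_w normal_pdf2 s (Y n w) c) _ (fun=> M * normal_peak s ^+ 2)).
- by move=> n; exact: mint.
- exact: mint.
- exact: finite_measure_integrable_cst.
- apply: aeW => c; apply: cvgM; first exact: cvg_cst.
  exact: cvg_normal_pdf2.
- apply: aeW => c n; rewrite normrM ler_pM//.
  by apply: Rintegral_le_bound => [|w]; [exact: ip|exact: normal_pdf2_bound].
Qed.

Lemma cvg_test_function {d} {T : measurableType d} {R : realType}
    (P : probability T R) (Y : nat -> T -> R * R)
    {d'} {T' : measurableType d'} (Q : probability T' R) (Z : T' -> R * R)
    (F : R * R -> R) (M L : R) :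
  measurable_fun setT F -> (forall c, `|F c| <= M) -> 0 <= L ->
  (forall n, measurable_fun setT (Y n)) -> measurable_fun setT Z ->
  (forall a b c, \int[P]_w cos (a * (Y n w).1 + b * (Y n w).2 + c) @[n --> \oo] -->
     \int[Q]_w cos (a * (Z w).1 + b * (Z w).2 + c)) ->
  let f c := F c * normal_pdf2 1 (0, 0) c in
  (forall x y, `|f x - f y| <= L * dist2 x y) ->
  \int[P]_w f (Y n w) @[n --> \oo] --> \int[Q]_w f (Z w).
Proof.
move=> mF FM L0 mY mZ H f fL.
have M0 : 0 <= M by exact: le_trans (normr_ge0 _) (FM (0, 0)).
have o0 : (1 : R) != 0 by exact: oner_neq0.
have mf : measurable_fun setT f.
  by apply: measurable_funM => //; exact: measurable_normal_pdf2.
have fM c : `|f c| <= M * normal_peak 1 ^+ 2.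
  by rewrite normrM ler_pM// normal_pdf2_bound.
apply/cvgrPdist_le => e e0.
(* This bandwidth makes the smoothing error [4 * L * s] at most [e / 4]; the [+ 1] covers
   [L = 0]. *)
pose s := e / (16 * (L + 1)).
have L1 : 0 < 16 * (L + 1) by rewrite mulr_gt0// ltr_pwDr.
have s0 : 0 < s by rewrite divr_gt0.
have sn0 : s != 0 by rewrite gt_eqF.
have sL : 4 * L * s <= e / 4.
  rewrite /s mulrA ler_pdivrMr// (_ : e / 4 * (16 * (L + 1)) = 4 * L * e + 4 * e); last by field.
  by rewrite lerDl mulr_ge0// ltW.
pose g z := \int[prod_prob (normal_prob 0 1) (normal_prob 0 1)]_c (F c * normal_pdf2 s z c).
have gf z : `|g z - f z| <= e / 4.
  by apply: le_trans sL; exact: (gaussian_smoothing_dist _ s0 mF FM L0 fL).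
have hb z c : `|F c * normal_pdf2 s z c| <= M * normal_peak s ^+ 2.
  by rewrite normrM ler_pM// normal_pdf2_bound.
have mg : measurable_fun setT g.
  apply: (@measurable_Rintegral2 _ _ _ _ _ (prod_prob (normal_prob 0 1) (normal_prob 0 1)) (fun z : (R * R) * (R * R) => F z.2 * normal_pdf2 s z.1 z.2) (M * normal_peak s ^+ 2)) => //.
  by apply: measurable_funM; [exact: measurableT_comp|exact: measurable_normal_pdf2].
have gb z : `|g z| <= M * normal_peak 1 ^+ 2 + e / 4.
  rewrite -(subrK (f z) (g z)) addrC (le_trans (ler_normD _ _))//.
  by rewrite lerD.
have close d0 (S : measurableType d0) (U : probability S R) (y : S -> R * R) : measurable_fun setT y ->
    `|\int[U]_w g (y w) - \int[U]_w f (y w)| <= e / 4.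
  move=> my; apply: Rintegral_sub_le => [||w]; last exact: gf.
    apply: (@bounded_integrable _ _ _ _ _ (M * normal_peak 1 ^+ 2 + e / 4)) => [|w]; last exact: gb.
    exact: measurableT_comp mg my.
  apply: (@bounded_integrable _ _ _ _ _ (M * normal_peak 1 ^+ 2)) => [|w]; last exact: fM.
  exact: measurableT_comp mf my.
have e4 : 0 < e / 4 by rewrite divr_gt0.
have := cvg_smoothed sn0 mF FM mY mZ H => /cvgrPdist_le/(_ _ e4).
apply: filterS => n.
have := close _ _ P (Y n) (mY n); have := close _ _ Q Z mZ.
rewrite /g !ler_norml => /andP[? ?] /andP[? ?] /andP[? ?]; apply/andP; split; lra.
Qed.

(* Compact support makes the quotient by a Gaussian density bounded. *)
Definition truncated {R : realType} (f : R * R -> R) (m : R) (x : R * R) : R :=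
  Num.min (inf_conv f m x) (Num.max 0 (m - dist2 x (0, 0))).

Lemma minr_dist_le {R : realType} (a b a' b' : R) :
  `|Num.min a b - Num.min a' b'| <= `|a - a'| + `|b - b'|.
Proof.
have h1 := ler_norm (a - a'); have h2 := ler_norm (b - b').
have h3 := ler_norm (a' - a); have h4 := ler_norm (b' - b).
rewrite (distrC a' a) in h3; rewrite (distrC b' b) in h4.
have := normr_ge0 (a - a'); have := normr_ge0 (b - b') => *.
rewrite ler_norml; apply/andP; split.
  rewrite lerBrDr; have [ab|ab] := leP a b; have [ab'|ab'] := leP a' b'; lra.
rewrite lerBlDr; have [ab|ab] := leP a b; have [ab'|ab'] := leP a' b'; lra.
Qed.

Lemma truncated_lipschitz {R : realType} (f : R * R -> R) (M m : R) :
  (forall z, `|f z| <= M) -> 0 <= m ->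
  forall x y, `|truncated f m x - truncated f m y| <= (m + 1) * dist2 x y.
Proof.
move=> fM m0 x y; have [_ _ h] := inf_conv_props fM m0.
rewrite (le_trans (minr_dist_le _ _ _ _))// mulrDl mul1r lerD//.
have t1 := dist2_triangle y x (0, 0); have t2 := dist2_triangle x y (0, 0).
rewrite (dist2C y x) in t2; have := dist2_ge0 x y => *.
by rewrite ler_norml; apply/andP; split; (rewrite lerBrDr || rewrite lerBlDr);
  have [?|?] := leP 0 (m - dist2 x (0, 0)); have [?|?] := leP 0 (m - dist2 y (0, 0)); lra.
Qed.

Lemma inf_conv_ge0 {R : realType} (f : R * R -> R) (m : R) (x : R * R) :
  (forall z, 0 <= f z) -> 0 <= m -> 0 <= inf_conv f m x.
Proof.
move=> f0 m0; apply: lb_le_inf; first by exists (f x + m * dist2 x x), x.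
by move=> _ [y _ <-]; rewrite addr_ge0// mulr_ge0// dist2_ge0.
Qed.

Lemma truncated_cvg {R : realType} (f : R * R -> R) (M : R) (x : R * R) :
  (forall z, `|f z| <= M) -> continuous f ->
  truncated f n%:R x @[n --> \oo] --> f x.
Proof.
move=> fM cf; have h := @inf_conv_cvg _ f M x fM cf.
apply: cvg_trans h; apply: near_eq_cvg; near=> n.
have [_ h1 _] := inf_conv_props fM (ler0n R n).
have : M + dist2 x (0, 0) <= n%:R by near: n; exact: nbhs_infty_ger.
have := h1 x; rewrite /truncated ler_norml => /andP[_ ?] ?.
by rewrite minEle le_max (_ : inf_conv _ _ _ <= _ - _) ?orbT//; lra.
Unshelve. all: by end_near.
Qed.

Lemma normal_pdf_ge_bound {R : realType} (m x : R) : `|x| <= m ->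
  normal_pdf 0 1 m <= normal_pdf 0 1 x.
Proof.
move=> xm; have o0 : (1 : R) != 0 by exact: oner_neq0.
rewrite !normal_pdf0E// ler_wpM2l ?normal_peak_ge0// ler_expR.
rewrite !mulNr lerN2 ler_wpM2l ?invr_ge0 ?mulr_ge0 ?sqr_ge0//.
by rewrite -(real_normK (num_real x)) ler_sqr ?nnegrE ?(le_trans _ xm).
Qed.

(** The support lies in [dist2 c (0, 0) <= m], where both coordinates are at most [m] in absolute
    value, so each Gaussian factor is at least its value at [m]. *)
Lemma truncated_weight {R : realType} (f : R * R -> R) (M m : R) :
  (forall z, 0 <= f z) -> (forall z, `|f z| <= M) -> 0 <= m ->
  exists2 F : R * R -> R, measurable_fun setT F /\ (forall c, `|F c| <= M / normal_pdf 0 1 m ^+ 2) &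
    forall c, truncated f m c = F c * normal_pdf2 1 (0, 0) c.
Proof.
move=> f0 fM m0; have o0 : (1 : R) != 0 by exact: oner_neq0.
have p0 (x : R) : 0 < normal_pdf 0 1 x.
  by rewrite normal_pdf0E// mulr_gt0 ?expR_gt0// normal_peak_gt0.
have w0 (c : R * R) : 0 < normal_pdf2 1 (0, 0) c by rewrite mulr_gt0.
have [_ h1 _] := inf_conv_props fM m0.
have M0 : 0 <= M by exact: le_trans (normr_ge0 _) (fM (0, 0)).
exists (fun c => truncated f m c / normal_pdf2 1 (0, 0) c); last first.
  by move=> c; rewrite divfK// gt_eqF.
split.
  apply: measurable_funM.
    apply: continuous_measurable_fun2; apply: lipschitz2_continuous.
    exact: (truncated_lipschitz fM m0).
  have -> : (fun c => (normal_pdf2 1 (0, 0) c)^-1) = (fun c : R * R =>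
      normal_peak 1 ^- 2 * (expR (2^-1 * c.1 ^+ 2) * expR (2^-1 * c.2 ^+ 2))).
    apply/funext => c; rewrite /normal_pdf2 !normal_pdf0E// expr1n mulr1 !invfM !mulNr !expRN !invrK.
    by ring.
  by apply: measurable_funM => //; apply: measurable_funM; apply: measurableT_comp => //;
    apply: measurable_funM => //; apply: measurable_funX.
move=> c; have t0 : 0 <= truncated f m c.
  by rewrite /truncated le_min inf_conv_ge0//= le_max lexx.
rewrite normrM normrV ?unitfE ?gt_eqF// !ger0_norm// ?(ltW (w0 _))//.
have [cm|cm] := leP (dist2 c (0, 0)) m; last first.
  rewrite (_ : truncated f m c = 0) ?mul0r ?divr_ge0 ?exprn_ge0 ?(ltW (p0 _))//.
  rewrite /truncated (max_idPl _); last by rewrite subr_le0 ltW.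
  by apply/min_idPr; exact: inf_conv_ge0.
rewrite /dist2 /= !subr0 in cm.
have c1 : `|c.1| <= m by apply: le_trans cm; rewrite lerDl.
have c2 : `|c.2| <= m by apply: le_trans cm; rewrite lerDr.
apply: ler_pM => //; first by rewrite invr_ge0 ltW.
  rewrite /truncated ge_min; apply/orP; left.
  by apply: le_trans (h1 c); exact: ler_norm.
rewrite lef_pV2 ?posrE ?exprn_gt0// expr2 /normal_pdf2 /=.
by apply: ler_pM; rewrite ?(ltW (p0 _))// normal_pdf_ge_bound.
Qed.

(** A form of Levy's continuity theorem. Since the limit law is given, lower bounds for the
    expectations of [f] and of [- f] suffice, and compactly supported Lipschitz minorants provide
    them, in the role otherwise played by tightness. *)
Lemma cvg_in_distribution_cos {d} {T : measurableType d} {R : realType}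
    (P : probability T R) (Y : nat -> T -> R * R)
    {d'} {T' : measurableType d'} (Q : probability T' R) (Z : T' -> R * R) :
  (forall n, measurable_fun setT (Y n)) -> measurable_fun setT Z ->
  (forall a b c, \int[P]_w cos (a * (Y n w).1 + b * (Y n w).2 + c) @[n --> \oo] -->
     \int[Q]_w cos (a * (Z w).1 + b * (Z w).2 + c)) ->
  cvg_in_distribution P Y Q Z.
Proof.
move=> mY mZ H f cf [M fM].
have M0 : 0 <= M by exact: le_trans (normr_ge0 _) (fM (0, 0)).
have mf := continuous_measurable_fun2 cf.
have iU d0 (S : measurableType d0) (U : probability S R) (y : S -> R * R) (g : R * R -> R) (N : R) :
    measurable_fun setT y -> continuous g -> (forall z, `|g z| <= N) ->
    U.-integrable setT (EFin \o (fun w => g (y w))).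
  move=> my cg gN; apply: (@bounded_integrable _ _ _ _ _ N) => [|w]; last exact: gN.
  by apply: measurableT_comp => //; exact: continuous_measurable_fun2.
rewrite integral_EFin_Rintegral; last exact: iU fM.
under eq_fun do rewrite (integral_EFin_Rintegral (iU _ _ _ _ _ _ (mY _) cf fM)).
apply: cvg_EFin; first by apply: nearW.

(* One-sided bound; the other one follows by applying it to [- f]. *)
suff lower (g : R * R -> R) : continuous g -> (forall z, `|g z| <= M) ->
    forall e, 0 < e -> \forall n \near \oo,
      \int[Q]_w g (Z w) - e <= \int[P]_w g (Y n w).
  have cNf : continuous (fun z => - f z) by move=> z; apply: cvgN; exact: cf.
  have NfM z : `|- f z| <= M by rewrite normrN.
  have NE d1 (S : measurableType d1) (U : probability S R) (h : S -> R) :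
      U.-integrable setT (EFin \o h) -> \int[U]_w (- h w) = - \int[U]_w h w.
    move=> hi; under eq_Rintegral do rewrite -mulN1r.
    by rewrite RintegralZl// mulN1r.
  have iQ := iU _ _ Q Z f M mZ cf fM; have iP n := iU _ _ P (Y n) f M (mY n) cf fM.
  apply/cvgrPdist_le => e e0.
  have lf := lower f cf fM e e0; have lN := lower _ cNf NfM e e0.
  near=> n => /=.
  rewrite ler_norml; apply/andP; split.
    have : \int[Q]_w (- f (Z w)) - e <= \int[P]_w (- f (Y n w)).
      by near: n.
    rewrite !NE; [lra|exact: iP|exact: iQ].
  have : \int[Q]_w f (Z w) - e <= \int[P]_w f (Y n w).
    by near: n.
  lra.
move=> cg gM e e0.
(* A cutoff stays below a function only if the latter is nonnegative; the added constant has the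
   same integral [M] under both laws and cancels. *)
pose h z := g z + M.
have h0 z : 0 <= h z by have := gM z; rewrite ler_norml /h => /andP[? _]; lra.
have ch : continuous h by move=> z; apply: cvgD; [exact: cg|exact: cvg_cst].
have hM z : `|h z| <= M + M by rewrite (le_trans (ler_normD _ _))// lerD// ger0_norm.
have hE d0 (S : measurableType d0) (U : probability S R) (y : S -> R * R) : measurable_fun setT y ->
    \int[U]_w h (y w) = \int[U]_w g (y w) + M.
  move=> my; rewrite RintegralD//; [|exact: iU gM|exact: finite_measure_integrable_cst].
  by rewrite Rintegral_prob_cst.
have tl m := truncated_lipschitz hM (ler0n R m).
have ct m := lipschitz2_continuous (tl m).
have tb m z : `|truncated h m%:R z| <= M + M.
  have [i1 i2 _] := inf_conv_props hM (ler0n R m).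
  rewrite ger0_norm /truncated.
    by rewrite ge_min (le_trans (ler_norm _) (i2 z)).
  by rewrite le_min inf_conv_ge0//= le_max lexx.
have L1 : \int[Q]_w truncated h m%:R (Z w) @[m --> \oo] --> \int[Q]_w h (Z w).
  apply: (@Rintegral_dct _ _ _ Q (fun m w => truncated h m%:R (Z w)) _ (fun=> M + M)).
  - by move=> m; apply: measurableT_comp mZ; exact: continuous_measurable_fun2.
  - by apply: measurableT_comp mZ; exact: continuous_measurable_fun2.
  - exact: finite_measure_integrable_cst.
  - by apply: aeW => w; exact: (@truncated_cvg _ h (M + M) (Z w)).
  - by apply: aeW => w m; exact: tb.
have e2 : 0 < e / 2 by rewrite divr_gt0.
have [m _ Hm] : \forall m \near \oo, \int[Q]_w h (Z w) - e / 2 <= \int[Q]_w truncated h m%:R (Z w).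
  move/cvgrPdist_le : L1 => /(_ _ e2); apply: filterS => m.
  by rewrite ler_norml => /andP[_]; lra.
have {}Hm := Hm m (leqnn m).
have [F [mF FM] FE] := truncated_weight h0 hM (ler0n R m).
have tE : truncated h m%:R = (fun c => F c * normal_pdf2 1 (0, 0) c) by apply/funext.
have FL x y : `|F x * normal_pdf2 1 (0, 0) x - F y * normal_pdf2 1 (0, 0) y| <= (m%:R + 1) * dist2 x y.
  by rewrite -!FE; exact: tl.
have L10 : 0 <= m%:R + 1 :> R by rewrite addr_ge0.
have := cvg_test_function mF FM L10 mY mZ H FL => /cvgrPdist_le/(_ _ e2).
apply: filterS => n; rewrite ler_norml => /andP[_ Hn].
have : \int[P]_w truncated h m%:R (Y n w) <= \int[P]_w h (Y n w).
  apply: Rintegral_ge_bound => [||w]; [exact: iU (tb m)|exact: iU hM|].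
  have [i1 _ _] := inf_conv_props hM (ler0n R m).
  by rewrite /truncated ge_min i1.
move: Hm; rewrite !hE// tE; lra.
Unshelve. all: by end_near.
Qed.

(** Uniqueness is the continuity theorem for a constant sequence, with the second coordinate set to
    0: expectations of bounded continuous functions agree, and these approximate indicators of
    rays. *)
Lemma cos_transform_unique {d} {T : measurableType d} {R : realType}
    (P : probability T R) {d'} {T' : measurableType d'} (Q : probability T' R)
    (Y : T -> R) (Z : T' -> R) :
  measurable_fun setT Y -> measurable_fun setT Z ->
  (forall a c, \int[P]_w cos (a * Y w + c) = \int[Q]_w cos (a * Z w + c)) ->
  forall B : set R, measurable B -> P (Y @^-1` B) = Q (Z @^-1` B).
Proof.
move=> mY mZ H.
have mp d0 (S : measurableType d0) (y : S -> R) : measurable_fun setT y ->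
    measurable_fun setT (fun w => (y w, 0 : R)).
  by move=> my; apply/measurable_fun_pairP; split => //=; exact: measurable_cst.
have CD : cvg_in_distribution P (fun _ w => (Y w, 0)) Q (fun w => (Z w, 0)).
  apply: cvg_in_distribution_cos => [n||a b c]; [exact: mp|exact: mp|].
  rewrite /= (_ : \int[Q]_w _ = \int[P]_w cos (a * Y w + b * 0 + c)); first exact: cvg_cst.
  under [RHS]eq_Rintegral do rewrite mulr0 addr0.
  by under eq_Rintegral do rewrite mulr0 addr0; rewrite H.
have eqC (g : R -> R) (M : R) : continuous g -> (forall x, `|g x| <= M) ->
    \int[P]_w g (Y w) = \int[Q]_w g (Z w).
  move=> cg gM.
  have cg2 : continuous (fun z : R * R => g z.1).
    by move=> z; apply: (@continuous_comp _ _ _ fst g); [exact: cvg_fst|exact: cg].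
  have /cvg_lim := CD _ cg2 (ex_intro _ M (fun z => gM z.1)).
  by rewrite lim_cst// /Rintegral => ->.
have mg_ (g : R -> R) : continuous g -> measurable_fun setT g by exact: continuous_measurable_fun.
have eqI (a : R) : P (Y @^-1` `]-oo, a]) = Q (Z @^-1` `]-oo, a]).
  (* Piecewise linear, equal to 1 up to [a] and to 0 from [a + m^-1] on (for positive [m]), hence
     decreasing to the indicator of the ray. *)
  pose g (m : nat) (x : R) := Num.max 0 (Num.min 1 (1 - m%:R * (x - a))).
  have cg m : continuous (g m).
    move=> x; apply/cvgrPdist_le => e e0; near=> y.
    apply: (@le_trans _ _ (m%:R * `|x - y|)).
      have E : m%:R * (x - a) - m%:R * (y - a) = m%:R * (x - y) by ring.
      have := ler_norm (m%:R * (x - y)); have := ler_norm (- (m%:R * (x - y))).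
      rewrite normrN normrM normr_nat -E /g => h1 h2.
      rewrite ler_norml; apply/andP; split; (rewrite lerBrDr || rewrite lerBlDr).
        by case: (leP 1 (1 - m%:R * (x - a))) => ?; case: (leP 1 (1 - m%:R * (y - a))) => ?;
          (repeat match goal with |- context [Num.max 0 ?u] => case: (leP 0 u) => ? end); lra.
      by case: (leP 1 (1 - m%:R * (x - a))) => ?; case: (leP 1 (1 - m%:R * (y - a))) => ?;
        (repeat match goal with |- context [Num.max 0 ?u] => case: (leP 0 u) => ? end); lra.
    apply: (@le_trans _ _ ((m%:R + 1) * `|x - y|)); first by rewrite ler_wpM2r// lerDl.
    have m1 : 0 < m%:R + 1 :> R by rewrite ltr_pwDr.
    rewrite -ler_pdivlMl//; near: y.
    have e1 : 0 < (m%:R + 1)^-1 * e by rewrite mulr_gt0 ?invr_gt0.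
    by have /cvgrPdist_le/(_ _ e1) := @cvg_id _ (nbhs x).
  have g1 m x : `|g m x| <= 1.
    rewrite /g ger0_norm ?le_max ?lexx// ge_max ler01 /=.
    by rewrite ge_min lexx.
  have gcv x : g m x @[m --> \oo] --> (\1_`]-oo, a] x : R).
    rewrite indicE; have [xa|ax] := leP x a.
      rewrite mem_set /= ?in_itv//=.
      rewrite (_ : (fun m => g m x) = fun=> 1); first exact: cvg_cst.
      apply/funext => m; rewrite /g (min_idPl _) ?(max_idPr _)//.
      by rewrite lerBrDr gerDl mulr_ge0_le0// subr_le0.
    rewrite memNset /= ?in_itv/=; last by apply/negP; rewrite -ltNge.
    apply/cvgrPdist_le => e e0; near=> m.
    rewrite /g (max_idPl _); first by rewrite subrr normr0 ltW.
    rewrite ge_min; apply/orP; right.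
    rewrite subr_le0 -ler_pdivrMr ?subr_gt0//; near: m; exact: nbhs_infty_ger.
  have cvI d0 (S : measurableType d0) (U : probability S R) (y : S -> R) : measurable_fun setT y ->
      \int[U]_w g m (y w) @[m --> \oo] --> fine (U (y @^-1` `]-oo, a])).
    move=> my.
    have my1 : measurable (y @^-1` `]-oo, a]) by rewrite -[X in measurable X]setTI; exact: my.
    rewrite (_ : fine _ = \int[U]_w \1_(y @^-1` `]-oo, a]) w); last first.
      by rewrite /Rintegral integral_indic// setIT.
    apply: (@Rintegral_dct _ _ _ U (fun m w => g m (y w)) _ (fun=> 1)).
    - by move=> m; apply: measurableT_comp my; exact: mg_.
    - exact: measurable_indic.
    - exact: finite_measure_integrable_cst.
    - by apply: aeW => w; exact: (gcv (y w)).
    - by apply: aeW => w m; exact: g1.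
  have := cvI _ _ P Y mY; under eq_fun do rewrite (eqC _ _ (cg _) (g1 _)).
  move=> h1; have h := cvg_unique (@Rhausdorff R) h1 (cvI _ _ Q Z mZ).
  have mI d0 (S : measurableType d0) (y : S -> R) : measurable_fun setT y -> measurable (y @^-1` `]-oo, a]).
    by move=> my; rewrite -[X in measurable X]setTI; exact: my.
  rewrite -[LHS]fineK; last by apply: fin_num_measure; exact: mI.
  by rewrite h fineK//; apply: fin_num_measure; exact: mI.
pose Ym : {mfun T >-> measurableTypeR R} := @mfun_Sub _ _ T (measurableTypeR R) _ (mem_set mY).
pose Zm : {mfun T' >-> measurableTypeR R} := @mfun_Sub _ _ T' (measurableTypeR R) _ (mem_set mZ).
apply: (@eq_measure_cdf _ (distribution P Ym) (distribution Q Zm)) => x.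
exact: eqI.
Unshelve. all: by end_near.
Qed.

(** * Gaussian vectors *)

Lemma sqrtr_gt0_neq0 {R : realType} (v : R) : 0 < v -> Num.sqrt v != 0.
Proof.
by move=> v0; rewrite gt_eqF// sqrtr_gt0.
Qed.

(** The cosine transform determines the law. Zero variance is a separate case, where [gauss_law] is
    a Dirac mass. *)
Lemma gauss_law_cos {R : realType} {d} {T : measurableType d} (Q : probability T R)
    (Z : T -> R) (v : R) :
  measurable_fun setT Z -> 0 <= v ->
  (forall t c, \int[Q]_w cos (t * Z w + c) = expR (- (v * t ^+ 2 / 2)) * cos c) ->
  is_normal_rv Q Z 0 v.
Proof.
move=> mZ v0 H; split=> // B mB; rewrite /gauss_law; case: ifPn => [vp|].
  have s0 := sqrtr_gt0_neq0 vp.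
  rewrite -[RHS](_ : normal_prob 0 (Num.sqrt v) (id @^-1` B) = _)//.
  apply: (@cos_transform_unique _ _ _ Q _ _ (normal_prob 0 (Num.sqrt v)) Z id) => // a c.
  rewrite H; under eq_Rintegral do rewrite addrC.
  by rewrite Rintegral_normal_cos// sqr_sqrtr.
rewrite -leNgt => vn; have {v0 vn} vz : v = 0 by apply/eqP; rewrite eq_le v0 vn.
pose D : probability R R := \d_(0 : R).
rewrite -[RHS](_ : D (id @^-1` B) = _)//.
apply: (@cos_transform_unique _ _ _ Q _ _ D Z id) => // a c.
rewrite H vz mul0r mul0r oppr0 expR0 mul1r /Rintegral integral_dirac//.
  by rewrite diracT mul1e /= mulr0 add0r.
apply/measurable_EFinP; apply: measurable_fun_cos; exact: measurable_funD.
Qed.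

Lemma Rintegral_two_normals_cos {R : realType} (t1 t2 c : R) :
  \int[prod_prob (normal_prob 0 1) (normal_prob 0 1)]_z cos (t1 * z.1 + t2 * z.2 + c) =
  expR (- ((t1 ^+ 2 + t2 ^+ 2) / 2)) * cos c.
Proof.
have o0 : (1 : R) != 0 by exact: oner_neq0.
rewrite (@Rintegral_prod _ _ _ _ _ _ _ _ 1); last 2 first.
- apply: measurable_fun_cos; apply: measurable_funD => //.
  by apply: measurable_funD; apply: measurable_funM => //.
- by move=> z; exact: normr_cos_le1.
transitivity (\int[normal_prob 0 1]_x (expR (- (t2 ^+ 2 / 2)) * cos (c + t1 * x))).
  apply: eq_Rintegral => x _ /=.
  have := Rintegral_normal_cos (c + t1 * x) t2 o0; rewrite expr1n mul1r => <-.
  by apply: eq_Rintegral => y _; congr cos; ring.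
rewrite RintegralZl//; last first.
  apply: (@bounded_integrable _ _ _ _ _ 1) => [|w]; last exact: normr_cos_le1.
  by apply: measurable_fun_cos; apply: measurable_funD => //; exact: measurable_funM.
rewrite Rintegral_normal_cos// mulrA -expRD; congr (expR _ * _); rewrite expr1n; ring.
Qed.

(** Cholesky factorisation applied to two independent standard normals. The pivot is the second
    variance because in the theorem the first one vanishes for [r = 0]. *)
Lemma gaussian_vector_exists {R : realType} (v1 v2 c12 : R) :
  0 < v2 -> c12 ^+ 2 <= v1 * v2 ->
  exists (d : measure_display) (T : measurableType d) (Q : probability T R) (W1 W2 : T -> R),
    [/\ measurable_fun setT W1, measurable_fun setT W2,
       centered_gaussian_vector Q W1 W2 v1 v2 c12 &
       forall a b c, \int[Q]_w cos (a * W1 w + b * W2 w + c) =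
         expR (- ((a ^+ 2 * v1 + 2 * a * b * c12 + b ^+ 2 * v2) / 2)) * cos c].
Proof.
move=> v20 c12le.
pose q := Num.sqrt v2; pose p := Num.sqrt (v1 - c12 ^+ 2 / v2).
have q0 : q != 0 by exact: sqrtr_gt0_neq0.
have qE : q ^+ 2 = v2 by rewrite sqr_sqrtr// ltW.
have pE : p ^+ 2 = v1 - c12 ^+ 2 / v2.
  by rewrite sqr_sqrtr// subr_ge0 ler_pdivrMr.
pose Q := prod_prob (@normal_prob R 0 1) (@normal_prob R 0 1).
exists _, _, Q, (fun z => c12 / q * z.2 + p * z.1), (fun z => q * z.2).
have m1 : measurable_fun setT (fun z : R * R => c12 / q * z.2 + p * z.1).
  by apply: measurable_funD; apply: measurable_funM => //.
have m2 : measurable_fun setT (fun z : R * R => q * z.2) by apply: measurable_funM => //.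
have key a b c : \int[Q]_w cos (a * (c12 / q * w.2 + p * w.1) + b * (q * w.2) + c) =
    expR (- ((a ^+ 2 * v1 + 2 * a * b * c12 + b ^+ 2 * v2) / 2)) * cos c.
  transitivity (\int[Q]_w cos ((a * p) * w.1 + (a * (c12 / q) + b * q) * w.2 + c)).
    by apply: eq_Rintegral => z _; congr cos; ring.
  rewrite Rintegral_two_normals_cos; congr (expR (- (_ / 2)) * _).
  rewrite exprMn pE -qE; field; exact: q0.
split=> // a b.
have v0 : 0 <= a ^+ 2 * v1 + 2 * a * b * c12 + b ^+ 2 * v2.
  rewrite (_ : _ + _ + _ = (a * p) ^+ 2 + (a * (c12 / q) + b * q) ^+ 2).
    by rewrite addr_ge0 ?sqr_ge0.
  by rewrite exprMn pE -qE; field; exact: q0.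
apply: gauss_law_cos => // [|t c].
  by apply: measurable_funD; apply: measurable_funM => //.
transitivity (\int[Q]_w cos ((t * a) * (c12 / q * w.2 + p * w.1) + (t * b) * (q * w.2) + c)).
  by apply: eq_Rintegral => z _; congr cos; ring.
by rewrite key; congr (expR (- _) * _); field.
Qed.

(** * One exceedance *)

Lemma Rintegral_std_exp_memoryless {R : realType} (s : R) (f : R -> R) (M : R) :
  0 <= s -> measurable_fun setT f -> (forall x, `|f x| <= M) ->
  \int[@std_exp R]_x ((s < x)%R%:R * f (x - s)) = expR (- s) * \int[@std_exp R]_x f x.
Proof.
move=> s0 mf fM.
have g0 x : 0 <= M + f x by have := fM x; rewrite ler_norml => /andP[? _]; lra.
have mg : measurable_fun setT (fun x => M + f x) by exact: measurable_funD.
have mi : measurable_fun setT (fun x : R => (s < x)%R%:R : R).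
  by apply: measurable_natr_bool; exact: measurable_fun_ltr.
have ib : (@std_exp R).-integrable setT (EFin \o (fun x : R => (s < x)%R%:R : R)).
  by apply: (@bounded_integrable _ _ _ _ _ 1) => // x; exact: natr_bool_le1.
have mfs : measurable_fun setT (fun x : R => f (x - s)).
  by apply: measurableT_comp => //; exact: measurable_funB.
have if1 : (@std_exp R).-integrable setT (EFin \o (fun x : R => (s < x)%R%:R * f (x - s))).
  apply: (@bounded_integrable _ _ _ _ _ M) => [|x]; first exact: measurable_funM.
  exact: natr_bool_bound.
have iff : (@std_exp R).-integrable setT (EFin \o f) by apply: (@bounded_integrable _ _ _ _ _ M).
have ig : (@std_exp R).-integrable setT (EFin \o (fun x => M + f x)).
  by apply: integrable_funD => //; exact: finite_measure_integrable_cst.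
have := std_exp_memoryless s0 mg g0.
rewrite (integral_EFin_Rintegral ig) integral_EFin_Rintegral; last first.
  apply: (@bounded_integrable _ _ _ _ _ (`|M| + `|M|)) => [|x].
    by apply: measurable_funM => //; apply: measurable_funD.
  apply: natr_bool_bound; rewrite (le_trans (ler_normD _ _))// lerD//.
  by apply: le_trans (fM _) _; exact: ler_norm.
rewrite -EFinM => /(congr1 fine) /=.
under eq_Rintegral do rewrite mulrDr [_ * M]mulrC.
rewrite RintegralD//; last exact: integrable_funZl.
rewrite RintegralZl// std_exp_gt// RintegralD//; last exact: finite_measure_integrable_cst.
by rewrite Rintegral_prob_cst mulrDr mulrC => /addrI.
Qed.

Lemma std_exp_norm_moments {R : realType} (a : R) : a < 1 ->
  let E := @std_exp R in
  [/\ E.-integrable setT (EFin \o (fun x : R => expR (a * `|x|))),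
      E.-integrable setT (EFin \o (fun x : R => `|x| * expR (a * `|x|))) &
      E.-integrable setT (EFin \o (fun x : R => x ^+ 2 * expR (a * `|x|)))] /\
  [/\ \int[E]_x expR (a * `|x|) = (1 - a)^-1,
      \int[E]_x (`|x| * expR (a * `|x|)) = (1 - a) ^- 2 &
      \int[E]_x (x ^+ 2 * expR (a * `|x|)) = 2 * (1 - a) ^- 3].
Proof.
move=> a1 E.
have mn : measurable_fun setT (fun x : R => `|x|) by exact: normr_measurable.
have me : measurable_fun setT (fun x : R => expR (a * x)).
  by apply: measurableT_comp => //; exact: measurable_funM.
have men : measurable_fun setT (fun x : R => expR (a * `|x|)) by exact: (measurableT_comp me mn).
have ms : measurable_fun setT (fun x : R => x ^+ 2) by exact: exprn_measurable.
have key (w : R -> R) (c : R) : measurable_fun setT w -> (forall x, 0 <= w x) ->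
    (\int[E]_x (w x * expR (a * x))%:E = c%:E)%E ->
    E.-integrable setT (EFin \o (fun x : R => w x * expR (a * `|x|))) /\
    \int[E]_x (w x * expR (a * `|x|)) = c.
  move=> mw w0 H.
  have H' : (\int[E]_x (w x * expR (a * `|x|))%:E = c%:E)%E.
    rewrite -H !ge0_integral_std_exp//.
    - apply: eq_integral => x; rewrite inE /= in_itv /= andbT => x0.
      by rewrite ger0_norm.
    - exact: measurable_funM.
    - by move=> x; rewrite mulr_ge0// expR_ge0.
    - exact: measurable_funM.
    - by move=> x; rewrite mulr_ge0// expR_ge0.
  split; last by rewrite /Rintegral H'.
  apply/integrableP; split.
    by apply/measurable_EFinP; exact: measurable_funM.
  under eq_integral do rewrite /= ger0_norm ?mulr_ge0 ?expR_ge0//.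
  by rewrite H' ltry.
have [h0 h1 h2] := std_exp_moments a1.
have h0' : (\int[E]_x (1 * expR (a * x))%:E = ((1 - a)^-1)%:E)%E.
  by under eq_integral do rewrite mul1r.
have m1c : measurable_fun setT (fun _ : R => 1 : R) by exact: measurable_cst.
have [i0 e0] := key (fun=> 1) _ m1c (fun=> ler01) h0'.
have [i1 e1] := key (fun x => `|x|) _ mn (fun x => normr_ge0 x) h1.
have [i2 e2] := key (fun x => x ^+ 2) _ ms (fun x => sqr_ge0 x) h2.
have oE : (fun x : R => expR (a * `|x|)) = (fun x => 1 * expR (a * `|x|)).
  by apply/funext => x; rewrite mul1r.
by split; split => //; rewrite oE.
Qed.

(* The increments of the triangular array are [psi / sqrt k + kappa h / k]; all
   the error terms of the second-order Taylor expansion are bounded before the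
   phase [b] is fixed. *)
Lemma triangular_cos_expansion {d} {T : measurableType d} {R : realType}
    (Q : probability T R) (psi w h : T -> R) (h_ : nat -> T -> R)
    (kk kap : nat -> R) (mu v : R) :
  measurable_fun setT psi -> measurable_fun setT w -> measurable_fun setT h ->
  (forall n, measurable_fun setT (h_ n)) ->
  Q.-integrable setT (EFin \o psi) -> \int[Q]_x psi x = 0 ->
  Q.-integrable setT (EFin \o (fun x => psi x ^+ 2)) -> \int[Q]_x psi x ^+ 2 = v ->
  Q.-integrable setT (EFin \o (fun x => w x ^+ 2)) ->
  (forall n x, `|h_ n x| <= w x) ->
  (forall x, h_ n x @[n --> \oo] --> h x) ->
  (forall n, 0 < kk n) -> kk n @[n --> \oo] --> +oo -> kap n @[n --> \oo] --> mu ->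
  exists2 e : nat -> R, e n @[n --> \oo] --> 0 &
    forall n b, `|kk n * (\int[Q]_x cos (b + (psi x / Num.sqrt (kk n) + kap n * h_ n x / kk n)) - cos b)
       + v / 2 * cos b + mu * (\int[Q]_x h x) * sin b| <= e n.
Proof.
move=> mpsi mw mh mh_ ipsi psi0 ipsi2 psiv iw2 hw hcv kk0 kkoo kapmu.
have w0 x : 0 <= w x by exact: le_trans (normr_ge0 _) (hw 0%N x).
have iw : Q.-integrable setT (EFin \o w).
  apply: (@le_integrable _ _ _ Q setT _ _ (EFin \o (fun x => 1 + w x ^+ 2))) => //.
  - exact/measurable_EFinP.
  - move=> x _ /=; rewrite lee_fin [leRHS]ger0_norm ?addr_ge0 ?sqr_ge0//.
    exact: normr_le1Dsqr.
  - by apply: integrable_funD => //; exact: finite_measure_integrable_cst.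
have ih n : Q.-integrable setT (EFin \o h_ n).
  apply: (le_integrable _ _ _ iw) => //; first exact/measurable_EFinP.
  by move=> x _ /=; rewrite lee_fin (ger0_norm (w0 x)).
pose x_ n t := psi t / Num.sqrt (kk n).
(* The scaled remainder of the main part: the quadratic branch dominates it by [3 * psi t ^+ 2],
   while the cubic one makes it [O ((kk n)^(-1/2))] for fixed [t]. *)
pose Tr n t := kk n * Num.min (2 * `|x_ n t| ^+ 3) (3 * x_ n t ^+ 2).
have sq0 n : 0 < Num.sqrt (kk n) by rewrite sqrtr_gt0.
have sqE n : Num.sqrt (kk n) ^+ 2 = kk n by rewrite sqr_sqrtr// ltW.
have mx n : measurable_fun setT (x_ n) by exact: measurable_funM.
have mTr n : measurable_fun setT (Tr n).
  apply: measurable_funM => //; apply: measurable_minr; apply: measurable_funM => //; apply: measurable_funX => //.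
  exact: measurableT_comp.
have kx2 n t : kk n * x_ n t ^+ 2 = psi t ^+ 2.
  by rewrite /x_ exprMn exprVn sqE mulrCA divff ?mulr1// gt_eqF.
have Tr0 n t : 0 <= Tr n t.
  apply: mulr_ge0; first exact: ltW.
  by rewrite le_min; apply/andP; split; rewrite mulr_ge0 ?sqr_ge0 ?exprn_ge0.
have TrM n t : `|Tr n t| <= 3 * psi t ^+ 2.
  rewrite ger0_norm// -(kx2 n) mulrCA ler_wpM2l ?(ltW (kk0 n))//.
  by rewrite ge_min lexx orbT.
have iTM : Q.-integrable setT (EFin \o (fun t => 3 * psi t ^+ 2)) by exact: integrable_funZl.
have iTr n : Q.-integrable setT (EFin \o Tr n).
  apply: (le_integrable _ _ _ iTM) => //; first exact/measurable_EFinP.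
  by move=> x _ /=; rewrite lee_fin [leRHS]ger0_norm// mulr_ge0// sqr_ge0.
have sqoo : (Num.sqrt (kk n))^-1 @[n --> \oo] --> (0 : R).
  apply/cvgrPdist_le => e e0; near=> n.
  rewrite sub0r normrN ger0_norm ?invr_ge0 ?sqrtr_ge0//.
  rewrite invf_ple ?posrE// -ler_sqr ?nnegrE ?invr_ge0 ?sqrtr_ge0 ?(ltW e0)// sqE.
  by near: n; move/cvgryPge : kkoo; apply.
have kinv : (kk n)^-1 @[n --> \oo] --> (0 : R).
  rewrite (_ : (fun n => _) = (fun n => (Num.sqrt (kk n))^-1 * (Num.sqrt (kk n))^-1)).
    by rewrite -[X in _ --> X](mulr0 (0 : R)); exact: cvgM.
  by apply/funext => n; rewrite -invfM -expr2 sqE.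
have LTr : \int[Q]_t Tr n t @[n --> \oo] --> (0 : R).
  rewrite -[X in _ --> X](Rintegral_prob_cst Q 0).
  apply: (@Rintegral_dct _ _ _ Q Tr (fun=> 0) (fun t => 3 * psi t ^+ 2)) => //; last first.
    by apply: aeW => t n; exact: TrM.
  apply: aeW => t; apply: (@squeeze_norm_cvgr0 _ _ _ _ _ (fun n => 2 * `|psi t| ^+ 3 * (Num.sqrt (kk n))^-1)).
    apply: nearW => n; rewrite ger0_norm//.
    apply: (@le_trans _ _ (kk n * (2 * `|x_ n t| ^+ 3))).
      by rewrite ler_wpM2l ?(ltW (kk0 n))// ge_min lexx.
    rewrite /x_ normrM normfV (ger0_norm (ltW (sq0 n))) -[X in X * (2 * _)]sqE exprMn exprVn.
    rewrite le_eqVlt; apply/orP; left; apply/eqP; field; exact: lt0r_neq0.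
  by rewrite -(mulr0 (2 * `|psi t| ^+ 3)); apply: cvgM; [exact: cvg_cst|exact: sqoo].
have Lh : \int[Q]_t h_ n t @[n --> \oo] --> \int[Q]_t h t.
  apply: (@Rintegral_dct _ _ _ Q h_ h w) => //; first exact: aeW.
  by apply: aeW => t n; exact: hw.
pose W2 := \int[Q]_t w t ^+ 2.
(* In order: the square of the perturbation, the Taylor remainder of the main part, the cross term,
   and the convergence of the drift. *)
exists (fun n => 2 * kap n ^+ 2 * (kk n)^-1 * W2 + \int[Q]_t Tr n t +
    `|kap n| * (Num.sqrt (kk n))^-1 * (W2 + v) +
    `|kap n * \int[Q]_t h_ n t - mu * \int[Q]_t h t|).
  have zE : (0 : R) = 2 * mu ^+ 2 * 0 * W2 + 0 + `|mu| * 0 * (W2 + v) + `|mu * \int[Q]_t h t - mu * \int[Q]_t h t|.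
    by rewrite subrr normr0; ring.
  rewrite [X in _ --> X]zE; apply: cvgD; [apply: cvgD; [apply: cvgD|]|].
  - apply: cvgM; last exact: cvg_cst.
    apply: cvgM => //; apply: cvgM; first exact: cvg_cst.
    by rewrite expr2; under eq_fun do rewrite expr2; exact: cvgM.
  - exact: LTr.
  - by apply: cvgM; [apply: cvgM => //; exact: cvg_norm|exact: cvg_cst].
  - by apply: cvg_norm; apply: cvgB; [exact: cvgM|exact: cvg_cst].
move=> n b; set k := kk n; have k0 : 0 < k by exact: kk0.
have kn0 : k != 0 by exact: lt0r_neq0.
have sn0 : Num.sqrt k != 0 by exact: (lt0r_neq0 (sq0 n)).
pose y_ t := kap n * h_ n t / k.
pose rem t := cos (b + (x_ n t + y_ t)) - cos b + x_ n t * sin b + x_ n t ^+ 2 / 2 * cos b + y_ t * sin b.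
have remb t : `|rem t| <= 2 * y_ t ^+ 2 + Num.min (2 * `|x_ n t| ^+ 3) (3 * x_ n t ^+ 2) + 2 * `|y_ t| * `|x_ n t|.
  (* Expand to first order in [y_] around [b + x_], to second order in [x_] around [b], then move
     the sine from [b + x_] back to [b]. *)
  have -> : rem t = (cos (b + x_ n t + y_ t) - cos (b + x_ n t) + y_ t * sin (b + x_ n t)) +
     (cos (b + x_ n t) - cos b + x_ n t * sin b + x_ n t ^+ 2 / 2 * cos b) -
     y_ t * (sin (b + x_ n t) - sin b).
    by rewrite /rem addrA; ring.
  rewrite (le_trans (ler_normB _ _))// lerD//.
    rewrite (le_trans (ler_normD _ _))// lerD//.
      by have [] := cos_taylor1 (b + x_ n t) (y_ t).
    by rewrite le_min; apply/andP; have := cos_taylor2 b (x_ n t).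
  rewrite normrM -mulrA mulrCA ler_wpM2l//; exact: sin_dist_le.
pose bnd t := 2 * kap n ^+ 2 * k^-1 * w t ^+ 2 + Tr n t + `|kap n| * (Num.sqrt k)^-1 * (w t ^+ 2 + psi t ^+ 2).
have krem t : `|k * rem t| <= bnd t.
  rewrite normrM (ger0_norm (ltW k0)); apply: (le_trans (ler_wpM2l (ltW k0) (remb t))).
  rewrite !mulrDr /bnd; apply: lerD; [apply: lerD|] => //.
    have -> : k * (2 * y_ t ^+ 2) = 2 * kap n ^+ 2 * k^-1 * h_ n t ^+ 2.
      by rewrite /y_; field; exact: lt0r_neq0.
    apply: ler_wpM2l; first by rewrite divr_ge0 ?(ltW k0)// mulr_ge0 ?sqr_ge0.
    by rewrite -(real_normK (num_real (h_ n t))) ler_sqr ?nnegrE.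
  have -> : k * (2 * `|y_ t| * `|x_ n t|) = `|kap n| * (Num.sqrt k)^-1 * (2 * `|h_ n t| * `|psi t|).
    rewrite /y_ /x_ !normrM !normfV (ger0_norm (ltW k0)) (ger0_norm (ltW (sq0 n))) -/k.
    by field; apply/andP; split; (exact: kn0 || exact: sn0).
  apply: ler_wpM2l; first by rewrite divr_ge0 ?sqrtr_ge0.
  have := hw n t; have := w0 t; have := sqr_ge0 (w t - `|psi t|); rewrite sqrrB.
  rewrite real_normK ?num_real// => *.
  have : `|h_ n t| * `|psi t| <= w t * `|psi t| by rewrite ler_wpM2r.
  lra.
have ix : Q.-integrable setT (EFin \o (fun t => x_ n t)).
  by rewrite /x_; under eq_fun do rewrite mulrC; exact: integrable_funZl.
have ix2 : Q.-integrable setT (EFin \o (fun t => x_ n t ^+ 2)).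
  rewrite (_ : (fun t => _) = (fun t => k^-1 * psi t ^+ 2)); first exact: integrable_funZl.
  by apply/funext => t; rewrite -(kx2 n t) mulrA mulVf ?mul1r// gt_eqF.
have iy : Q.-integrable setT (EFin \o y_).
  rewrite (_ : y_ = (fun t => (kap n / k) * h_ n t)); first exact: integrable_funZl.
  by apply/funext => t; rewrite /y_; ring.
have my : measurable_fun setT y_.
  by rewrite /y_; apply: measurable_funM => //; apply: measurable_funM => //; exact: mh_.
have ic : Q.-integrable setT (EFin \o (fun t => cos (b + (x_ n t + y_ t)))).
  apply: (@bounded_integrable _ _ _ _ _ 1) => [|t]; last exact: normr_cos_le1.
  by apply: measurable_fun_cos; apply: measurable_funD => //; exact: measurable_funD.
have icst c : Q.-integrable setT (EFin \o (fun=> c)) by exact: finite_measure_integrable_cst.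
have irem : Q.-integrable setT (EFin \o rem).
  rewrite (_ : rem = (fun t => cos (b + (x_ n t + y_ t)) - cos b + sin b * x_ n t + cos b / 2 * x_ n t ^+ 2 + sin b * y_ t)); last first.
    by apply/funext => t; rewrite /rem; field.
  apply: integrable_funD; last exact: integrable_funZl.
  apply: integrable_funD; last exact: integrable_funZl.
  apply: integrable_funD; last exact: integrable_funZl.
  exact: integrable_funB.
have remE : \int[Q]_t rem t = \int[Q]_t cos (b + (x_ n t + y_ t)) - cos b + cos b / 2 * (k^-1 * v) +
    sin b * (kap n / k * \int[Q]_t h_ n t).
  transitivity (\int[Q]_t (cos (b + (x_ n t + y_ t)) - cos b + sin b * (Num.sqrt k)^-1 * psi t + cos b / 2 * k^-1 * psi t ^+ 2 + sin b * (kap n / k) * h_ n t)).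
    apply: eq_Rintegral => t _; rewrite /rem -(kx2 n t) /y_ /x_ -/k.
    by field; apply/andP; split; (exact: kn0 || exact: sn0).
  have iA : Q.-integrable setT (EFin \o (fun t => cos (b + (x_ n t + y_ t)) - cos b)) by exact: integrable_funB.
  have iB : Q.-integrable setT (EFin \o (fun t => sin b * (Num.sqrt k)^-1 * psi t)) by exact: integrable_funZl.
  have iC : Q.-integrable setT (EFin \o (fun t => cos b / 2 * k^-1 * psi t ^+ 2)) by exact: integrable_funZl.
  have iD : Q.-integrable setT (EFin \o (fun t => sin b * (kap n / k) * h_ n t)) by exact: integrable_funZl.
  have iAB := integrable_funD iA iB.
  have iABC := integrable_funD iAB iC.
  rewrite (RintegralD _ iABC iD)// (RintegralD _ iAB iC)// (RintegralD _ iA iB)//.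
  rewrite (RintegralB _ ic (icst _))// Rintegral_prob_cst.
  rewrite (RintegralZl _ _ ipsi)// (RintegralZl _ _ ipsi2)// (RintegralZl _ _ (ih n))//.
  by rewrite psi0 psiv; ring.
have -> : k * (\int[Q]_x cos (b + (psi x / Num.sqrt k + kap n * h_ n x / k)) - cos b)
       + v / 2 * cos b + mu * (\int[Q]_x h x) * sin b =
   k * \int[Q]_t rem t - (kap n * \int[Q]_t h_ n t - mu * \int[Q]_t h t) * sin b.
  rewrite remE /x_ /y_ -/k; field; exact: lt0r_neq0.
rewrite (le_trans (ler_normB _ _))// lerD//; last first.
  by rewrite normrM ler_piMr// ; have := sin_max b; exact.
have ibnd : Q.-integrable setT (EFin \o bnd).
  apply: integrable_funD; first by apply: integrable_funD => //; exact: integrable_funZl.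
  by apply: integrable_funZl; exact: integrable_funD.
apply: (@le_trans _ _ (\int[Q]_t bnd t)).
  rewrite -RintegralZl//.
  have := @Rintegral_dist_le _ _ _ Q (fun t => k * rem t) (fun=> 0) bnd.
  rewrite Rintegral_prob_cst subr0; apply => //; first exact: integrable_funZl.
  by move=> t; rewrite subr0.
have i1 : Q.-integrable setT (EFin \o (fun t => 2 * kap n ^+ 2 * k^-1 * w t ^+ 2)) by exact: integrable_funZl.
have i2 : Q.-integrable setT (EFin \o (fun t => w t ^+ 2 + psi t ^+ 2)) by exact: integrable_funD.
have i3 := integrable_funD i1 (iTr n).
have i4 : Q.-integrable setT (EFin \o (fun t => `|kap n| * (Num.sqrt k)^-1 * (w t ^+ 2 + psi t ^+ 2))) by exact: integrable_funZl.
rewrite (RintegralD _ i3 i4)// (RintegralD _ i1 (iTr n))// (RintegralZl _ _ iw2)//.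
by rewrite (RintegralZl _ _ i2)// (RintegralD _ iw2 ipsi2)// psiv.
Unshelve. all: by end_near.
Qed.

(** From [1 + x <= expR x <= (1 - x)^-1]. *)
Lemma expR_taylor1 {R : realType} (x : R) : `|x| <= 2^-1 ->
  `|expR x - 1 - x| <= 2 * x ^+ 2 /\ `|expR x - 1| <= 2 * `|x| /\ expR x <= 2.
Proof.
move=> xh; have := xh; rewrite ler_norml => /andP[h1 h2].
have e1 := expR_ge1Dx x; have e2 := expR_ge1Dx (- x).
have x1 : 0 < 1 - x by lra.
have eu : expR x <= (1 - x)^-1.
  by rewrite -[expR x]invrK -expRN lef_pV2 ?posrE ?expR_gt0.
have iE : (1 - x)^-1 = 1 + x + x ^+ 2 / (1 - x) by field; exact: lt0r_neq0.
have i2 : x ^+ 2 / (1 - x) <= 2 * x ^+ 2.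
  by rewrite ler_pdivrMr// -mulrA mulrCA; have := sqr_ge0 x => ?; rewrite ler_peMr//; lra.
have x2 : x ^+ 2 <= `|x| / 2.
  by rewrite -(real_normK (num_real x)) expr2; have := normr_ge0 x => ?; rewrite ler_wpM2l//; lra.
have l1 : `|expR x - 1 - x| <= 2 * x ^+ 2 by rewrite ger0_norm; lra.
split=> //; split.
  have := ler_normD (expR x - 1 - x) x; rewrite subrK; lra.
by have := ler_norm x; lra.
Qed.

Lemma std_exp_quad_moment {R : realType} (a c0 c1 c2 : R) : a < 1 ->
  let f := fun x : R => (c0 + c1 * `|x| + c2 * x ^+ 2) * expR (a * `|x|) in
  (@std_exp R).-integrable setT (EFin \o f) /\
  \int[@std_exp R]_x f x = c0 / (1 - a) + c1 / (1 - a) ^+ 2 + 2 * c2 / (1 - a) ^+ 3.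
Proof.
move=> a1 f; have [[i0 i1 i2] [e0 e1 e2]] := std_exp_norm_moments a1.
have fE : f = (fun x => c0 * expR (a * `|x|) + c1 * (`|x| * expR (a * `|x|)) + c2 * (x ^+ 2 * expR (a * `|x|))).
  by apply/funext => x; rewrite /f; ring.
have j0 := integrable_funZl c0 i0; have j1 := integrable_funZl c1 i1; have j2 := integrable_funZl c2 i2.
have j01 := integrable_funD j0 j1.
rewrite fE; split; first exact: integrable_funD.
rewrite (RintegralD _ j01 j2)// (RintegralD _ j0 j1)//.
rewrite (RintegralZl _ _ i0)// (RintegralZl _ _ i1)// (RintegralZl _ _ i2)//.
by rewrite e0 e1 e2; field; rewrite subr_eq0 gt_eqF.
Qed.

(** This is [a * g_ru r 0 x + b * g_ru r 1 x] at [x = expR y]; the argument [y] will be the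
    logarithm of a ratio of order statistics. *)
Definition exp_affine {R : realType} (r a b y : R) : R := expR (r * y) * (a + b * y).

Lemma measurable_exp_affine {R : realType} {d} {T : measurableType d} (r a b : R) (f : T -> R) :
  measurable_fun setT f -> measurable_fun setT (fun t => exp_affine r a b (f t)).
Proof.
move=> mf; apply: measurable_funM.
  by apply: measurableT_comp => //; exact: measurable_funM.
by apply: measurable_funD => //; exact: measurable_funM.
Qed.

Lemma exp_affineB {R : realType} (r a b y D : R) :
  exp_affine r a b (y + D) - exp_affine r a b y =
  expR (r * y) * ((a + b * y) * (expR (r * D) - 1) + b * D * expR (r * D)).
Proof.
rewrite /exp_affine (_ : expR (r * (y + D)) = expR (r * y) * expR (r * D)); first by ring.
by rewrite -expRD -mulrDr.
Qed.

(** The quadratic form of the limiting covariance matrix, that is, the variance of [a W1 + b W2].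
    Likewise [limit_bias] is [a nu1 + b nu2], and [limit_mean] is [a xi(r,0) + b xi(r,1)]. *)
Definition limit_variance {R : realType} (g r a b : R) : R :=
  a ^+ 2 * (g ^+ 2 * r ^+ 2 / ((1 - 2 * g * r) * (1 - g * r) ^+ 2)) +
  2 * a * b * (g ^+ 2 * r * (1 - g * r - g ^+ 2 * r ^+ 2)
               / ((1 - 2 * g * r) ^+ 2 * (1 - g * r) ^+ 3)) +
  b ^+ 2 * (g ^+ 2 * (1 - 2 * g * r + 2 * g ^+ 4 * r ^+ 4)
               / ((1 - 2 * g * r) ^+ 3 * (1 - g * r) ^+ 4)).

Definition limit_bias {R : realType} (g r rho a b : R) : R :=
  a * (r / ((1 - g * r) * (1 - g * r - rho))) +
  b * ((1 - rho - g ^+ 2 * r ^+ 2) / ((1 - g * r) ^+ 2 * (1 - g * r - rho) ^+ 2)).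

Definition limit_mean {R : realType} (g r a b : R) : R :=
  a / (1 - g * r) + b * (g / (1 - g * r) ^+ 2).

(** The log-excess [g * |z|] is the exact Pareto limit. Squaring doubles the exponent, so the
    variance is finite because [2 * g * r < 1]. *)
Lemma exp_affine_moments {R : realType} (g r a b : R) : g * r < 2^-1 ->
  let E := @std_exp R in let f := fun z : R => exp_affine r a b (g * `|z|) in
  let xi := limit_mean g r a b in
  [/\ E.-integrable setT (EFin \o f), \int[E]_z f z = xi,
      E.-integrable setT (EFin \o (fun z => (f z - xi) ^+ 2)) &
      \int[E]_z (f z - xi) ^+ 2 =
        limit_variance g r a b].
Proof.
move=> gr E f xi.
have gr1 : g * r < 1 by lra.
have gr2 : 2 * (g * r) < 1 by lra.
have fE : f = (fun z => (a + b * g * `|z| + 0 * z ^+ 2) * expR (g * r * `|z|)).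
  apply/funext => z; rewrite /f /exp_affine mulrC; congr (_ * expR _); ring.
have [i1 e1] := std_exp_quad_moment a (b * g) 0 gr1.
have [i2 e2] := std_exp_quad_moment (a ^+ 2) (2 * a * b * g) (b ^+ 2 * g ^+ 2) gr2.
rewrite -fE in i1.
have e1' : \int[E]_z f z = xi by rewrite fE e1 /xi /limit_mean; ring.
pose f2 (z : R) := (a ^+ 2 + 2 * a * b * g * `|z| + b ^+ 2 * g ^+ 2 * z ^+ 2) * expR (2 * (g * r) * `|z|).
have sE : (fun z => (f z - xi) ^+ 2) = (fun z => f2 z + - 2 * xi * f z + xi ^+ 2).
  apply/funext => z; rewrite /f2 -(real_normK (num_real z)) fE /=.
  rewrite (_ : expR (2 * _ * _) = expR (g * r * `|z|) * expR (g * r * `|z|)); first by ring.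
  by rewrite -expRD; congr expR; ring.
have i3 := integrable_funZl (- 2 * xi) i1.
have i23 := integrable_funD i2 i3.
have ic : E.-integrable setT (EFin \o (fun=> xi ^+ 2)) by exact: finite_measure_integrable_cst.
split=> //; first by rewrite sE; exact: integrable_funD.
transitivity (\int[E]_z (f2 z + - 2 * xi * f z + xi ^+ 2)).
  by apply: eq_Rintegral => z _; exact: (congr1 (fun h => h z) sE).
rewrite (RintegralD _ i23 ic)// (RintegralD _ i2 i3)// (RintegralZl _ _ i1)//.
rewrite e2 Rintegral_prob_cst e1' /xi /limit_mean /limit_variance.
have n1 : 1 - g * r != 0 by rewrite subr_eq0 gt_eqF.
have n2 : 1 - 2 * g * r != 0 by rewrite subr_eq0 gt_eqF// -mulrA.
by field; apply/andP; split.
Qed.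

(** The origin of the bias: the derivative of [exp_affine] at the Pareto log-excess, times the
    second-order limit of the perturbation of that log-excess. The integrand is a difference of two
    exponential moments, at [g * r + rho] and [g * r]. *)
Lemma exp_affine_derive_moment {R : realType} (g r a b rho : R) :
  g * r < 2^-1 -> rho < 0 ->
  \int[@std_exp R]_z (expR (r * (g * `|z|)) * (a * r + b + b * r * (g * `|z|)) *
    ((expR (rho * `|z|) - 1) / rho)) =
  limit_bias g r rho a b.
Proof.
move=> gr rho0; have gr1 : g * r < 1 by lra.
have gr2 : g * r + rho < 1 by lra.
pose c0 := (a * r + b) / rho; pose c1 := b * r * g / rho.
have [i1 e1] := std_exp_quad_moment c0 c1 0 gr2.
have [i2 e2] := std_exp_quad_moment c0 c1 0 gr1.
have rn0 : rho != 0 by rewrite lt_eqF.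
transitivity (\int[@std_exp R]_z ((c0 + c1 * `|z| + 0 * z ^+ 2) * expR ((g * r + rho) * `|z|) -
    (c0 + c1 * `|z| + 0 * z ^+ 2) * expR (g * r * `|z|))).
  apply: eq_Rintegral => z _.
  have -> : r * (g * `|z|) = g * r * `|z| by ring.
  have -> : expR ((g * r + rho) * `|z|) = expR (g * r * `|z|) * expR (rho * `|z|).
    by rewrite -expRD -mulrDl.
  by rewrite /c0 /c1; field.
rewrite (RintegralB _ i1 i2)// e1 e2 /c0 /c1 /limit_bias.
have n1 : 1 - g * r != 0 by rewrite subr_eq0 gt_eqF.
have n2 : 1 - g * r - rho != 0 by rewrite gt_eqF//; lra.
have n3 : 1 - (g * r + rho) != 0 by rewrite gt_eqF//; lra.
by field; rewrite ?n1 ?n2 ?n3 ?rn0.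
Qed.

(** The perturbation [D_ n] of the log-excess has size [B_ n], comparable to [1 / Num.sqrt (kk n)];
    hence after division by [Num.sqrt (kk n)] its effect is of order [1 / kk n], as a drift should
    be. *)
Lemma exp_affine_cos_expansion {R : realType} (g r a b rho C mu : R)
    (D_ : nat -> R -> R) (B_ kk : nat -> R) :
  0 < g -> g * r < 2^-1 -> rho < 0 ->
  (forall n, measurable_fun setT (D_ n)) ->
  (forall n, B_ n != 0) -> B_ n @[n --> \oo] --> 0 ->
  (forall n z, `|D_ n z| <= C * `|B_ n|) -> (forall n, `|r| * (C * `|B_ n|) <= 2^-1) ->
  (forall z, D_ n z / B_ n @[n --> \oo] --> (expR (rho * `|z|) - 1) / rho) ->
  (forall n, 0 < kk n) -> kk n @[n --> \oo] --> +oo ->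
  Num.sqrt (kk n) * B_ n @[n --> \oo] --> mu ->
  let xi := limit_mean g r a b in
  let v := limit_variance g r a b in
  let m := mu * limit_bias g r rho a b in
  exists2 e : nat -> R, e n @[n --> \oo] --> 0 &
    forall n c, `|kk n * (\int[@std_exp R]_z
         cos (c + (exp_affine r a b (g * `|z| + D_ n z) - xi) / Num.sqrt (kk n)) - cos c)
       + v / 2 * cos c + m * sin c| <= e n.
Proof.
move=> g0 gr rho0 mD B0 Bcv DB rB Dcv kk0 kkoo kap xi v m.
pose y (z : R) := g * `|z|.
have y0 z : 0 <= y z by rewrite mulr_ge0// ltW.
have my : measurable_fun setT y by apply: measurable_funM => //; exact: normr_measurable.
pose psi (z : R) := exp_affine r a b (y z) - xi.
pose h_ n (z : R) := (exp_affine r a b (y z + D_ n z) - exp_affine r a b (y z)) / B_ n.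
pose h (z : R) := expR (r * y z) * (a * r + b + b * r * y z) * ((expR (rho * `|z|) - 1) / rho).
(* Envelope for the difference quotients, from [|expR x - 1| <= 2 |x|] and [expR x <= 2] at
   [x = r * D_ n z], which the hypotheses keep within 1/2. *)
pose w (z : R) := expR (r * y z) * (2 * C * (`|a * r| + `|b| + `|b * r| * y z)).
have [i1 e1 i2 e2] := exp_affine_moments a b gr.
have me (c : R) : measurable_fun setT (fun z : R => expR (c * `|z|)).
  by apply: measurableT_comp => //; apply: measurable_funM => //; exact: normr_measurable.
have mey : measurable_fun setT (fun z : R => expR (r * y z)).
  by apply: measurableT_comp => //; exact: measurable_funM.
have mpsi : measurable_fun setT psi by apply: measurable_funB => //; exact: measurable_exp_affine.
have ipsi : (@std_exp R).-integrable setT (EFin \o psi).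
  by apply: integrable_funB => //; exact: finite_measure_integrable_cst.
have psi0 : \int[@std_exp R]_z psi z = 0.
  rewrite RintegralB//; last exact: finite_measure_integrable_cst.
  by rewrite e1 Rintegral_prob_cst subrr.
have C0 : 0 <= C.
  have := le_trans (normr_ge0 _) (DB 0%N 0).
  by rewrite pmulr_lge0// normr_gt0.
have mw : measurable_fun setT w.
  apply: measurable_funM => //; apply: measurable_funM => //.
  by apply: measurable_funD => //; exact: measurable_funM.
have mh : measurable_fun setT h.
  apply: measurable_funM.
    by apply: measurable_funM => //; apply: measurable_funD => //; exact: measurable_funM.
  by apply: measurable_funM => //; exact: measurable_funB.
have mh_ n : measurable_fun setT (h_ n).
  apply: measurable_funM => //; apply: measurable_funB; apply: measurable_exp_affine => //.
  exact: measurable_funD.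
have iw : (@std_exp R).-integrable setT (EFin \o (fun z => w z ^+ 2)).
  pose A1 := `|a * r| + `|b|; pose A2 := `|b * r| * g.
  have gr2 : 2 * (g * r) < 1 by lra.
  have [+ _] := std_exp_quad_moment (4 * C ^+ 2 * A1 ^+ 2) (8 * C ^+ 2 * A1 * A2) (4 * C ^+ 2 * A2 ^+ 2) gr2.
  congr (_.-integrable _ (EFin \o _)); apply/funext => z.
  rewrite /w /A1 /A2 /y -(real_normK (num_real z)).
  have -> : r * (g * `|z|) = g * r * `|z| by ring.
  rewrite (_ : expR (2 * _ * _) = expR (g * r * `|z|) * expR (g * r * `|z|)); first by ring.
  by rewrite -expRD; congr expR; ring.
have rD n z : `|r * D_ n z| <= 2^-1.
  by rewrite normrM (le_trans _ (rB n))// ler_wpM2l.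
have hw n z : `|h_ n z| <= w z.
  have [_ [t2 t3]] := expR_taylor1 (rD n z).
  rewrite /h_ exp_affineB !normrM normfV (ger0_norm (expR_ge0 _)) /w -mulrA ler_wpM2l ?expR_ge0//.
  rewrite ler_pdivrMr ?normr_gt0//.
  apply: (le_trans (ler_normD _ _)); rewrite !normrM (ger0_norm (expR_ge0 _)).
  have ab : `|a + b * y z| <= `|a| + `|b| * y z.
    by rewrite (le_trans (ler_normD _ _))// normrM (ger0_norm (y0 z)).
  have d1 : `|expR (r * D_ n z) - 1| <= 2 * `|r| * (C * `|B_ n|).
    by rewrite (le_trans t2)// normrM mulrA ler_wpM2l ?mulr_ge0.
  apply: (@le_trans _ _ ((`|a| + `|b| * y z) * (2 * `|r| * (C * `|B_ n|)) + `|b| * (C * `|B_ n|) * 2)).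
    apply: lerD; first by apply: ler_pM.
    by apply: ler_pM => //; rewrite ?expR_ge0// ?mulr_ge0// ler_wpM2l.
  by rewrite le_eqVlt; apply/orP; left; apply/eqP; ring.
have nB : `|B_ n| @[n --> \oo] --> (0 : R) by rewrite -(@normr0 _ R); exact: cvg_norm.
have D0 z : D_ n z @[n --> \oo] --> 0.
  apply: (@squeeze_norm_cvgr0 _ _ _ _ _ (fun n => C * `|B_ n|)); first exact: nearW.
  by rewrite -(mulr0 C); apply: cvgM; [exact: cvg_cst|exact: nB].
have hcv z : h_ n z @[n --> \oo] --> h z.
  have E1 : (expR (r * D_ n z) - 1 - r * D_ n z) / B_ n @[n --> \oo] --> 0.
    apply: (@squeeze_norm_cvgr0 _ _ _ _ _ (fun n => 2 * r ^+ 2 * C ^+ 2 * `|B_ n|)).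
      apply: nearW => n; have [t1 _] := expR_taylor1 (rD n z).
      rewrite normrM normfV ler_pdivrMr ?normr_gt0// (le_trans t1)//.
      rewrite exprMn -(real_normK (num_real (D_ n z))) [leRHS](_ : _ = 2 * (r ^+ 2 * (C * `|B_ n|) ^+ 2)); last by ring.
      by rewrite ler_wpM2l// ler_wpM2l ?sqr_ge0// ler_sqr ?nnegrE// mulr_ge0.
    by rewrite -(mulr0 (2 * r ^+ 2 * C ^+ 2)); apply: cvgM; [exact: cvg_cst|exact: nB].
  have E2 : expR (r * D_ n z) @[n --> \oo] --> (1 : R).
    rewrite -(@expR0 R) -(mulr0 r); apply: continuous_cvg; first exact: continuous_expR.
    by apply: cvgM; [exact: cvg_cst|exact: D0].
  rewrite (_ : (fun n => h_ n z) = (fun n => expR (r * y z) * ((a + b * y z) *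
     (r * (D_ n z / B_ n) + (expR (r * D_ n z) - 1 - r * D_ n z) / B_ n) + b * (D_ n z / B_ n) * expR (r * D_ n z)))); last first.
    by apply/funext => n; rewrite /h_ exp_affineB; field.
  set del := (expR (rho * `|z|) - 1) / rho.
  rewrite (_ : h z = expR (r * y z) * ((a + b * y z) * (r * del + 0) + b * del * 1)); last first.
    by rewrite /h -/del; ring.
  apply: cvgM; first exact: cvg_cst.
  apply: cvgD; apply: cvgM.
  - exact: cvg_cst.
  - by apply: cvgD => //; apply: cvgM; [exact: cvg_cst|exact: Dcv].
  - by apply: cvgM; [exact: cvg_cst|exact: Dcv].
  - exact: E2.
(* The perturbation [h_ n * B_ n / Num.sqrt (kk n)] is rewritten as [kap n * h_ n / kk n] with
   [kap n = Num.sqrt (kk n) * B_ n]. *)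
have [e ecv He] := @triangular_cos_expansion _ (measurableTypeR R) R std_exp psi w h h_ kk
  (fun n => Num.sqrt (kk n) * B_ n) mu v mpsi mw mh mh_ ipsi psi0 i2 e2 iw hw hcv kk0 kkoo kap.
have hE : mu * (\int[@std_exp R]_z h z) = m.
  by rewrite /m; congr (_ * _); exact: exp_affine_derive_moment.
exists e => // n c; have := He n c; rewrite hE.
suff -> : \int[@std_exp R]_z cos (c + (psi z / Num.sqrt (kk n) + Num.sqrt (kk n) * B_ n * h_ n z / kk n)) =
  \int[@std_exp R]_z cos (c + (exp_affine r a b (g * `|z| + D_ n z) - xi) / Num.sqrt (kk n)) by [].
set k := kk n.
have k0 : 0 < k by exact: kk0.
have s0 : Num.sqrt k != 0 by rewrite gt_eqF// sqrtr_gt0.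
have kE : Num.sqrt k ^+ 2 = k by rewrite sqr_sqrtr// ltW.
have kV : k^-1 = (Num.sqrt k)^-1 * (Num.sqrt k)^-1 by rewrite -invfM -expr2 kE.
have Bn : B_ n != 0 by exact: B0.
apply: eq_Rintegral => z _; congr (cos (_ + _)).
by rewrite /psi /h_ -/(y z) kV; field; apply/andP; split.
Qed.

(** * The quantile transform *)

Lemma cvg_expRy {R : realType} : expR x @[x --> +oo] --> (+oo : set_system R).
Proof.
apply/cvgryPge => A; near=> x.
apply: (@le_trans _ _ (1 + x)); last exact: expR_ge1Dx.
suff : A <= x by lra.
by near: x; apply: nbhs_pinfty_ge; exact: num_real.
Unshelve. all: by end_near.
Qed.

(** The last clause is right-continuity, phrased with inequalities so that it combines directly with
    the supremum defining the generalised inverse. *)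
Definition nonneg_cdf {R : realType} (F : R -> R) : Prop :=
  [/\ forall x, 0 <= F x <= 1, {homo F : x y / x <= y}, forall x, x < 0 -> F x = 0,
      forall p, p < 1 -> exists x, p < F x &
      forall p x, (forall y, x < y -> p < F y) -> p <= F x].

Lemma nonneg_cdf_rv {R : realType} {d} {T : measurableType d} (P : probability T R)
    (X : T -> R) (F : R -> R) :
  measurable_fun setT X -> (forall x : R, P [set w | X w <= x] = (F x)%:E) ->
  (forall w, 0 <= X w) -> nonneg_cdf F.
Proof.
move=> mX FE X0.
have mXle x : measurable [set w | X w <= x].
  rewrite (_ : [set _ | _] = X @^-1` `]-oo, x]); last first.
    by apply/seteqP; split => w /=; rewrite in_itv.
  by rewrite -[X in measurable X]setTI; exact: mX.
pose Xm : {RV P >-> R} := mfun_Sub (mem_set mX).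
have cdfE : cdf Xm = (fun x => (F x)%:E).
  apply/funext => x.
  by rewrite /cdf -FE; congr (P _); apply/seteqP; split => w /=; rewrite in_itv.
split.
- by move=> x; rewrite -!lee_fin -FE measure_ge0 probability_le1.
- by move=> x y xy; rewrite -lee_fin -!FE le_measure ?inE// => w /= /le_trans; apply.
- move=> x x0; apply: EFin_inj; rewrite -FE (_ : [set _ | _] = set0) ?measure0//.
  by rewrite -subset0 => w /= Xx; have := le_trans (X0 w) Xx; rewrite leNgt x0.
- move=> p p1; have := cvg_cdfy1 Xm; rewrite cdfE.
  move=> /fine_cvgP[_ /cvgrPdist_lt/(_ (1 - p))]; rewrite subr_gt0 => /(_ p1) [M [_ HM]].
  exists (M + 1); have := HM (M + 1); rewrite ltrDl => /(_ ltr01) /=.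
  by move=> /(le_lt_trans (ler_norm _)); lra.
- move=> p x H; have := @cdf_right_continuous _ _ _ P Xm x; rewrite cdfE.
  move=> /fine_cvgP[_ Fcv]; apply: (cvgr_to_ge Fcv); near=> y => /=.
  by apply: ltW; apply: H; near: y; exact: nbhs_right_gt.
Unshelve. all: by end_near.
Qed.

Definition log_quantile {R : realType} (F : R -> R) (z : R) : R := tail_quantile F (expR z).

(** The inverse is a supremum over [F x <= p], so [u z <= x] sits between [p < F x] and [p <= F x]
    with [p = 1 - expR (- z)]. The last two clauses record both sides of this gap, which is a null
    event for an atomless law. *)
Lemma log_quantile_props {R : realType} (F : R -> R) : nonneg_cdf F ->
  let u := log_quantile F in
  [/\ forall z, 0 <= u z, {homo u : x y / x <= y}, forall z, z < 0 -> u z = 0,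
      forall z x, 0 <= z -> 1 - expR (- z) < F x -> u z <= x &
      forall z x, 0 <= z -> u z <= x -> 1 - expR (- z) <= F x].
Proof.
move=> [F01 Fh Fn Fp Fr] u.
pose p (z : R) := 1 - expR (- z).
have uE z : u z = sup [set x | F x <= p z].
  by rewrite /u /log_quantile /tail_quantile /geninv -expRN.
have p1 z : p z < 1 by rewrite /p; have := expR_gt0 (- z); lra.
have ub z x : p z < F x -> ubound [set y | F y <= p z] x.
  move=> pF y /= Fy; rewrite leNgt; apply/negP => /ltW/Fh; lra.
(* For [z < 0] the level is negative, the set is empty and [sup] takes its default value 0. *)
have un z : z < 0 -> u z = 0.
  move=> z0; rewrite uE (_ : [set _ | _] = set0) ?sup0//.
  rewrite -subset0 => x /=; have /andP[+ _] := F01 x.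
  have : 1 < expR (- z) by rewrite expR_gt1; lra.
  rewrite /p; lra.
have p0 z : 0 <= z -> 0 <= p z by move=> z0; rewrite subr_ge0 -expR0 ler_expR oppr_le0.
have hub z : has_ubound [set y | F y <= p z].
  by have [x px] := Fp _ (p1 z); exists x; exact: ub.
have negS z x : 0 <= z -> x < 0 -> F x <= p z by move=> z0 x0; rewrite Fn// p0.
(* All negative numbers belong to the set since [F] vanishes there, so the supremum exceeds every
   [- e]. *)
have u0 z : 0 <= z -> 0 <= u z.
  move=> z0; apply/ler_addgt0Pr => e e0; rewrite -lerBlDr sub0r uE.
  by apply: ub_le_sup => //=; apply: negS => //; rewrite oppr_lt0.
have ne z : 0 <= z -> [set y | F y <= p z] !=set0.
  by move=> z0; exists (-1); apply: negS => //; rewrite oppr_lt0.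
split => //.
- by move=> z; have [/un ->|/u0] := ltP z 0.
- move=> z z' zz'; have [z0|z0] := ltP z 0.
    by rewrite un//; have [/un ->|/u0] := ltP z' 0.
  rewrite !uE; apply: ge_sup; first exact: ne.
  move=> x /= Fx; apply: ub_le_sup; first exact: hub.
  by rewrite /= (le_trans Fx)// /p lerD2l lerN2 ler_expR lerN2.
- by move=> z x z0 pF; rewrite uE; apply: ge_sup; [exact: ne|exact: ub].
- move=> z x z0 ux; apply: Fr => y xy; rewrite ltNge; apply/negP => Fy.
  have : y <= u z by rewrite uE; apply: ub_le_sup.
  by move=> /le_trans/(_ ux)/(lt_le_trans xy); rewrite ltxx.
Qed.

Lemma measurable_log_quantile {R : realType} (F : R -> R) : nonneg_cdf F ->
  measurable_fun setT (log_quantile F).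
Proof.
by move=> /log_quantile_props[_ h _ _ _]; exact: nondecreasing_measurable.
Qed.

(* Quantile transform: [1 - exp (- Z)] is uniform when [Z] is exponential. *)
Lemma std_exp_log_quantile {R : realType} {d} {T : measurableType d} (P : probability T R)
    (X : T -> R) (F : R -> R) :
  measurable_fun setT X -> (forall x : R, P [set w | X w <= x] = (F x)%:E) ->
  (forall w, 0 <= X w) ->
  forall B : set R, measurable B -> P (X @^-1` B) = @std_exp R (log_quantile F @^-1` B).
Proof.
move=> mX FE X0; have cF := nonneg_cdf_rv mX FE X0.
have [u0 uh un uge ule] := log_quantile_props cF.
have mu := measurable_log_quantile cF; have mu' := mu.
have [F01 _ Fn _ _] := cF.
pose u := log_quantile F.
pose Xm : {mfun T >-> measurableTypeR R} := @mfun_Sub _ _ T (measurableTypeR R) _ (mem_set mX).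
pose um : {mfun measurableTypeR R >-> measurableTypeR R} :=
  @mfun_Sub _ _ (measurableTypeR R) (measurableTypeR R) _ (mem_set mu).
apply: (@eq_measure_cdf _ (distribution P Xm) (distribution (@std_exp R) um)) => x.
rewrite /distribution /pushforward /=.
transitivity ((F x)%:E).
  by rewrite -FE; congr (P _); apply/seteqP; split => w /=; rewrite in_itv.
rewrite (_ : _ @^-1` _ = [set z | u z <= x]); last first.
  by apply/seteqP; split => w /=; rewrite in_itv.
have mS : measurable ([set z | u z <= x] : set (measurableTypeR R)).
  rewrite (_ : [set _ | _] = u @^-1` `]-oo, x]); last first.
    by apply/seteqP; split => w /=; rewrite in_itv.
  by rewrite -[X in measurable X]setTI; exact: mu'.
have [x0|x0] := ltP x 0.
  rewrite Fn// (_ : [set _ | _] = set0) ?measure0//.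
  by rewrite -subset0 => z /=; have := u0 z; rewrite /u; lra.
have itv1 (y : R) : 0 <= y -> @std_exp R `]-oo, y[%classic = (1 - expR (- y))%:E.
  by move=> y0; rewrite -(std_exp_itv0c y0) -(@setUitv1 _ _ _ y true)// measureU0//; exact: std_exp_set1.
have /andP[F0 F1] := F01 x.
(* When [F x = 1] the threshold [- ln (1 - F x)] below would be infinite. *)
have [Flt|Fge] := ltP (F x) 1; last first.
  have FE1 : F x = 1 by apply/eqP; rewrite eq_le F1 Fge.
  rewrite FE1 (_ : [set _ | _] = setT) ?probability_setT// -subTset => z _ /=.
  have [z0|z0] := ltP z 0; first by rewrite /u un.
  by apply: uge => //; rewrite FE1; have := expR_gt0 (- z); lra.
pose y := - ln (1 - F x).
have F1p : 0 < 1 - F x by lra.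
have y0 : 0 <= y.
  by rewrite oppr_ge0 -(@ln1 R) ler_ln ?posrE//; lra.
have yE : 1 - expR (- y) = F x by rewrite /y opprK lnK ?posrE//; lra.
(* The event [u z <= x] contains the open ray below [y] and lies in the closed one; both have
   exponential measure [F x]. *)
apply/eqP; rewrite eq_le; apply/andP; split.
  rewrite -yE -itv1//; apply: le_measure; rewrite ?inE//.
  move=> z /=; rewrite in_itv /= => zy.
  have [z0|z0] := ltP z 0; first by rewrite /u un.
  by apply: uge => //; rewrite -yE ltrD2l ltrN2 ltr_expR ltrN2.
rewrite -yE -std_exp_itv0c//; apply: le_measure; rewrite ?inE//.
move=> z /= uz; rewrite in_itv /=.
have [z0|z0] := ltP z 0; first by lra.
by have := ule z x z0 uz; rewrite -yE lerD2l lerN2 ler_expR lerN2.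
Qed.

Lemma second_order_log {R : realType} (F A : R -> R) (gamma rho : R) :
  nonneg_cdf F -> rho < 0 ->
  ((\forall t \near +oo, 0 < A t) \/ (\forall t \near +oo, A t < 0)) ->
  A t @[t --> +oo] --> 0 ->
  (forall x : R, 0 < x ->
     ((tail_quantile F (t * x) / tail_quantile F t - x `^ gamma) / A t)
       @[t --> +oo] --> x `^ gamma * (x `^ rho - 1) / rho) ->
  let u := log_quantile F in
  let H := fun s => ln (u s) - gamma * s in
  (\forall s \near +oo, 0 < u s) /\
  (forall z, (H (s + z) - H s) / A (expR s) @[s --> +oo] --> (expR (rho * z) - 1) / rho).
Proof.
move=> cF rho0 Asgn A0 H2 u H.
have [u0 uh _ _ _] := log_quantile_props cF.
have An0 : \forall t \near +oo, A t != 0.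
  by case: Asgn; apply: filterS => t; [move=> ?; rewrite gt_eqF|move=> ?; rewrite lt_eqF].
have S2 z : (u (s + z) / u s - expR (gamma * z)) / A (expR s) @[s --> +oo] -->
    expR (gamma * z) * (expR (rho * z) - 1) / rho.
  have := H2 (expR z) (expR_gt0 z).
  rewrite /powR gt_eqF ?expR_gt0// expRK => h.
  have := cvg_comp _ _ cvg_expRy h.
  apply: cvg_trans; apply: near_eq_cvg; apply: nearW => s /=.
  by rewrite /u /log_quantile expRD.
have upos : \forall s \near +oo, 0 < u s.
  have [[s1 us1]|no] := pselect (exists s, 0 < u s).
    by near=> s; apply: (lt_le_trans us1); apply: uh; near: s; apply: nbhs_pinfty_ge; exact: num_real.
  (* If [u] vanished identically, the ratio would be [0 / 0 = 0]; at [z = 0] the condition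
     multiplied by [A] would then make the constant -1 tend to 0. *)
  exfalso; have uz s : u s = 0.
    by apply/eqP; rewrite eq_le u0 andbT leNgt; apply/negP => us; apply: no; exists s.
  have An0' : \forall s \near +oo, A (expR s) != 0 by exact: (cvg_expRy An0).
  have A0' : A (expR s) @[s --> +oo] --> 0 by exact: (cvg_comp _ _ cvg_expRy A0).
  have C1 : (u (s + 0) / u s - expR (gamma * 0)) / A (expR s) * A (expR s) @[s --> +oo] -->
      expR (gamma * 0) * (expR (rho * 0) - 1) / rho * 0 by apply: cvgM; [exact: S2|exact: A0'].
  rewrite [X in _ --> X]mulr0 in C1.
  have : (fun _ : R => -1 : R) s @[s --> +oo] --> (0 : R).
    apply: cvg_trans C1; apply: near_eq_cvg; near=> s.
    have As : A (expR s) != 0 by near: s.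
    by rewrite /= !uz mulr0 expR0 mul0r sub0r divfK.
  move=> /(cvg_unique (@Rhausdorff R) (cvg_cst (-1 : R))) /eqP.
  by rewrite oppr_eq0 oner_eq0.
split=> // z.
(* Chosen so that [1 + A t * q t] is the ratio of quantiles divided by its limit
   [expR (gamma * z)]. *)
pose q t := (u (ln t + z) / u (ln t) - expR (gamma * z)) / A t / expR (gamma * z).
pose kap := (expR (rho * z) - 1) / rho.
have lncv : ln s @[s --> +oo] --> (+oo : set_system R).
  apply/cvgryPge => M; near=> s.
  have s0 : 0 < s by near: s; apply: nbhs_pinfty_gt; exact: num_real.
  rewrite -ler_expR lnK ?posrE//; near: s; apply: nbhs_pinfty_ge; exact: num_real.
have qcv : q t @[t --> +oo] --> kap.
  have en0 : expR (gamma * z) != 0 by rewrite gt_eqF ?expR_gt0.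
  rewrite (_ : kap = expR (gamma * z) * (expR (rho * z) - 1) / rho / expR (gamma * z)); last first.
    have rn0 : rho != 0 by rewrite lt_eqF.
    by rewrite /kap; field; apply/andP; split.
  apply: cvgM; last exact: cvg_cst.
  apply: cvg_trans (cvg_comp _ _ lncv (S2 z)); apply: near_eq_cvg; near=> t.
  have t0 : 0 < t by near: t; apply: nbhs_pinfty_gt; exact: num_real.
  by rewrite /= lnK.
have uszn : \forall s \near +oo, 0 < u (s + z).
  have [M [_ HM]] := upos; near=> s; apply: HM; rewrite /= -ltrBlDr.
  near: s; apply: nbhs_pinfty_gt; exact: num_real.
have L := ln_div_cvg An0 A0 qcv.
apply: cvg_trans (cvg_comp _ _ cvg_expRy L); apply: near_eq_cvg; near=> s => /=.
have us : 0 < u s by near: s.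
have usz : 0 < u (s + z) by near: s.
have As : A (expR s) != 0 by near: s; exact: (cvg_expRy An0).
congr (_ / _); rewrite /q expRK.
have e0 := expR_gt0 (gamma * z).
have -> : 1 + A (expR s) * ((u (s + z) / u s - expR (gamma * z)) / A (expR s) / expR (gamma * z)) =
   u (s + z) / u s * expR (- (gamma * z)).
  by rewrite expRN; field; rewrite As !gt_eqF.
rewrite lnM ?posrE ?divr_gt0 ?expR_gt0// ln_div ?posrE// expRK /H; ring.
Unshelve. all: by end_near.
Qed.

(** Uniformity in [s] and [c] by contradiction: a sequence of bad triples [(n_j, s_j, c_j)] with
    [s_j - tau (n_j)] tending to 0 is an instance of the sequential expansion, whose error is
    bounded independently of the phase. *)
Lemma uniform_cos_expansion {R : realType} (H B : R -> R) (g r a b rho mu : R)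
    (kk tau : nat -> R) :
  0 < g -> g * r < 2^-1 -> rho < 0 ->
  measurable_fun setT H -> measurable_fun setT B ->
  ((\forall s \near +oo, 0 < B s) \/ (\forall s \near +oo, B s < 0)) ->
  B s @[s --> +oo] --> 0 ->
  (forall z, (H (s + z) - H s) / B s @[s --> +oo] --> (expR (rho * z) - 1) / rho) ->
  kk n @[n --> \oo] --> +oo -> tau n @[n --> \oo] --> +oo ->
  Num.sqrt (kk n) * B (tau n) @[n --> \oo] --> mu ->
  let xi := limit_mean g r a b in
  let v := limit_variance g r a b in
  let m := mu * limit_bias g r rho a b in
  forall e : R, 0 < e -> exists eta : R, 0 < eta /\ exists N : nat, forall n s c,
    (N <= n)%N -> `|s - tau n| <= eta ->
    `|kk n * (\int[@std_exp R]_z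
         cos (c + (exp_affine r a b (g * `|z| + (H (s + `|z|) - H s)) - xi) / Num.sqrt (kk n)) - cos c)
       + v / 2 * cos c + m * sin c| <= e.
Proof.
move=> g0 gr rho0 mH mB Bsgn B0 H2 kkoo tauoo kap xi v m e e0.
have [[C [sC HC]] Bratio] := second_order_bound rho0 mB Bsgn B0 H2.
have Bn0 : \forall s \near +oo, B s != 0.
  by case: Bsgn; apply: filterS => t; [move=> ?; rewrite gt_eqF|move=> ?; rewrite lt_eqF].
have smallB : \forall s \near +oo, `|r| * (C * `|B s|) <= 2^-1.
  have h0 : `|r| * (C * `|B s|) @[s --> +oo] --> (0 : R).
    rewrite -(mulr0 (`|r| : R)) -(mulr0 C) -(@normr0 _ R).
    by apply: cvgM; [exact: cvg_cst|apply: cvgM; [exact: cvg_cst|exact: cvg_norm]].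
  have h2 : (0 : R) < 2^-1 by [].
  move/cvgr0Pnorm_le : h0 => /(_ _ h2); apply: filterS => s.
  exact: le_trans (ler_norm _).
have [s0 Hs0] : exists s0 : R, forall s, s0 <= s ->
    [/\ sC <= s, B s != 0 & `|r| * (C * `|B s|) <= 2^-1].
  apply: near_pinfty_ge; near=> s; split.
  - by near: s; apply: nbhs_pinfty_ge; exact: num_real.
  - by near: s.
  - by near: s.
(* The margin 1 keeps every [s_ j], at distance at most 1 from [tau (n_ j)], beyond [s0]. *)
have [N0 _ HN0] : \forall n \near \oo, s0 + 1 <= tau n /\ 0 < kk n.
  near=> n; split; first by near: n; move/cvgryPge : tauoo; apply.
  by near: n; move/cvgryPgt : kkoo; apply.
apply: contrapT => nex.
have bad j : exists p : nat * R * R, [/\ (maxn j N0 <= p.1.1)%N, `|p.1.2 - tau p.1.1| <= j.+1%:R^-1 &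
   e < `|kk p.1.1 * (\int[@std_exp R]_z
         cos (p.2 + (exp_affine r a b (g * `|z| + (H (p.1.2 + `|z|) - H p.1.2)) - xi) / Num.sqrt (kk p.1.1)) - cos p.2)
       + v / 2 * cos p.2 + m * sin p.2|].
  apply: contrapT => nobad; apply: nex; exists j.+1%:R^-1; split; first by rewrite invr_gt0.
  exists (maxn j N0) => n s c Nn sn; rewrite leNgt; apply/negP => lt.
  by apply: nobad; exists (n, s, c).
have [p Hp] := choice bad.
pose n_ j := (p j).1.1; pose s_ j := (p j).1.2.
have nj j : (j <= n_ j)%N by have [+ _ _] := Hp j; rewrite geq_max => /andP[].
have nN j : (N0 <= n_ j)%N by have [+ _ _] := Hp j; rewrite geq_max => /andP[].
have sj j : `|s_ j - tau (n_ j)| <= j.+1%:R^-1 by have [_ + _] := Hp j.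
have n_oo : n_ j @[j --> \oo] --> \oo.
  move=> /= U [N _ HU]; exists N => // j /= Nj; apply: HU => /=; exact: leq_trans (nj j).
have ss j : s0 <= s_ j.
  have [h _] := HN0 _ (nN j); have := sj j; rewrite ler_norml => /andP[+ _].
  have : j.+1%:R^-1 <= 1 :> R by rewrite invf_le1// ler1n.
  by move: h; move: (tau (n_ j)) (s_ j) (j.+1%:R^-1 : R) => x y z; lra.
have s_oo : s_ j @[j --> \oo] --> +oo.
  have tn : tau (n_ j) @[j --> \oo] --> +oo by exact: (cvg_comp _ _ n_oo tauoo).
  apply/cvgryPge => M; near=> j.
  have : M + 1 <= tau (n_ j) by near: j; move/cvgryPge : tn; apply.
  have := sj j; rewrite ler_norml => /andP[+ _].
  have : j.+1%:R^-1 <= 1 :> R by rewrite invf_le1// ler1n.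
  by move: (tau (n_ j)) (s_ j) (j.+1%:R^-1 : R) => x y z; lra.
pose D_ j (z : R) := H (s_ j + `|z|) - H (s_ j).
have mD j : measurable_fun setT (D_ j).
  apply: measurable_funB => //; apply: measurableT_comp => //.
  by apply: measurable_funD => //; exact: normr_measurable.
have B_n0 j : B (s_ j) != 0 by have [_ + _] := Hs0 _ (ss j).
have kapj : Num.sqrt (kk (n_ j)) * B (s_ j) @[j --> \oo] --> mu.
  have kn : Num.sqrt (kk (n_ j)) * B (tau (n_ j)) @[j --> \oo] --> mu by exact: (cvg_comp _ _ n_oo kap).
  (* The local uniformity of [B] is what preserves the limit [mu] when [tau (n_ j)] is replaced by
     the nearby [s_ j]. *)
  have rt : B (s_ j) / B (tau (n_ j)) @[j --> \oo] --> (1 : R).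
    apply/cvgrPdist_le => e1 e10; have [eta [s1 [eta0 Hr]]] := Bratio e1 e10.
    have tn : tau (n_ j) @[j --> \oo] --> +oo by exact: (cvg_comp _ _ n_oo tauoo).
    near=> j.
    have h1 : s1 <= tau (n_ j) by near: j; move/cvgryPge : tn; apply.
    have h2 : `|s_ j - tau (n_ j)| <= eta.
      apply: (le_trans (sj j)); rewrite invf_ple ?posrE//.
      apply: (@le_trans _ _ j%:R); last by rewrite ler_nat.
      near: j; exact: nbhs_infty_ger.
    by have := Hr _ _ h1 h2; rewrite subrKC distrC.
  rewrite -(mulr1 mu); apply: cvg_trans (cvgM kn rt); apply: near_eq_cvg; near=> j.
  have tB : B (tau (n_ j)) != 0.
    have [h _] := HN0 _ (nN j).
    have hh : s0 <= tau (n_ j) by move: h; move: (tau (n_ j)) => x; lra.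
    by have [_ + _] := Hs0 _ hh.
  by rewrite /=; field.
have := @exp_affine_cos_expansion R g r a b rho C mu D_ (B \o s_) (kk \o n_) g0 gr rho0 mD B_n0.
case.
- exact: (cvg_comp _ _ s_oo B0).
- by move=> j z; have [h _ _] := Hs0 _ (ss j); exact: HC.
- by move=> j; have [_ _ h] := Hs0 _ (ss j).
- by move=> z; exact: (cvg_comp _ _ s_oo (H2 `|z|)).
- by move=> j; have [] := HN0 _ (nN j).
- exact: (cvg_comp _ _ n_oo kkoo).
- exact: kapj.
move=> err errcv Herr.
have [j _ Hj] : \forall j \near \oo, err j < e.
  by move/cvgrPdist_lt : errcv => /(_ _ e0); apply: filterS => j; rewrite sub0r normrN; exact: le_lt_trans (ler_norm _).
have := Hj j (leqnn j); have [_ _ lt] := Hp j.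
have := Herr j (p j).2; rewrite /= -/xi -/v -/m => le1 lt2.
by have := lt_le_trans lt le1; rewrite ltNge ltW.
Unshelve. all: by end_near.
Qed.

(** * Order statistics of an exponential sample *)

Lemma measurable_id_realType {R : realType} :
  @measurable_fun _ _ (measurableTypeR R) R setT id.
Proof.
by move=> _ B mB; rewrite setTI.
Qed.

(** [std_exp] lives on [measurableTypeR R]; the pushforward by the identity gives it the type
    [probability R R], for use with [tuple_prob] and tuples over [R]. *)
Definition exp_law {R : realType} : probability R R :=
  distribution (@std_exp R)
    (@mfun_Sub _ _ (measurableTypeR R) R _ (mem_set measurable_id_realType)).

Lemma Rintegral_exp_law {R : realType} (f : R -> R) :
  measurable_fun setT f -> (@std_exp R).-integrable setT (EFin \o f) ->
  \int[@exp_law R]_x f x = \int[@std_exp R]_x f x.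
Proof.
by move=> mf fi; rewrite Rintegral_pushforward.
Qed.

Lemma measurable_fun_inv {R : realType} {d} {T : measurableType d} (f : T -> R) :
  measurable_fun setT f -> measurable_fun setT (fun t => (f t)^-1).
Proof.
move=> mf.
(* Squaring reduces inversion to a power of a nonnegative number; at 0 the outer factor restores the
   convention [0^-1 = 0]. *)
rewrite (_ : (fun t => _) = (fun t => f t * (f t ^+ 2) `^ (-1))).
  apply: measurable_funM => //; apply: (measurableT_comp (measurable_powR (-1))).
  exact: measurable_funX.
apply/funext => t; rewrite powR_inv1 ?sqr_ge0//.
have [->|ft0] := eqVneq (f t) 0; first by rewrite invr0 mul0r.
by rewrite expr2 invfM mulrA divff// mul1r.
Qed.

Lemma order_stat_sum_head {R : realType} (u phi : R -> R) (s : R) (l : seq R) (n k : nat) :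
  {homo u : x y / x <= y} -> uniq (s :: l) -> size l = n -> count_gt s l = k ->
  let x_ := sort <=%R [seq u x | x <- s :: l] in
  \sum_(0 <= i < k) phi (nth 0 x_ (n.+1 - i).-1 / nth 0 x_ (n.+1 - k).-1) =
  \sum_(x <- l | s < x) phi (u x / u s).
Proof.
move=> uh ul <- <- x_.
rewrite /x_ (order_stat_threshold uh ul).
exact: (sum_order_stat_above (fun y => phi (y / u s)) uh ul).
Qed.

Lemma count_gt_mono {R : realType} (s s' : R) (t : seq R) : s <= s' ->
  (count_gt s' t <= count_gt s t)%N.
Proof.
by move=> ss; apply: sub_count => x /=; exact: le_lt_trans.
Qed.

(* If the [k + 1]-st largest coordinate leaves the window [[lo, hi]], then the
   number of coordinates above [lo] or above [hi] is atypical. *)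
Lemma count_gt_outside {R : realType} (s lo hi : R) (l : seq R) (k : nat) :
  count_gt s (s :: l) = k -> ~~ (lo <= s <= hi) ->
  (k < count_gt hi (s :: l))%N || (count_gt lo (s :: l) <= k)%N.
Proof.
rewrite /count_gt /= ltxx add0n => ck; rewrite negb_and -!ltNge => /orP[slo|his].
  apply/orP; right; rewrite ltNge ltW// add0n -ck.
  exact: count_gt_mono (ltW slo).
apply/orP; left; rewrite his add1n ltnS -ck.
exact: count_gt_mono (ltW his).
Qed.

(** After symmetrisation the head is the threshold and the sum runs over the exceedances. For a head
    in the window the product formula applies; for the others the integrand is bounded trivially,
    and the probability of leaving the window is controlled by the counts above [lo] and [hi]. *)
Lemma tuple_order_stat_cos {R : realType} (u phi : R -> R) (n k : nat)
    (c lo hi q m delta a1 a2 : R) :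
  {homo u : x y / x <= y} -> measurable_fun setT phi -> (k < n)%N ->
  0 <= lo -> lo <= hi -> 0 <= q <= 1 -> 0 <= delta ->
  (forall s, lo <= s <= hi -> forall b,
     `|\int[@exp_law R]_x ((s < x)%R%:R * cos (b + phi (u x / u s))) -
       expR (- s) * (q * cos (b + m))| <= expR (- s) * delta) ->
  0 < a1 -> a1 <= k.+1%:R - n%:R * expR (- hi) ->
  0 < a2 -> a2 <= n%:R * expR (- lo) - k%:R ->
  `|\int[tuple_prob (@exp_law R) n]_t
      (let x_ := sort <=%R [seq u x | x <- t] in
       cos (c + \sum_(0 <= i < k) phi (nth 0 x_ (n - i).-1 / nth 0 x_ (n - k).-1)))
    - q ^+ k * cos (c + k%:R * m)| <=
  k%:R * delta + 2 * (n%:R * expR (- hi) / a1 ^+ 2 + n%:R * expR (- lo) / a2 ^+ 2).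
Proof.
move=> uh mphi; case: n => // n; rewrite ltnS => kn lo0 lohi q01 d0 Hs a10 a1le a20 a2le.
have mu : measurable_fun setT u by exact: nondecreasing_measurable.
set Q := @exp_law R.
pose fu (t : n.+1.-tuple R) := let x_ := sort <=%R [seq u x | x <- t] in
   cos (c + \sum_(0 <= i < k) phi (nth 0 x_ (n.+1 - i).-1 / nth 0 x_ (n.+1 - k).-1)).
pose ft (t : n.+1.-tuple R) := cos (c + \sum_(x <- t | thead t < x) phi (u x / u (thead t))).
pose ind (t : n.+1.-tuple R) : R := (count_gt (thead t) t == k)%:R.
have mth : measurable_fun setT (fun t : n.+1.-tuple R => thead t) by exact: measurable_tnth.
have mind : measurable_fun setT ind by exact: measurable_count_gt_eq.
have mdiv d (T : measurableType d) (x s : T -> R) : measurable_fun setT x -> measurable_fun setT s ->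
    measurable_fun setT (fun t => phi (u (x t) / u (s t))).
  move=> mx ms; apply: measurableT_comp => //; apply: measurable_funM; first exact: measurableT_comp.
  by apply: measurable_fun_inv; exact: measurableT_comp.
have mft : measurable_fun setT ft.
  apply: measurable_fun_cos; apply: measurable_funD => //.
  apply: (@measurable_sum_tuple_gt _ _ R n.+1 id (fun t => thead t)
     (fun z : n.+1.-tuple R * R => phi (u z.2 / u (thead z.1)))) => //.
  by apply: mdiv => //; exact: measurableT_comp mth measurable_fst.
have msort j : measurable_fun setT (fun t : n.+1.-tuple R => nth 0 (sort <=%R [seq u x | x <- t]) j).
  have mmap : measurable_fun setT (fun t : n.+1.-tuple R => [tuple u (tnth t i) | i < n.+1]).
    apply/measurable_fun_tnthP => i; rewrite (_ : _ \o _ = (fun t => u (tnth t i))).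
      by apply: measurableT_comp => //; exact: measurable_tnth.
    by apply/funext => t /=; rewrite tnth_mktuple.
  rewrite (_ : (fun t => _) = (fun t : n.+1.-tuple R => nth 0 (sort <=%R [tuple u (tnth t i) | i < n.+1]) j)).
    have ms := @measurable_sorted_nth R n.+1 j.
    by have := measurableT_comp ms mmap.
  apply/funext => t; congr (nth 0 (sort _ _) j).
  by rewrite -[in LHS](map_tnth_enum t) -map_comp.
have mfu : measurable_fun setT fu.
  apply: measurable_fun_cos; apply: measurable_funD => //; apply: measurable_sum => i.
  by apply: measurableT_comp => //; apply: measurable_funM => //; exact: measurable_fun_inv.
have Q1 (x : R) : Q [set x] = 0%E by exact: std_exp_set1.
have Qgt (s : R) : 0 <= s -> expR (- s) = \int[Q]_x (s < x)%R%:R.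
  have ms : measurable_fun setT (fun x : R => (s < x)%R%:R : R).
    by apply: measurable_natr_bool; exact: measurable_fun_ltr.
  move=> s0; rewrite Rintegral_exp_law//; first by rewrite std_exp_gt.
  by apply: (@bounded_integrable _ _ _ _ _ 1) => // x; exact: natr_bool_le1.
have cb (x : R) : `|cos x| <= 1 by exact: normr_cos_le1.
have ib t : `|ind t| <= 1 by exact: natr_bool_le1.
have [q0 q1] := andP q01.
have qb (x : R) : `|q ^+ k * cos x| <= 1.
  by rewrite normrM mulr_ile1// ger0_norm ?exprn_ge0// exprn_ile1.
pose L := q ^+ k * cos (c + k%:R * m).
have head (f : n.+1.-tuple R -> R) (M : R) : measurable_fun setT f -> (forall t, `|f t| <= M) ->
    (forall t t' : n.+1.-tuple R, perm_eq t t' -> f t = f t') ->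
    \int[tuple_prob Q n.+1]_t f t = n.+1%:R * \int[tuple_prob Q n.+1]_t (f t * ind t).
  by move=> mf fM fs; exact: (Rintegral_symmetric_head Q1 kn mf fM fs).
have permE (t t' : n.+1.-tuple R) (p : pred R) : perm_eq t t' -> count p t = count p t'.
  by move=> /permP ->.
have fuE : \int[tuple_prob Q n.+1]_t fu t = n.+1%:R * \int[tuple_prob Q n.+1]_t (ft t * ind t).
  have fub t : `|fu t| <= 1 by exact: cb.
  rewrite (head fu 1 mfu fub); last first.
    move=> t t' tt'; rewrite /fu (_ : sort _ _ = sort <=%R [seq u x | x <- t'])//.
    apply/perm_sort_leP; first exact: perm_map.
  congr (_ * _); apply: eq_Rintegral_ae; [exact: measurable_funM|exact: measurable_funM|].
  apply: filterS (tuple_prob_uniq n.+1 Q1) => t.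
  case/tupleP: t => s l ut; rewrite /ind /fu /ft theadE /=.
  have [ck|_] := eqVneq (count_gt s (s :: l)) k; last by rewrite !mulr0.
  have ck' : count_gt s l = k by rewrite -ck /count_gt /= ltxx add0n.
  rewrite !mulr1 big_cons ltxx.
  by congr (cos (c + _)); exact: (order_stat_sum_head phi uh ut (size_tuple l) ck').
(* Symmetrising the constant 1 shows that the weights [n.+1%:R * ind] have total mass 1, so the main
   term contributes exactly [L]. *)
have one : 1 = n.+1%:R * \int[tuple_prob Q n.+1]_t ind t.
  have n1 (t : n.+1.-tuple R) : `|1 : R| <= 1 by rewrite normr1.
  have m1 : measurable_fun setT (fun _ : n.+1.-tuple R => 1 : R) by exact: measurable_cst.
  have h := head (fun=> 1) 1 m1 n1 (fun _ _ _ => erefl).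
  rewrite Rintegral_prob_cst in h; apply: (etrans h).
  by congr (_ * _); apply: eq_Rintegral => t _; rewrite mul1r.
pose win (s : R) := lo <= s <= hi.
have mwin : measurable_fun setT win.
  by apply: measurable_and; exact: measurable_fun_ler.
pose dif (t : n.+1.-tuple R) := (ft t - L) * ind t.
have mdif : measurable_fun setT dif.
  by apply: measurable_funM => //; exact: measurable_funB.
have L1 : `|L| <= 1 by exact: qb.
have difb t : `|dif t| <= 2.
  rewrite normrM -[leRHS]mulr1 ler_pM// (le_trans (ler_normB _ _))//.
  by rewrite (_ : 2 = 1 + 1 :> R)// lerD// cb.
have iind : (tuple_prob Q n.+1).-integrable setT (EFin \o ind).
  by apply: (@bounded_integrable _ _ _ _ _ 1).
have iftind : (tuple_prob Q n.+1).-integrable setT (EFin \o (fun t => ft t * ind t)).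
  apply: (@bounded_integrable _ _ _ _ _ 1); first exact: measurable_funM.
  by move=> t; rewrite normrM mulr_ile1// cb.
have E1 : \int[tuple_prob Q n.+1]_t fu t - L = n.+1%:R * \int[tuple_prob Q n.+1]_t dif t.
  rewrite fuE (_ : \int[_]_t dif t = \int[tuple_prob Q n.+1]_t (ft t * ind t) - L * \int[tuple_prob Q n.+1]_t ind t).
    by rewrite mulrBr mulrCA -one mulr1.
  rewrite -(RintegralZl _ _ iind)// -(RintegralB _ iftind (integrable_funZl L iind))//.
  by apply: eq_Rintegral => t _; rewrite /dif mulrBl.
rewrite -/L -/fu; rewrite [X in `|X|]E1.
pose J s := \int[tuple_prob Q n]_l dif (tcons (s, l)).
pose I s := \int[tuple_prob Q n]_l ind (tcons (s, l)).
have mtc (f : n.+1.-tuple R -> R) (s : R) : measurable_fun setT f ->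
    measurable_fun setT (fun l : n.-tuple R => f (tcons (s, l))).
  move=> mf; have mz : measurable_fun setT (fun l : n.-tuple R => (s, l)) by apply/measurable_fun_pairP; split; [exact: measurable_cst|exact: measurable_id].
  have h1 := measurableT_comp (@measurable_tcons _ R n) mz.
  exact: (measurableT_comp mf h1).
have indE s l : ind (tcons (s, l)) = (count_gt s l == k)%:R.
  by rewrite /ind theadE /count_gt /= ltxx add0n.
have ftE s l : ft (tcons (s, l)) = cos (c + \sum_(x <- l | s < x) phi (u x / u s)).
  by rewrite /ft theadE /= big_cons ltxx.
have IE s : I s = \int[tuple_prob Q n]_l (count_gt s l == k)%:R.
  by apply: eq_Rintegral => l _; rewrite indE.
have JE s : J s = \int[tuple_prob Q n]_l ((count_gt s l == k)%:R * cos (c + \sum_(x <- l | s < x) phi (u x / u s))) -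
    L * I s.
  have i1 : (tuple_prob Q n).-integrable setT (EFin \o (fun l => ind (tcons (s, l)))).
    by apply: (@bounded_integrable _ _ _ _ _ 1) => //; exact: mtc.
  have i2 : (tuple_prob Q n).-integrable setT (EFin \o (fun l => ft (tcons (s, l)) * ind (tcons (s, l)))).
    apply: (@bounded_integrable _ _ _ _ _ 1) => [|l]; last by rewrite normrM mulr_ile1// cb.
    by apply: measurable_funM; exact: mtc.
  transitivity (\int[tuple_prob Q n]_l (ft (tcons (s, l)) * ind (tcons (s, l))) - L * I s); last first.
    by congr (_ - _); apply: eq_Rintegral => l _; rewrite ftE indE mulrC.
  rewrite -(RintegralZl _ _ i1)// -(RintegralB _ i2 (integrable_funZl L i1))//.
  by apply: eq_Rintegral => l _; rewrite /dif mulrBl.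
have I0 s : 0 <= I s by apply: Rintegral_ge0 => t _; rewrite /ind ler0n.
have Jgood s : win s -> `|J s| <= k%:R * delta * I s.
  move=> ws; rewrite JE IE; have := Hs s ws => Hb.
  have s0 : 0 <= s by case/andP: ws => ls _; exact: le_trans ls.
  have mth1 : measurable_fun setT (fun x => phi (u x / u s)) by exact: mdiv.
  have := Rintegral_count_gt_cos mth1 (Qgt s s0) q01 d0 Hb n k c.
  by rewrite /L mulrC.
(* Outside the window only [|ft - L| <= 2] is used. *)
have Jbad s : `|J s| <= 2 * I s.
  rewrite /J /I -RintegralZl//; last by apply: (@bounded_integrable _ _ _ _ _ 1) => //; exact: mtc.
  have i2 : (tuple_prob Q n).-integrable setT (EFin \o (fun l => 2 * ind (tcons (s, l)))).
    by apply: integrable_funZl; apply: (@bounded_integrable _ _ _ _ _ 1) => //; exact: mtc.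
  have i1 : (tuple_prob Q n).-integrable setT (EFin \o (fun l => dif (tcons (s, l)))).
    by apply: (@bounded_integrable _ _ _ _ _ 2) => //; exact: mtc.
  have := @Rintegral_dist_le _ _ _ (tuple_prob Q n) (fun l => dif (tcons (s, l))) (fun=> 0) (fun l => 2 * ind (tcons (s, l))).
  rewrite Rintegral_prob_cst subr0; apply => //; first exact: finite_measure_integrable_cst.
  move=> l; rewrite subr0 /dif normrM (ger0_norm (ler0n _ _)) ler_wpM2r ?ler0n//.
  by rewrite (le_trans (ler_normB _ _))// (_ : 2 = 1 + 1 :> R)// lerD// cb.
have Jall s : `|J s| <= k%:R * delta * I s + 2 * ((~~ win s)%:R * I s).
  have [ws|nw] := boolP (win s); first by rewrite mul0r mulr0 addr0 Jgood.
  rewrite mul1r (le_trans (Jbad s))// lerDr mulr_ge0// mulr_ge0//.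
pose bad (t : n.+1.-tuple R) : R := (k < count_gt hi t)%N%:R + (count_gt lo t <= k)%N%:R.
have mhi (x : R) : measurable_fun setT (fun t : n.+1.-tuple R => (count_gt x t)%:R : R).
  by apply: measurable_count_gt.
have mbh : measurable_fun setT (fun t : n.+1.-tuple R => (k < count_gt hi t)%N).
  rewrite (_ : (fun t => _) = (fun t : n.+1.-tuple R => (k%:R : R) < (count_gt hi t)%:R)).
    exact: measurable_fun_ltr.
  by apply/funext => t; rewrite ltr_nat.
have mbl : measurable_fun setT (fun t : n.+1.-tuple R => (count_gt lo t <= k)%N).
  rewrite (_ : (fun t => _) = (fun t : n.+1.-tuple R => ((count_gt lo t)%:R : R) <= k%:R)).
    exact: measurable_fun_ler.
  by apply/funext => t; rewrite ler_nat.
have mbad : measurable_fun setT bad by apply: measurable_funD; exact: measurable_natr_bool.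
have badb t : `|bad t| <= 2.
  by rewrite (le_trans (ler_normD _ _))// (_ : 2 = 1 + 1 :> R)// lerD// natr_bool_le1.
have hi0 : 0 <= hi by exact: le_trans lohi.
(* More than [k] exceedances means at least [k.+1], hence the successor in the lower bound for the
   deviation [a1]. *)
have chi : \int[tuple_prob Q n.+1]_t (k < count_gt hi t)%N%:R <= n.+1%:R * expR (- hi) / a1 ^+ 2.
  apply: (chebyshev_count_gt (s := hi)) => //; first exact: Qgt.
  move=> t kt; apply: le_trans (ler_norm _); apply: (le_trans a1le).
  by rewrite lerD2r ler_nat.
have clo : \int[tuple_prob Q n.+1]_t (count_gt lo t <= k)%N%:R <= n.+1%:R * expR (- lo) / a2 ^+ 2.
  apply: (chebyshev_count_gt (s := lo)) => //; first exact: Qgt.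
  move=> t kt; rewrite distrC; apply: le_trans (ler_norm _); apply: (le_trans a2le).
  by rewrite lerD2l lerN2 ler_nat.
have ibh : (tuple_prob Q n.+1).-integrable setT (EFin \o (fun t : n.+1.-tuple R => (k < count_gt hi t)%N%:R : R)).
  by apply: (@bounded_integrable _ _ _ _ _ 1) => [|t]; [exact: measurable_natr_bool|exact: natr_bool_le1].
have ibl : (tuple_prob Q n.+1).-integrable setT (EFin \o (fun t : n.+1.-tuple R => (count_gt lo t <= k)%N%:R : R)).
  by apply: (@bounded_integrable _ _ _ _ _ 1) => [|t]; [exact: measurable_natr_bool|exact: natr_bool_le1].
(* [bad] is symmetric, so the symmetrisation can be read backwards: it absorbs the factor [n.+1],
   which would otherwise ruin the Chebyshev bound. *)
have badE : n.+1%:R * \int[tuple_prob Q n.+1]_t (bad t * ind t) <=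
    n.+1%:R * expR (- hi) / a1 ^+ 2 + n.+1%:R * expR (- lo) / a2 ^+ 2.
  rewrite -(head bad 2)//; last by move=> t t' tt'; rewrite /bad /count_gt !(permE _ _ _ tt').
  by rewrite (RintegralD _ ibh ibl)// lerD.
pose G (t : n.+1.-tuple R) := k%:R * delta * ind t + 2 * (bad t * ind t).
have kd0 : 0 <= k%:R * delta by rewrite mulr_ge0.
have mG : measurable_fun setT G.
  by apply: measurable_funD; apply: measurable_funM => //; exact: measurable_funM.
have Gb t : `|G t| <= k%:R * delta + 4.
  rewrite (le_trans (ler_normD _ _))// lerD//.
    by rewrite normrM (ger0_norm kd0) ler_piMr.
  rewrite !normrM (ger0_norm (ler0n _ 2)) (_ : 4 = 2 * (2 * 1) :> R); last by ring.
  by rewrite ler_wpM2l// ler_pM.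
have iib : (tuple_prob Q n.+1).-integrable setT (EFin \o (fun t => bad t * ind t)).
  apply: (@bounded_integrable _ _ _ _ _ 2) => [|t]; first exact: measurable_funM.
  by rewrite normrM -[leRHS]mulr1 ler_pM.
have mR2 (f : n.+1.-tuple R -> R) (M : R) : measurable_fun setT f -> (forall t, `|f t| <= M) ->
    measurable_fun setT (fun s => \int[tuple_prob Q n]_l f (tcons (s, l))).
  move=> mf fM; apply: (@measurable_Rintegral2 _ _ _ _ _ (tuple_prob Q n) (fun z => f (tcons z)) M) => //.
  by apply: measurableT_comp => //; exact: measurable_tcons.
have iJ : Q.-integrable setT (EFin \o J).
  apply: (@bounded_integrable _ _ _ _ _ 2); first exact: mR2 difb.
  by move=> s; apply: Rintegral_le_bound => //; apply: (@bounded_integrable _ _ _ _ _ 2) => //; exact: mtc.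
have iGl s : (tuple_prob Q n).-integrable setT (EFin \o (fun l => G (tcons (s, l)))).
  by apply: (@bounded_integrable _ _ _ _ _ (k%:R * delta + 4)) => //; exact: mtc.
have JG s : `|J s| <= \int[tuple_prob Q n]_l G (tcons (s, l)).
  apply: (le_trans (Jall s)).
  have i1 : (tuple_prob Q n).-integrable setT (EFin \o (fun l => ind (tcons (s, l)))).
    by apply: (@bounded_integrable _ _ _ _ _ 1) => //; exact: mtc.
  have -> : k%:R * delta * I s + 2 * ((~~ win s)%:R * I s) =
      \int[tuple_prob Q n]_l ((k%:R * delta + 2 * (~~ win s)%:R) * ind (tcons (s, l))).
    by rewrite (RintegralZl _ _ i1)// -/(I s); ring.
  apply: le_Rintegral => //; first exact: integrable_funZl.
  move=> l _; rewrite /G mulrDl lerD2l -mulrA ler_wpM2l//.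
  rewrite indE; have [ck|_] := eqVneq (count_gt s l) k; last by rewrite !mulr0.
  rewrite !mulr1 /bad; have [ws|nw] := boolP (win s); first by rewrite addr_ge0.
  have ck' : count_gt s (s :: l) = k by rewrite /count_gt /= ltxx add0n.
  have /orP[->|->] := count_gt_outside ck' nw; first by rewrite lerDl.
  by rewrite lerDr.
have iG : Q.-integrable setT (EFin \o (fun s => \int[tuple_prob Q n]_l G (tcons (s, l)))).
  apply: (@bounded_integrable _ _ _ _ _ (k%:R * delta + 4)); first exact: mR2 Gb.
  by move=> s; exact: Rintegral_le_bound.
have dom : `|\int[tuple_prob Q n.+1]_t dif t| <= \int[tuple_prob Q n.+1]_t G t.
  rewrite (Rintegral_tupleS Q mdif difb) (Rintegral_tupleS Q mG Gb).
  have := @Rintegral_dist_le _ _ _ Q J (fun=> 0) (fun s => \int[tuple_prob Q n]_l G (tcons (s, l))).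
  rewrite Rintegral_prob_cst subr0; apply => //; first exact: finite_measure_integrable_cst.
  by move=> s; rewrite subr0.
rewrite normrM (ger0_norm (ler0n _ _)).
apply: (@le_trans _ _ (n.+1%:R * \int[tuple_prob Q n.+1]_t (k%:R * delta * ind t + 2 * (bad t * ind t)))).
  by rewrite ler_wpM2l.
rewrite (RintegralD _ (integrable_funZl _ iind) (integrable_funZl _ iib))//.
rewrite (RintegralZl _ _ iind)// (RintegralZl _ _ iib)// mulrDr mulrCA -one mulr1 lerD2l.
by rewrite mulrCA ler_wpM2l.
Qed.

(** The contraction [expR (- v / (2 k))] with rotation [m / k] has the same expansion to order
    [1 / k] as one exceedance, so it can replace the Taylor polynomial as a factor. *)
Lemma cos_contraction_expansion {R : realType} (k v m c : R) :
  0 < k -> 0 <= v <= k ->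
  `|k * (expR (- (v / (2 * k))) * cos (c + m / k) - cos c) + v / 2 * cos c + m * sin c| <=
  (v ^+ 2 / 2 + 2 * m ^+ 2 + v * `|m|) / k.
Proof.
move=> k0 /andP[v0 vk]; set x := v / (2 * k); set t := m / k.
have kn0 : k != 0 by rewrite gt_eqF.
have x0 : 0 <= x by rewrite divr_ge0// mulr_ge0// ltW.
have xh : `|- x| <= 2^-1.
  by rewrite normrN ger0_norm// /x ler_pdivrMr ?mulr_gt0// mulrA mulVf// mul1r.
have [t1 _] := expR_taylor1 xh; have [t2 t3] := cos_taylor1 c t.
(* Remainder of the exponential, remainder of the rotation, and the product of the two first-order
   effects. *)
have -> : k * (expR (- x) * cos (c + t) - cos c) + v / 2 * cos c + m * sin c =
  k * (expR (- x) - 1 - (- x)) * cos (c + t) + k * (cos (c + t) - cos c + t * sin c) -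
  v / 2 * (cos (c + t) - cos c).
  rewrite /x /t; field; exact: kn0.
have b1 : `|k * (expR (- x) - 1 - - x) * cos (c + t)| <= v ^+ 2 / 2 / k.
  rewrite normrM -[leRHS]mulr1 ler_pM ?normr_cos_le1// normrM (ger0_norm (ltW k0)).
  rewrite (le_trans (ler_wpM2l (ltW k0) t1))// le_eqVlt; apply/orP; left; apply/eqP.
  by rewrite /x; field; exact: kn0.
have b2 : `|k * (cos (c + t) - cos c + t * sin c)| <= 2 * m ^+ 2 / k.
  rewrite normrM (ger0_norm (ltW k0)).
  rewrite (le_trans (ler_wpM2l (ltW k0) t2))// le_eqVlt; apply/orP; left; apply/eqP.
  by rewrite /t; field; exact: kn0.
have b3 : `|v / 2 * (cos (c + t) - cos c)| <= v * `|m| / k.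
  have v2 : 0 <= v / 2 by rewrite divr_ge0.
  rewrite normrM (ger0_norm v2) (le_trans (ler_wpM2l v2 t3))// le_eqVlt; apply/orP; left; apply/eqP.
  by rewrite /t normrM normfV (ger0_norm (ltW k0)); field; exact: kn0.
rewrite [leRHS](_ : _ = v ^+ 2 / 2 / k + 2 * m ^+ 2 / k + v * `|m| / k); last by ring.
by rewrite (le_trans (ler_normB _ _))// lerD// (le_trans (ler_normD _ _))// lerD.
Qed.

Lemma limit_variance_ge0 {R : realType} (g r a b : R) : g * r < 2^-1 ->
  0 <= limit_variance g r a b.
Proof.
move=> gr; have [_ _ _ h] := exp_affine_moments a b gr; rewrite -h.
by apply: Rintegral_ge0 => z _; exact: sqr_ge0.
Qed.

(** The one-exceedance hypothesis of the product formula: by the memoryless property the excess over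
    [s] is again exponential, and it contributes the mass [expR (- s)] of the exceedance event. *)
Lemma exp_spacing_cos {R : realType} (F A : R -> R) (gamma rho r a b mu : R)
    (kk tau : nat -> R) :
  nonneg_cdf F -> 0 < gamma -> gamma * r < 2^-1 -> rho < 0 ->
  measurable_fun setT A ->
  ((\forall t \near +oo, 0 < A t) \/ (\forall t \near +oo, A t < 0)) ->
  A t @[t --> +oo] --> 0 ->
  (forall x : R, 0 < x ->
     ((tail_quantile F (t * x) / tail_quantile F t - x `^ gamma) / A t)
       @[t --> +oo] --> x `^ gamma * (x `^ rho - 1) / rho) ->
  kk n @[n --> \oo] --> +oo -> tau n @[n --> \oo] --> +oo ->
  Num.sqrt (kk n) * A (expR (tau n)) @[n --> \oo] --> mu ->
  let u := log_quantile F in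
  let v := limit_variance gamma r a b in
  let m := mu * limit_bias gamma r rho a b in
  let phi n x := (a * g_ru r 0 x + b * g_ru r 1 x - limit_mean gamma r a b) / Num.sqrt (kk n) in
  forall e : R, 0 < e -> exists eta : R, 0 < eta /\ exists N : nat, forall n s c,
    (N <= n)%N -> `|s - tau n| <= eta ->
    `|\int[@exp_law R]_x ((s < x)%R%:R * cos (c + phi n (u x / u s))) -
      expR (- s) * (expR (- (v / (2 * kk n))) * cos (c + m / kk n))| <= expR (- s) * (e / kk n).
Proof.
move=> cF g0 gr rho0 mA Asgn A0 H2 kkoo tauoo kap u v m phi e e0.
have [_ uh _ _ _] := log_quantile_props cF.
have mu_ : measurable_fun setT u by exact: measurable_log_quantile.
pose H s := ln (u s) - gamma * s; pose B s := A (expR s).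
have [upos HB] := second_order_log cF rho0 Asgn A0 H2.
have mH : measurable_fun setT H.
  by apply: measurable_funB; [exact: measurableT_comp|exact: measurable_funM].
have mB : measurable_fun setT B by exact: measurableT_comp.
have Bsgn : (\forall s \near +oo, 0 < B s) \/ (\forall s \near +oo, B s < 0).
  by case: Asgn => h; [left|right]; exact: (cvg_expRy h).
have B0 : B s @[s --> +oo] --> 0 by exact: (cvg_comp _ _ cvg_expRy A0).
have e2 : 0 < e / 2 by rewrite divr_gt0.
have [eta [eta0 [N1 HN1]]] := @uniform_cos_expansion R H B gamma r a b rho mu kk tau
  g0 gr rho0 mH mB Bsgn B0 HB kkoo tauoo kap _ e2.
exists eta; split=> //.
have [s1 Hs1] := near_pinfty_ge upos.
have v0 : 0 <= v by exact: limit_variance_ge0.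
pose W := v ^+ 2 / 2 + 2 * m ^+ 2 + v * `|m|.
(* The window must lie in the region where [u] is positive and [s >= 0], and [k] must be large
   enough to make the error [W / k] of the contraction at most [e / 2]. *)
have [N2 _ HN2] : \forall n \near \oo, [/\ Num.max s1 0 + eta <= tau n, v <= kk n, 0 < kk n & W / (e / 2) <= kk n].
  near=> n; split; near: n; by [move/cvgryPge : tauoo; apply|move/cvgryPge : kkoo; apply|move/cvgryPgt : kkoo; apply|move/cvgryPge : kkoo; apply].
exists (maxn N1 N2) => n s c; rewrite geq_max => /andP[n1 n2] sn.
have [h1 vk k0 Wk] := HN2 _ n2; set k := kk n in vk k0 Wk *.
have [ss1 s0] : s1 <= s /\ 0 <= s.
  apply/andP; rewrite -ge_max; move: sn h1; rewrite ler_norml => /andP[+ _].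
  by move: (tau n) (Num.max s1 0) => x y; lra.
have us : 0 < u s by exact: Hs1.
pose th (z : R) := (exp_affine r a b (gamma * `|z| + (H (s + `|z|) - H s)) - limit_mean gamma r a b) / Num.sqrt k.
have mth : measurable_fun setT th.
  apply: measurable_funM => //; apply: measurable_funB => //; apply: measurable_exp_affine.
  have mn : measurable_fun setT (fun z : R => `|z|) by exact: normr_measurable.
  apply: measurable_funD; first exact: measurable_funM.
  apply: measurable_funB => //; apply: measurableT_comp => //; exact: measurable_funD.
have mf0 : measurable_fun setT (fun z => cos (c + th z)).
  by apply: measurable_fun_cos; exact: measurable_funD.
have mphi : measurable_fun setT (phi n).
  apply: measurable_funM => //; apply: measurable_funB => //.
  have mg i : measurable_fun setT (@g_ru R r i).
    apply: measurable_funM; first exact: measurable_powR.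
    by apply: measurable_funX; exact: measurable_ln.
  by apply: measurable_funD; apply: measurable_funM => //; exact: mg.
have mint : measurable_fun setT (fun x : R => (s < x)%R%:R * cos (c + phi n (u x / u s)) : R).
  apply: measurable_funM; first by apply: measurable_natr_bool; exact: measurable_fun_ltr.
  apply: measurable_fun_cos; apply: measurable_funD => //; apply: measurableT_comp => //.
  exact: measurable_funM.
have -> : \int[@exp_law R]_x ((s < x)%R%:R * cos (c + phi n (u x / u s))) =
    expR (- s) * \int[@std_exp R]_z cos (c + th z).
  rewrite Rintegral_exp_law//; last first.
    apply: (@bounded_integrable _ _ _ _ _ 1) => // x; apply: natr_bool_bound.
    exact: normr_cos_le1.
  rewrite -(Rintegral_std_exp_memoryless s0 mf0 (fun z => normr_cos_le1 _)).
  (* On the event [s < x] the excess is positive, and the linear part and the increment of [H]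
     recombine into [ln (u x / u s)]. *)
  apply: eq_Rintegral => x _; have [sx|_] := ltP s x; last by rewrite !mul0r.
  congr (_ * cos (c + _)); rewrite /th.
  have xs0 : 0 <= x - s by rewrite subr_ge0 ltW.
  rewrite (ger0_norm xs0) subrKC.
  have ux : 0 < u x by apply: (lt_le_trans us); apply: uh; exact: ltW.
  have -> : gamma * (x - s) + (H x - H s) = ln (u x / u s).
    by rewrite ln_div ?posrE// /H; ring.
  rewrite /phi /g_ru /exp_affine /powR gt_eqF ?divr_gt0// expr0 expr1 -/k; congr (_ / _); ring.
have key : `|\int[@std_exp R]_z cos (c + th z) - expR (- (v / (2 * k))) * cos (c + m / k)| <= e / k.
  have h2 := HN1 n s c n1 sn.
  rewrite -/v -/m -/k in h2.
  have vv : 0 <= v <= k by rewrite v0.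
  have h3 := cos_contraction_expansion m c k0 vv.
  have h4 : W / k <= e / 2 by rewrite ler_pdivrMr// mulrC -ler_pdivrMr.
  rewrite ler_pdivlMr// -[X in _ * X <= _](ger0_norm (ltW k0)) -normrM.
  set E := \int[@std_exp R]_z _ in h2 *.
  have -> : (E - expR (- (v / (2 * k))) * cos (c + m / k)) * k =
    (k * (E - cos c) + v / 2 * cos c + m * sin c) -
    (k * (expR (- (v / (2 * k))) * cos (c + m / k) - cos c) + v / 2 * cos c + m * sin c) by ring.
  rewrite (le_trans (ler_normB _ _))//.
  have := le_trans h3 h4; move: h2; rewrite -/E; lra.
by rewrite -mulrBr normrM (ger0_norm (expR_ge0 _)) ler_wpM2l ?expR_ge0.
Unshelve. all: by end_near.
Qed.

(** * From the sample to the exponential model, and conclusion *)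

Lemma cvg_lny {R : realType} : ln s @[s --> +oo] --> (+oo : set_system R).
Proof.
apply/cvgryPge => M; near=> s.
have s0 : 0 < s by near: s; apply: nbhs_pinfty_gt; exact: num_real.
rewrite -ler_expR lnK ?posrE//; near: s; apply: nbhs_pinfty_ge; exact: num_real.
Unshelve. all: by end_near.
Qed.

Lemma order_stat_tuple {T : Type} {R : realType} (X : nat -> T -> R) (n j : nat) (w : T) :
  order_stat X n j w = nth 0 (sort <=%R [tuple X i w | i < n]) j.-1.
Proof.
by rewrite /order_stat; congr (nth 0 (sort _ _) _); rewrite -val_enum_ord -map_comp.
Qed.

Lemma measurable_order_stat {d} {T : measurableType d} {R : realType} (X : nat -> T -> R) (n j : nat) :
  (forall i, measurable_fun setT (X i)) -> measurable_fun setT (order_stat X n j).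
Proof.
move=> mX; rewrite (_ : order_stat X n j = (fun w => nth 0 (sort <=%R [tuple X i w | i < n]) j.-1)); last first.
  by apply/funext => w; rewrite order_stat_tuple.
have mt : measurable_fun setT (fun w => [tuple X i w | i < n]).
  apply/measurable_fun_tnthP => i; rewrite (_ : _ \o _ = X i); first exact: mX.
  by apply/funext => t /=; rewrite tnth_mktuple.
have ms := @measurable_sorted_nth R n j.-1.
by have := measurableT_comp ms mt.
Qed.

Lemma measurable_g_ru {R : realType} (r : R) (u : nat) : measurable_fun setT (g_ru r u).
Proof.
apply: measurable_funM; first exact: measurable_powR.
by apply: measurable_funX; exact: measurable_ln.
Qed.

Lemma measurable_G_stat {d} {T : measurableType d} {R : realType} (X : nat -> T -> R) (n k : nat)
    (r : R) (u : nat) :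
  (forall i, measurable_fun setT (X i)) -> measurable_fun setT (G_stat X n k r u).
Proof.
move=> mX; apply: measurable_funM => //; apply: measurable_sum => i.
apply: (measurableT_comp (measurable_g_ru r u)); apply: measurable_funM.
  exact: measurable_order_stat.
by apply: measurable_fun_inv; exact: measurable_order_stat.
Qed.

Lemma Rintegral_sample_cos {R : realType} {d} {T : measurableType d} (P : probability T R)
    (X : nat -> T -> R) (F phi : R -> R) (n k : nat) (c : R) :
  (forall i, measurable_fun setT (X i)) -> mutually_independent P X ->
  (forall i (x : R), P [set w | X i w <= x] = (F x)%:E) ->
  (forall i w, 0 <= X i w) -> measurable_fun setT phi ->
  \int[P]_w cos (c + \sum_(0 <= i < k) phi (order_stat X n (n - i) w / order_stat X n (n - k) w)) =
  \int[tuple_prob (@exp_law R) n]_t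
      (let x_ := sort <=%R [seq log_quantile F x | x <- t] in
       cos (c + \sum_(0 <= i < k) phi (nth 0 x_ (n - i).-1 / nth 0 x_ (n - k).-1))).
Proof.
move=> mX iX FE X0 mphi; set u := log_quantile F.
have cF := nonneg_cdf_rv (mX 0%N) (FE 0%N) (X0 0%N).
pose f (t : n.-tuple R) := cos (c + \sum_(0 <= i < k) phi (nth 0 (sort <=%R t) (n - i).-1 / nth 0 (sort <=%R t) (n - k).-1)).
have mf : measurable_fun setT f.
  apply: measurable_fun_cos; apply: measurable_funD => //; apply: measurable_sum => i.
  apply: measurableT_comp => //; apply: measurable_funM; first exact: measurable_sorted_nth.
  by apply: measurable_fun_inv; exact: measurable_sorted_nth.
have XQ i (B : set R) : measurable B -> P (X i @^-1` B) = exp_law (u @^-1` B).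
  by move=> mB; exact: (std_exp_log_quantile (mX i) (FE i) (X0 i)).
have := Rintegral_independent_tuple iX mX (measurable_log_quantile cF) XQ mf (fun t => normr_cos_le1 _).
rewrite -/u => h; transitivity (\int[P]_w f [tuple X i w | i < n]).
  apply: eq_Rintegral => w _; rewrite /f; congr (cos (c + _)).
  by apply: eq_bigr => i _; rewrite !order_stat_tuple.
rewrite h; apply: eq_Rintegral => t _; rewrite /f /=.
suff -> : [seq u (tnth t i) | i <- enum 'I_n] = [seq u x | x <- t] by [].
by rewrite (map_comp u (tnth t)) map_tnth_enum.
Qed.

(** Because [Num.sqrt k / k = 1 / Num.sqrt k], a linear combination of the two statistics is a sum
    of [k] centred terms with the scaling of the one-exceedance estimate. *)
Lemma G_stat_linear {T : Type} {R : realType} (X : nat -> T -> R) (n k : nat) (g r a b c : R) (w : T) :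
  (0 < k)%N ->
  a * (Num.sqrt k%:R * (G_stat X n k r 0 w - xi_ru g r 0)) +
  b * (Num.sqrt k%:R * (G_stat X n k r 1 w - xi_ru g r 1)) + c =
  c + \sum_(0 <= i < k)
    (fun x => (a * g_ru r 0 x + b * g_ru r 1 x - limit_mean g r a b) / Num.sqrt k%:R)
      (order_stat X n (n - i) w / order_stat X n (n - k) w).
Proof.
move=> k0; rewrite -mulr_suml big_split /= big_split /= -!mulr_sumr sumr_const_nat subn0.
rewrite /G_stat; set S0 := \sum_(0 <= i < k) g_ru r 0 _; set S1 := \sum_(0 <= i < k) g_ru r 1 _.
have kR : 0 < k%:R :> R by rewrite ltr0n.
have s0 : Num.sqrt k%:R != 0 :> R by rewrite gt_eqF// sqrtr_gt0.
have kE : k%:R = Num.sqrt k%:R ^+ 2 :> R by rewrite sqr_sqrtr// ltW.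
rewrite /xi_ru /limit_mean fact0 expr0 expr1 -[- _ *+ k]mulr_natr.
set q := Num.sqrt k%:R in s0 kE *; rewrite kE; clearbody q.
rewrite (_ : 1`! = 1%N)// !mul1r !mulr1; set x := 1 - g * r.
rewrite expr1 -!(exprVn x); move: (x^-1) => y; field; exact: s0.
Qed.

Lemma sample_cos_cvg {R : realType} {d} {T : measurableType d} (P : probability T R)
    (X : nat -> T -> R) (F A : R -> R) (gamma rho r mu a b c : R) (k : nat -> nat) :
  0 < gamma -> rho < 0 ->
  (forall i, measurable_fun setT (X i)) -> mutually_independent P X ->
  (forall i (x : R), P [set w | X i w <= x] = (F x)%:E) ->
  (forall i w, 0 <= X i w) ->
  measurable_fun setT A ->
  ((\forall t \near +oo, 0 < A t) \/ (\forall t \near +oo, A t < 0)) ->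
  A t @[t --> +oo] --> 0 ->
  (forall x : R, 0 < x ->
     ((tail_quantile F (t * x) / tail_quantile F t - x `^ gamma) / A t)
       @[t --> +oo] --> x `^ gamma * (x `^ rho - 1) / rho) ->
  gamma * r < 2^-1 ->
  (\forall n \near \oo, (0 < k n)%N && (k n < n)%N) ->
  ((k n)%:R : R) @[n --> \oo] --> +oo ->
  (n%:R / (k n)%:R : R) @[n --> \oo] --> +oo ->
  (Num.sqrt (k n)%:R * A (n%:R / (k n)%:R)) @[n --> \oo] --> mu ->
  \int[P]_w cos (a * (Num.sqrt (k n)%:R * (G_stat X n (k n) r 0 w - xi_ru gamma r 0)) +
     b * (Num.sqrt (k n)%:R * (G_stat X n (k n) r 1 w - xi_ru gamma r 1)) + c) @[n --> \oo] -->
  expR (- (limit_variance gamma r a b / 2)) * cos (c + mu * limit_bias gamma r rho a b).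
Proof.
move=> g0 rho0 mX iX FE X0 mA Asgn A0 H2 gr kn kkoo nkoo kap.
have cF := nonneg_cdf_rv (mX 0%N) (FE 0%N) (X0 0%N).
(* At the level [tau n] the expected number of exceedances, [n * expR (- tau n)], is exactly
   [k n]. *)
pose kk n : R := (k n)%:R; pose tau n : R := ln (n%:R / kk n).
have tauoo : tau n @[n --> \oo] --> +oo by exact: (cvg_comp _ _ nkoo cvg_lny).
have kap' : Num.sqrt (kk n) * A (expR (tau n)) @[n --> \oo] --> mu.
  apply: cvg_trans kap; apply: near_eq_cvg; near=> n.
  have /andP[k0 knn] : (0 < k n)%N && (k n < n)%N by near: n.
  rewrite /tau lnK// posrE divr_gt0// /kk ltr0n//; exact: leq_trans knn.
set v := limit_variance gamma r a b; set m := mu * limit_bias gamma r rho a b.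
have v0 : 0 <= v by exact: limit_variance_ge0.
apply/cvgrPdist_le => e e0; have e2 : 0 < e / 2 by rewrite divr_gt0.
have [eta [eta0 [N HN]]] := @exp_spacing_cos R F A gamma rho r a b mu kk tau
  cF g0 gr rho0 mA Asgn A0 H2 kkoo tauoo kap' _ e2.
have em1 : 0 < 1 - expR (- eta) by rewrite subr_gt0 expR_lt1 oppr_lt0.
have ep1 : 0 < expR eta - 1 by rewrite subr_gt0 expR_gt1.
pose D := 2 * (expR (- eta) / (1 - expR (- eta)) ^+ 2 + expR eta / (expR eta - 1) ^+ 2).
near=> n.
have /andP[k0 knn] : (0 < k n)%N && (k n < n)%N by near: n.
have Nn : (N <= n)%N by near: n; exact: nbhs_infty_ge.
have taue : eta <= tau n by near: n; move/cvgryPge : tauoo; apply.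
have Dk : D / (e / 2) <= kk n by near: n; move/cvgryPge : kkoo; apply.
have kR : 0 < kk n by rewrite ltr0n.
have nR : 0 < n%:R :> R by rewrite ltr0n (leq_trans _ knn).
have kn0 : kk n != 0 by rewrite gt_eqF.
have nn0 : n%:R != 0 :> R by rewrite gt_eqF.
pose phi x := (a * g_ru r 0 x + b * g_ru r 1 x - limit_mean gamma r a b) / Num.sqrt (kk n).
have mphi : measurable_fun setT phi.
  apply: measurable_funM => //; apply: measurable_funB => //.
  by apply: measurable_funD; apply: measurable_funM => //; exact: measurable_g_ru.
under eq_Rintegral do rewrite (G_stat_linear _ _ _ _ _ _ _ _ k0).
rewrite (Rintegral_sample_cos n (k n) c mX iX FE X0 mphi).
have ntau : n%:R * expR (- tau n) = kk n.
  by rewrite expRN /tau lnK ?posrE ?divr_gt0//; field; rewrite kn0.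
have q01 : 0 <= expR (- (v / (2 * kk n))) <= 1.
  by rewrite expR_ge0 -expR0 ler_expR oppr_le0 divr_ge0// mulr_ge0// ltW.
have lo0 : 0 <= tau n - eta by rewrite subr_ge0.
have lohi : tau n - eta <= tau n + eta by move: (tau n) => x; lra.
have dl0 : 0 <= e / 2 / kk n by rewrite divr_ge0 ?ltW.
have win s : tau n - eta <= s <= tau n + eta -> forall c, 
    `|\int[@exp_law R]_x ((s < x)%R%:R * cos (c + phi (log_quantile F x / log_quantile F s))) -
      expR (- s) * (expR (- (v / (2 * kk n))) * cos (c + m / kk n))| <= expR (- s) * (e / 2 / kk n).
  move=> ws c'; apply: HN => //; rewrite ler_norml; move: ws; move: (tau n) => x /andP[? ?].
  by apply/andP; split; lra.
(* At the ends of the window the expected counts are [kk n * expR (- eta)] and [kk n * expR eta];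
   their distances to [kk n] are of order [kk n], so Chebyshev's bound is [D / kk n]. *)
pose a1 := kk n * (1 - expR (- eta)); pose a2 := kk n * (expR eta - 1).
have a10 : 0 < a1 by rewrite mulr_gt0.
have a20 : 0 < a2 by rewrite mulr_gt0.
have hiE : n%:R * expR (- (tau n + eta)) = kk n * expR (- eta).
  by rewrite opprD expRD mulrA ntau.
have loE : n%:R * expR (- (tau n - eta)) = kk n * expR eta.
  by rewrite opprB addrC expRD mulrA ntau.
have a1le : a1 <= (k n).+1%:R - n%:R * expR (- (tau n + eta)).
  by rewrite hiE /a1 mulrBr mulr1 lerD2r ler_nat.
have a2le : a2 <= n%:R * expR (- (tau n - eta)) - (k n)%:R by rewrite loE /a2 mulrBr mulr1.
have qk : expR (- (v / (2 * kk n))) ^+ k n = expR (- (v / 2)).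
  rewrite -expRM_natl; congr expR; rewrite -/(kk n); field; exact: kn0.
have mk : (k n)%:R * (m / kk n) = m by rewrite -/(kk n) mulrCA divff// mulr1.
have errE : 2 * (kk n * expR (- eta) / a1 ^+ 2 + kk n * expR eta / a2 ^+ 2) = D / kk n.
  rewrite /a1 /a2 /D; field; rewrite kn0 /=; apply/andP; split; exact: lt0r_neq0.
have errle : D / kk n <= e / 2 by rewrite ler_pdivrMr// mulrC -ler_pdivrMr.
have kd : (k n)%:R * (e / 2 / kk n) = e / 2 by rewrite -/(kk n) mulrCA divff// mulr1.
have [_ uh _ _ _] := log_quantile_props cF.
have := tuple_order_stat_cos c uh mphi knn lo0 lohi q01 dl0 win a10 a1le a20 a2le.
rewrite qk mk kd hiE loE errE distrC => h; apply: (le_trans h).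
by move: errle; move: (D / kk n) => x; lra.
Unshelve. all: by end_near.
Qed.

(** With [x = g * r], the determinant is nonnegative because [1 - 2 x + 2 x^4 - (1 - x - x^2)^2 = (x
    (1 - x))^2]. *)
Lemma limit_variance_det {R : realType} (g r : R) : g * r < 2^-1 ->
  let d1 := 1 - g * r in let d2 := 1 - 2 * g * r in
  0 < g ->
  0 < g ^+ 2 * (d2 + 2 * g ^+ 4 * r ^+ 4) / (d2 ^+ 3 * d1 ^+ 4) /\
  (g ^+ 2 * r * (d1 - g ^+ 2 * r ^+ 2) / (d2 ^+ 2 * d1 ^+ 3)) ^+ 2 <=
  g ^+ 2 * r ^+ 2 / (d2 * d1 ^+ 2) * (g ^+ 2 * (d2 + 2 * g ^+ 4 * r ^+ 4) / (d2 ^+ 3 * d1 ^+ 4)).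
Proof.
move=> gr d1 d2 g0.
have d20 : 0 < d2 by rewrite /d2 -mulrA; lra.
have d10 : 0 < d1 by rewrite /d1; lra.
have e4 : 2 * g ^+ 4 * r ^+ 4 = 2 * ((g * r) ^+ 2) ^+ 2 by ring.
split.
  rewrite divr_gt0// mulr_gt0 ?exprn_gt0// e4 ltr_pwDl// mulr_ge0//.
  exact: sqr_ge0.
have n1 : d1 != 0 by rewrite gt_eqF.
have n2 : d2 != 0 by rewrite gt_eqF.
rewrite -subr_ge0 [leRHS](_ : _ = (g ^+ 2 * r * (g * r) * (1 - g * r)) ^+ 2 / (d2 ^+ 2 * d1 ^+ 3) ^+ 2).
  by rewrite divr_ge0// sqr_ge0.
by rewrite /d1 /d2; rewrite /d1 in n1; rewrite /d2 in n2; field; apply/andP; split.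
Qed.

Unset Implicit Arguments.
Set Strict Implicit.
Set Printing Implicit Defensive.

Theorem theorem2 (R : realType) (d : measure_display) (T : measurableType d)
  (P : probability T R) (X : nat -> T -> R) (F : R -> R)
  (gamma rho : R) (A : R -> R) (r mu : R) (k : nat -> nat) :
  0 < gamma -> rho < 0 ->
  (* X_1, X_2, ... i.i.d. nonnegative with distribution function F *)
  (forall i, measurable_fun setT (X i)) ->
  mutually_independent P X ->
  (forall i (x : R), P [set w | X i w <= x] = (F x)%:E) ->
  (forall i w, 0 <= X i w) ->
  (* second-order condition on U(t) = F^<-(1 - 1/t) *)
  measurable_fun setT A ->
  ((\forall t \near +oo, 0 < A t) \/ (\forall t \near +oo, A t < 0)) ->
  A t @[t --> +oo] --> 0 ->
  (forall x : R, 0 < x ->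
     ((tail_quantile F (t * x) / tail_quantile F t - x `^ gamma) / A t)
       @[t --> +oo] --> x `^ gamma * (x `^ rho - 1) / rho) ->
  (* r and the intermediate sequence k = k(n) *)
  gamma * r < 2^-1 ->
  (\forall n \near \oo, (0 < k n)%N && (k n < n)%N) ->
  ((k n)%:R : R) @[n --> \oo] --> +oo ->
  (n%:R / (k n)%:R : R) @[n --> \oo] --> +oo ->
  (Num.sqrt (k n)%:R * A (n%:R / (k n)%:R)) @[n --> \oo] --> mu ->
  let dr := fun m : nat => 1 - m%:R * gamma * r in
  let nu1 := r / (dr 1%N * (dr 1%N - rho)) in
  let nu2 := (1 - rho - gamma ^+ 2 * r ^+ 2)
               / (dr 1%N ^+ 2 * (dr 1%N - rho) ^+ 2) in
  let s1 := gamma ^+ 2 * r ^+ 2 / (dr 2%N * dr 1%N ^+ 2) in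
  let s2 := gamma ^+ 2 * (dr 2%N + 2 * gamma ^+ 4 * r ^+ 4)
               / (dr 2%N ^+ 3 * dr 1%N ^+ 4) in
  let s12 := gamma ^+ 2 * r * (dr 1%N - gamma ^+ 2 * r ^+ 2)
               / (dr 2%N ^+ 2 * dr 1%N ^+ 3) in
  let Y := fun (n : nat) (w : T) =>
    (Num.sqrt (k n)%:R * (G_stat X n (k n) r 0 w - xi_ru gamma r 0),
     Num.sqrt (k n)%:R * (G_stat X n (k n) r 1 w - xi_ru gamma r 1)) in
  exists (d' : measure_display) (T' : measurableType d')
         (Q : probability T' R) (W1 W2 : T' -> R),
    centered_gaussian_vector Q W1 W2 s1 s2 s12 /\
    cvg_in_distribution P Y Q (fun w => (mu * nu1 + W1 w, mu * nu2 + W2 w)).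
Proof.
move=> g0 rho0 mX iX FE X0 mA Asgn A0 H2 gr kn kkoo nkoo kap dr nu1 nu2 s1 s2 s12 Y.
have d1E : dr 1%N = 1 - gamma * r by rewrite /dr mul1r.
have d2E : dr 2%N = 1 - 2 * gamma * r by [].
have [s20 s12le] := limit_variance_det gr g0.
rewrite -d1E -d2E in s20 s12le.
have [d' [T' [Q [W1 [W2 [mW1 mW2 gW cosW]]]]]] := gaussian_vector_exists s20 s12le.
exists d', T', Q, W1, W2; split=> //.
have mG u n : measurable_fun setT (fun w =>
    Num.sqrt (k n)%:R * (G_stat X n (k n) r u w - xi_ru gamma r u)).
  by apply: measurable_funM => //; apply: measurable_funB => //; exact: measurable_G_stat.
apply: cvg_in_distribution_cos => [n||a b c].
- by apply/measurable_fun_pairP; split; exact: mG.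
- by apply/measurable_fun_pairP; split; exact: measurable_funD.
have -> : \int[Q]_w cos (a * (mu * nu1 + W1 w) + b * (mu * nu2 + W2 w) + c) =
    expR (- (limit_variance gamma r a b / 2)) * cos (c + mu * limit_bias gamma r rho a b).
  (* The deterministic bias joins the phase, leaving a centred Gaussian vector. *)
  transitivity (\int[Q]_w cos (a * W1 w + b * W2 w + (c + mu * (a * nu1 + b * nu2)))).
    by apply: eq_Rintegral => w _; congr cos; ring.
  by rewrite cosW /limit_variance /limit_bias /nu1 /nu2 d1E d2E.
have h := @sample_cos_cvg R d T P X F A gamma rho r mu a b c k g0 rho0 mX iX FE X0 mA Asgn A0 H2 gr kn kkoo nkoo kap.
exact: h.
Qed.
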